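(* Fix $\gamma\ge0$, $\epsilon,\nu>0$ and constants $a_0,a_1,a_2,a_3>0$. There exist constants $C_0,C_1,C_2,C_3>0$, depending only on $(a_0,a_1,a_2,a_3)$ and $(\epsilon,\nu)$, such that the following holds for all integers $n,p\ge2$ and $q\ge1$. Let $(X_1,Y_1),\dots,(X_n,Y_n)$ be i.i.d. following the logistic regression model with true parameter $\beta_0\in\mathbb{R}^p$, where $\|\beta_0\|_2\le a_0$ and $J_0=\mathrm{supp}(\beta_0)$ satisfies $|J_0|\le q$. Suppose the covariates satisfy: (A1) $\mathbb{E}[(X_1^\top u)^2]\ge a_1$ for every $2q$-sparse unit vector $u\in\mathbb{R}^p$; (A2) $\mathbb{E}[|X_1^\top u|^3]\le a_2$ for every $2q$-sparse unit vector $u\in\mathbb{R}^p$; (A3) $|X_{1j}|\le a_3$ for each $j\in[p]$. If $$p\ge C_0,\qquad n\ge\max\Big\{C_1\cdot q^3\log(p),\; C_2\cdot\frac{q\log(np^{2\gamma})}{\min_{j\in J_0}|(\beta_0)_j|^2}\Big\},$$ and if $$\sqrt n>p^{(1+\epsilon)(1+\nu)-\gamma},$$ then the event that $$J_0=\arg\min\{\mathrm{BIC}_\gamma(J): J\subset[p],\ |J|\le q\}$$ (i.e. $J_0$ is the unique minimizer) has probability at least $$\Big(1-\exp\Big\{-C_3\cdot\frac{n}{q^3}\Big\}\Big)\Big(1-\frac1{p^\nu}\Big).$$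
   Context: $[p]=\{1,\dots,p\}$; $\mathrm{supp}(\beta_0)=\{j:(\beta_0)_j\neq0\}$; a vector is $k$-sparse if it has at most $k$ nonzero coordinates; a unit vector has Euclidean norm $1$. Logistic regression model: $X_i\in\mathbb{R}^p$ are random covariates, $Y_i\in\{0,1\}$, and $\log\frac{P(Y_i=1\mid X_i=x)}{1-P(Y_i=1\mid X_i=x)}=x^\top\beta_0$. With $\mathrm{b}(\theta)=\log(1+e^\theta)$ the log-likelihood is $\log \mathrm{L}(\beta)=\sum_{i=1}^n\big(Y_i\,X_i^\top\beta-\mathrm{b}(X_i^\top\beta)\big)$. For $J\subseteq[p]$, $\mathbb{R}^J$ is identified with the set of vectors in $\mathbb{R}^p$ that vanish outside $J$, and $\hat\beta_J$ is the maximum likelihood estimator in the model given by $J$, i.e. a maximizer of $\log\mathrm{L}$ over $\mathbb{R}^J$ (so $\log\mathrm{L}(\hat\beta_J)$ is the supremum of $\log \mathrm{L}$ over $\mathbb{R}^J$). The (extended) Bayesian information criterion is $\mathrm{BIC}_\gamma(J)=-2\log \mathrm{L}(\hat\beta_J)+|J|\big(\log(n)+2\gamma\log(p)\big)$. If $J_0=\emptyset$, the minimum over $J_0$ is read as $+\infty$ (the corresponding sample size requirement is then vacuous). *)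

(* Defs.v *)
From HB Require Import structures.
From mathcomp Require Import all_boot all_order all_algebra.
From mathcomp Require Import all_classical all_reals all_analysis.

Set Implicit Arguments.
Unset Strict Implicit.
Unset Printing Implicit Defensive.

Import Order.TTheory GRing.Theory Num.Theory.
Import numFieldNormedType.Exports.

Local Open Scope classical_set_scope.
Local Open Scope ring_scope.

(* Parameters are row vectors; covariates are tuples, since [p.-tuple R] is the
   type that carries the product (Borel) sigma-algebra of R^p. *)
Definition linpred (R : realType) (p : nat) (x : p.-tuple R) (b : 'rV[R]_p) : R :=
  \sum_(j < p) tnth x j * b ord0 j.

Definition supp (R : realType) (p : nat) (b : 'rV[R]_p) : {set 'I_p} :=
  [set j | b ord0 j != 0]%SET.

Definition sparse (R : realType) (p : nat) (k : nat) (b : 'rV[R]_p) : Prop :=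
  (#|supp b| <= k)%N.

(* The library norm on ['rV[R]_p] is the sup norm, hence this definition. *)
Definition norm2 (R : realType) (p : nat) (b : 'rV[R]_p) : R :=
  Num.sqrt (\sum_(j < p) b ord0 j ^+ 2).

(* Equal to +oo when [b = 0]. *)
Definition min_sq_signal (R : realType) (p : nat) (b : 'rV[R]_p) : \bar R :=
  \big[Order.min/+oo%E]_(j in supp b) (`|b ord0 j| ^+ 2)%:E.

Section likelihood.
Context {R : realType} {n p : nat}.
Implicit Types (x : 'I_n -> p.-tuple R) (y : 'I_n -> bool) (b : 'rV[R]_p).

Definition cumulant (theta : R) : R := ln (1 + expR theta).

Definition loglik x y b : R :=
  \sum_(i < n) ((y i)%:R * linpred (x i) b - cumulant (linpred (x i) b)).

(* R^J as a subset of R^p. *)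
Definition submodel (J : {set 'I_p}) : set 'rV[R]_p :=
  [set b | forall j, j \notin J -> b ord0 j = 0].

(* The log-likelihood at the MLE of the model J.  It is the supremum over R^J, so
   that it also makes sense for separable data, where no maximizer exists.  The
   set is nonempty and bounded above by 0, so [sup] is the true supremum. *)
Definition max_loglik x y (J : {set 'I_p}) : R :=
  sup [set loglik x y b | b in submodel J].

Definition BIC (gamma : R) x y (J : {set 'I_p}) : R :=
  - 2 * max_loglik x y J + #|J|%:R * (ln n%:R + 2 * gamma * ln p%:R).

Definition unique_BIC_minimizer (gamma : R) x y (q : nat) (J0 : {set 'I_p}) :
    Prop :=
  (#|J0| <= q)%N /\
  forall J : {set 'I_p}, (#|J| <= q)%N -> J != J0 ->
    BIC gamma x y J0 < BIC gamma x y J.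

End likelihood.

Section model.
Context {d : measure_display} {T : measurableType d} {R : realType}.
Context (P : probability T R).

Definition mutually_independent {d'} {U : measurableType d'} {n : nat}
    (Z : 'I_n -> T -> U) : Prop :=
  forall (K : {set 'I_n}) (B : 'I_n -> set U), (forall i, measurable (B i)) ->
    P [set w | forall i, i \in K -> B i (Z i w)] =
    (\prod_(i in K) P (Z i @^-1` B i))%E.

Definition identically_distributed {d'} {U : measurableType d'} {n : nat}
    (Z : 'I_n -> T -> U) : Prop :=
  forall (i k : 'I_n) (B : set U), measurable B ->
    P (Z i @^-1` B) = P (Z k @^-1` B).

(* [pr] is a version of x |-> P(Y = 1 | X = x). *)
Definition is_cond_prob {p : nat} (X : {RV P >-> p.-tuple R})
    (Y : {RV P >-> bool}) (pr : p.-tuple R -> R) : Prop :=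
  [/\ measurable_fun [set: p.-tuple R] pr,
      forall x, 0 <= pr x <= 1 &
      forall B : set (p.-tuple R), measurable B ->
        P [set w | B (X w) /\ Y w = true] =
        (\int[P]_(w in X @^-1` B) (pr (X w))%:E)%E].

Definition logistic_regression {p : nat} (X : {RV P >-> p.-tuple R})
    (Y : {RV P >-> bool}) (b : 'rV[R]_p) : Prop :=
  exists2 pr : p.-tuple R -> R, is_cond_prob X Y pr &
    forall x, 0 < pr x < 1 /\ ln (pr x / (1 - pr x)) = linpred x b.

Definition iid_logistic_sample {n p : nat} (X : 'I_n -> {RV P >-> p.-tuple R})
    (Y : 'I_n -> {RV P >-> bool}) (b : 'rV[R]_p) : Prop :=
  let Z := fun (i : 'I_n) (w : T) => (X i w, Y i w) in
  [/\ mutually_independent Z, identically_distributed Z &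
      forall i, logistic_regression (X i) (Y i) b].

End model.

(* Main.v *)
Require Import Defs.
From HB Require Import structures.
From mathcomp Require Import all_boot all_order all_algebra.
From mathcomp Require Import all_classical all_reals all_analysis.
From mathcomp Require Import measurable_realfun ring lra.

Set Implicit Arguments.
Unset Strict Implicit.
Unset Printing Implicit Defensive.

Import Order.TTheory GRing.Theory Num.Theory.
Import numFieldNormedType.Exports.

Local Open Scope classical_set_scope.
Local Open Scope ring_scope.

(* Idea.  Let H be the Fisher information of the true model, a random quadratic
   form, and N = sqrt H its norm.

   Design.  The entries of H concentrate by Hoeffding's inequality, and (A1), (A2)
   bound their expectation below on 2q-sparse vectors; hence N dominates the
   Euclidean norm there, and also n^(1/2) q^(-1/2) times the l1 norm.

   Given such a design, the log-likelihood near the truth is the score minus N^2/2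
   up to a cubic error controlled by N, and concavity makes the local picture
   decisive.  A model that misses a signal loses a multiple of N^2.  For a model J
   containing the true support J0, compare b0 + u with b0 + v, where v is the
   H-projection of u on R^J0: the gain is the score on the H-orthogonal complement,
   of dimension r = |J| - |J0|, with a relative error that is small because
   n >= C q^3 log p.  That complement has an H-orthonormal basis, the conditional
   moment generating function of the score is nearly Gaussian, and a union bound
   over integer coefficient vectors gives a chi-square tail with the sharp exponent
   (1 + eps/4)(1 + nu) r log p, summable over all J.

   Conditioning on the design amounts to integrating exp (loglik X y b0), the
   conditional probability of the response vector y. *)

(** * The logistic function *)

(** The obstacle is the sharp constant. There are up to p^r models with r spurious covariates, and
    the penalty per covariate is only assumed to exceed 2 (1 + eps) (1 + nu) log p, so no fixed
    fraction of log p can be wasted. The slack is spent in two stages: squared residual scores are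
    controlled at level 1 + eps/2, and their tail keeps exponent 1 + eps/4. The first gap pays for
    the cubic error of the likelihood, the second for rounding and for the non-Gaussian moment
    generating function.

    The power q^3 comes from the cubic error. With linear predictors at most eta N, eta of order
    sqrt(q / n), and scores at most S N, S of order sqrt(q log p), it shifts the residual score by
    32 eta S^2, whose square has order q^3 (log p)^2 / n and must be small against log p. The crude
    l1 bound behind S is affordable because S appears only where constants may be lost.

    Expansion errors are proportional to the logistic variance at the truth, so N measures them all.
    For separable data no maximizer exists, hence likelihood bounds are proved at every point of a
    submodel and passed to the supremum. Design and responses each fail with probability at most
    p^(-nu) / 2. *)

Section logistic_function.
Context {R : realType}.
Implicit Types (t a c s : R).

(** Squaring [expR (t / 2) <= (1 - t / 2)^-1] leaves a polynomial inequality, valid on this range of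
    [t]. *)
Lemma expR_le_quadratic t : `|t| <= 1 / 4 -> expR t <= 1 + t + t ^+ 2.
Proof.
rewrite ler_norml => /andP[t1 t2].
have h : 0 < 1 - t / 2 by lra.
have e1 : expR (t / 2) <= (1 - t / 2)^-1.
  rewrite -[t / 2]opprK expRN lef_pV2 ?posrE ?expR_gt0 ?opprK//.
  exact: expR_ge1Dx.
have -> : expR t = expR (t / 2) ^+ 2.
  by rewrite expr2 -expRD; congr expR; lra.
have : expR (t / 2) ^+ 2 <= (1 - t / 2)^-1 ^+ 2.
  by rewrite ler_sqr// nnegrE ?expR_ge0// invr_ge0 ltW.
move/le_trans; apply.
rewrite exprVn -div1r ler_pdivrMr ?exprn_gt0//.
nra.
Qed.

Definition sigmoid (t : R) : R := expR t / (1 + expR t).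
Definition logistic_var (t : R) : R := sigmoid t * (1 - sigmoid t).
(** The Bregman divergence of the cumulant. It is also the logarithm of E[exp (t (Y - m))] for a
    Bernoulli variable Y of mean m = [sigmoid s]: the first reading gives the loss of
    log-likelihood, the second the tails of the score. *)
Definition bregman (s t : R) : R := cumulant (s + t) - cumulant s - sigmoid s * t.

Lemma expR1D_gt0 t : 0 < 1 + expR t.
Proof. by rewrite addr_gt0// expR_gt0. Qed.

Lemma sigmoid_gt0 t : 0 < sigmoid t.
Proof. by rewrite divr_gt0 ?expR_gt0 ?expR1D_gt0. Qed.

Lemma onem_sigmoid t : 1 - sigmoid t = (1 + expR t)^-1.
Proof.
by rewrite /sigmoid; field; rewrite gt_eqF// expR1D_gt0.
Qed.

Lemma sigmoid_lt1 t : sigmoid t < 1.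
Proof. by rewrite -subr_gt0 onem_sigmoid invr_gt0 expR1D_gt0. Qed.

Lemma logistic_var_gt0 t : 0 < logistic_var t.
Proof. by rewrite mulr_gt0 ?sigmoid_gt0// subr_gt0 sigmoid_lt1. Qed.

Lemma logistic_var_ge0 t : 0 <= logistic_var t.
Proof. exact/ltW/logistic_var_gt0. Qed.

Lemma logistic_var_le t : logistic_var t <= 1 / 4.
Proof. by rewrite /logistic_var; have := sqr_ge0 (sigmoid t - 1/2); nra. Qed.

Lemma logistic_var_ge t : expR (- `|t|) / 4 <= logistic_var t.
Proof.
rewrite /logistic_var onem_sigmoid /sigmoid -mulrA -invfM.
have [t0|t0] := leP 0 t.
  rewrite ger0_norm// expRN ler_pdivlMr ?mulr_gt0 ?expR1D_gt0//.
  rewrite mulrAC ler_pdivrMr// mulrC ler_pdivrMr ?expR_gt0//.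
  have : 1 <= expR t by rewrite -expR0 ler_expR.
  nra.
rewrite ltr0_norm// opprK ler_pdivlMr ?mulr_gt0 ?expR1D_gt0//.
have : expR t <= 1 by rewrite -expR0 ler_expR ltW.
have := expR_gt0 t; nra.
Qed.

Lemma bregman0 s : bregman s 0 = 0.
Proof. by rewrite /bregman addr0 subrr mulr0 subr0. Qed.

Lemma expR_cumulant s : expR (cumulant s) = 1 + expR s.
Proof. by rewrite lnK// posrE expR1D_gt0. Qed.

(** With m = [sigmoid s], the exponential of the left member is (1 - m) e^(-mt) + m e^(t - mt).
    Tangent lines at 0 bound both exponentials below, and their linear terms cancel. *)
Lemma bregman_ge0 s t : 0 <= bregman s t.
Proof.
rewrite -subr_ge0 subr0 -[X in X <= _](expRK 0) -[X in _ <= X]expRK.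
rewrite ler_ln ?posrE ?expR_gt0// expR0.
rewrite /bregman !expRD !expRN !expR_cumulant expRD.
have -> : (1 + expR s * expR t) / (1 + expR s) =
   (1 - sigmoid s) + sigmoid s * expR t.
  rewrite onem_sigmoid /sigmoid; field; rewrite gt_eqF// expR1D_gt0.
have -> : (expR (sigmoid s * t))^-1 = expR (- (sigmoid s * t)) by rewrite expRN.
rewrite mulrDl -mulrA -expRD.
have := sigmoid_gt0 s; have := sigmoid_lt1 s; set m := sigmoid s => m1 m0.
have h1 := expR_ge1Dx (- (m * t)).
have h2 := expR_ge1Dx (t + - (m * t)).
nra.
Qed.

(** The Bregman inequalities from the intermediate point to both ends, weighted by 1 - l and l; the
    slopes cancel. *)
Lemma cumulant_convex s t l : 0 <= l <= 1 ->
  cumulant (s + l * t) <= (1 - l) * cumulant s + l * cumulant (s + t).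
Proof.
move=> /andP[l0 l1].
have h1 := bregman_ge0 (s + l * t) (- (l * t)).
have h2 := bregman_ge0 (s + l * t) ((1 - l) * t).
move: h1 h2; rewrite /bregman addrK.
have -> : s + l * t + (1 - l) * t = s + t by ring.
set A := cumulant _; set B := cumulant _; set C := cumulant _; set m := sigmoid _.
nra.
Qed.

Lemma is_derive_cumulant s : is_derive s 1 (@cumulant R) (sigmoid s).
Proof.
have h := is_derive1_ln (expR1D_gt0 s).
have h2 : is_derive s 1 (fun t => 1 + expR t) (0 + expR s).
  exact: is_deriveD.
have := @is_derive1_comp _ (@ln R) (fun t => 1 + expR t) s _ _ h h2.
by rewrite /sigmoid add0r mulrC.
Qed.

(** The increment equals v (e^t - 1) / (1 + m (e^t - 1)) with v the local variance. Keeping the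
    factor v in the error, as in self-concordance, lets later remainders be summed in the Fisher
    form however extreme the linear predictors are. *)
Lemma sigmoid_increment s t : `|t| <= 1 / 4 ->
  `|sigmoid (s + t) - sigmoid s - logistic_var s * t| <= logistic_var s * t ^+ 2.
Proof.
move=> t4.
have s0 := sigmoid_gt0 s; have s1 := sigmoid_lt1 s.
have v0 := logistic_var_gt0 s.
have e1 := expR_le_quadratic t4.
have e2 : expR (- t) <= 1 - t + t ^+ 2.
  by rewrite -[t ^+ 2]sqrrN; apply: expR_le_quadratic; rewrite normrN.
have e3 := expR_ge1Dx t.
have E0 := expR_gt0 t.
set m := sigmoid s in s0 s1 *.
have D0 : 0 < 1 + m * (expR t - 1) by nra.
have -> : sigmoid (s + t) - m - logistic_var s * t =
   logistic_var s * ((expR t - 1) / (1 + m * (expR t - 1)) - t).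
  rewrite /logistic_var /m /sigmoid expRD.
  have ? : 1 + expR s != 0 by rewrite gt_eqF// expR1D_gt0.
  have ? : 1 + expR s * expR t != 0 by rewrite gt_eqF// -expRD expR1D_gt0.
  field; apply/andP; split => //.
  by rewrite [X in X != _](_ : _ = (1 + expR s * expR t))//; ring.
rewrite normrM (gtr0_norm v0) ler_pM2l// ler_norml.
rewrite lerBrDr lerBlDr; apply/andP; split.
  rewrite ler_pdivlMr//.
  have h : (1 - expR (- t)) * expR t = expR t - 1.
    by rewrite expRN mulrBl mulVf ?gt_eqF// mul1r.
  have h3 : (t - t ^+ 2) * expR t <= expR t - 1.
    by rewrite -h ler_pM2r//; lra.
  apply: le_trans h3; rewrite addrC -subr_ge0.
  rewrite (_ : _ - _ = (t - t ^+ 2) * ((1 - m) * (expR t - 1))); last by ring.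
  move: t4; rewrite ler_norml => /andP[? ?].
  have [t0|t0] := leP 0 t.
    have : 1 <= expR t by rewrite -expR0 ler_expR.
    by move=> ?; rewrite !mulr_ge0//; nra.
  have : expR t <= 1 by rewrite -expR0 ler_expR ltW.
  by move=> ?; rewrite mulr_le0//; nra.
rewrite ler_pdivrMr//.
have [t0|t0] := leP 0 t.
  have : 1 <= expR t by rewrite -expR0 ler_expR.
  move=> ?; have : 0 <= (t ^+ 2 + t) * (m * (expR t - 1)) by rewrite !mulr_ge0//; nra.
  nra.
have : expR t <= 1 by rewrite -expR0 ler_expR ltW.
move: t4; rewrite ler_norml => /andP[? ?].
have : 0 <= - (t ^+ 2 + t) * (m * (1 - expR t)).
  by rewrite !mulr_ge0//; nra.
nra.
Qed.

Let remainder s t := bregman s t - logistic_var s / 2 * t ^+ 2.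

Let remainder_lip_lt s a c : a < c -> `|a| <= 1 / 4 -> `|c| <= 1 / 4 ->
  `|remainder s c - remainder s a| <= logistic_var s * (c - a) * (a ^+ 2 + c ^+ 2).
Proof.
move=> ac a4 c4.
have D t : is_derive t 1 (remainder s) (sigmoid (s + t) - sigmoid s - logistic_var s * t).
  rewrite /remainder /bregman.
  have h0 : is_derive t 1 (fun t => s + t) (0 + 1) by exact: is_deriveD.
  have := @is_derive1_comp _ (@cumulant R) (fun t => s + t) t _ _ (is_derive_cumulant _) h0.
  rewrite add0r mulr1 => h1.
  apply: is_derive_eq.
  by rewrite /GRing.scale/= subr0 !mulr1 -mulrA mulrDr ![2^-1 * t]mulrC -splitr.
have [|t tac ->] := MVT ac (fun t _ => D t).
  by apply: derivable_within_continuous => t _; apply: ex_derive.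
have t4 : `|t| <= 1 / 4.
  move: tac a4 c4; rewrite in_itv/= !ler_norml => /andP[? ?] /andP[? ?] /andP[? ?].
  by apply/andP; split; lra.
rewrite normrM (@gtr0_norm _ (c - a)) ?subr_gt0// [leRHS]mulrAC.
rewrite ler_pM2r ?subr_gt0//.
apply: le_trans (sigmoid_increment _ t4) _.
rewrite ler_pM2l ?logistic_var_gt0//.
move: tac; rewrite in_itv/= => /andP[? ?].
have [t0|t0] := leP 0 t; nra.
Qed.

(** The mean value theorem applied to the remainder gives the factor |a - c|, which two separate
    expansions at 0 would lose. It makes the error of comparing two nearby parameters proportional
    to their distance. *)
Lemma bregman_increment s a c : `|a| <= 1 / 4 -> `|c| <= 1 / 4 ->
  `|bregman s a - bregman s c - logistic_var s / 2 * (a ^+ 2 - c ^+ 2)| <=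
  logistic_var s * `|a - c| * (a ^+ 2 + c ^+ 2).
Proof.
move=> a4 c4.
have -> : bregman s a - bregman s c - logistic_var s / 2 * (a ^+ 2 - c ^+ 2) =
  remainder s a - remainder s c by rewrite /remainder; ring.
case: (ltgtP a c) => [ac|ca|->].
- rewrite distrC (le_trans (remainder_lip_lt _ ac a4 c4))//.
  by rewrite ltr0_norm ?subr_lt0// opprB.
- rewrite (le_trans (remainder_lip_lt _ ca c4 a4))//.
  by rewrite gtr0_norm ?subr_gt0// [a ^+ 2 + _]addrC.
- by rewrite !subrr normr0 mulr0 mul0r.
Qed.

Lemma bregman_quadratic s a : `|a| <= 1 / 4 ->
  `|bregman s a - logistic_var s / 2 * a ^+ 2| <= logistic_var s * `|a| * a ^+ 2.
Proof.
move=> a4; have := @bregman_increment s a 0 a4.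
rewrite normr0 bregman0 !subr0 expr0n/= subr0 addr0; apply; lra.
Qed.

End logistic_function.

(** * Expansion of the log-likelihood *)

Section finite_sums.
Context {R : realType} {I : finType}.
Implicit Types (a b : I -> R).

Lemma sum_cauchy_schwarz a b :
  (\sum_i a i * b i) ^+ 2 <= (\sum_i a i ^+ 2) * (\sum_i b i ^+ 2).
Proof.
set A := \sum_i a i ^+ 2; set B := \sum_i b i ^+ 2; set S := \sum_i a i * b i.
have A0 : 0 <= A by apply: sumr_ge0 => i _; exact: sqr_ge0.
have [A_eq0|A_neq0] := eqVneq A 0.
  have a0 i : a i = 0.
    apply/eqP; rewrite -sqrf_eq0; apply/eqP.
    by have /eqP := A_eq0; rewrite psumr_eq0 => [/allP/(_ i)|j _]; rewrite ?sqr_ge0// mem_index_enum => /(_ isT)/eqP.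
  by rewrite A_eq0 mul0r /S big1 ?expr0n//= => i _; rewrite a0 mul0r.
have Agt0 : 0 < A by rewrite lt_neqAle eq_sym A_neq0.
have : 0 <= \sum_i (A * b i - S * a i) ^+ 2.
  by apply: sumr_ge0 => i _; exact: sqr_ge0.
rewrite (eq_bigr (fun i => A ^+ 2 * b i ^+ 2 +
  (- 2 * A * S * (a i * b i) + S ^+ 2 * a i ^+ 2))) => [|i _]; last by ring.
rewrite !big_split/= -!mulr_sumr -/A -/B -/S.
rewrite (_ : _ + _ = A * (A * B - S ^+ 2)); last by ring.
by rewrite pmulr_rge0// subr_ge0.
Qed.

Lemma sqr_sum_le_card (A : {set I}) a :
  (forall i, i \notin A -> a i = 0) ->
  (\sum_i a i) ^+ 2 <= #|A|%:R * \sum_i a i ^+ 2.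
Proof.
move=> a0; have := sum_cauchy_schwarz (fun i => (i \in A)%:R) a.
rewrite (eq_bigr a) => [|i _]; last first.
  by case: (boolP (i \in A)) => [_|/a0 ->]; rewrite ?mul1r ?mulr0.
rewrite [X in _ <= X * _ -> _](_ : _ = #|A|%:R)// -sum1_card natr_sum.
rewrite [RHS]big_mkcond/=; apply: eq_bigr => i _.
by case: (i \in A); rewrite /= ?mulr0n ?mulr1n ?expr1n ?expr0n.
Qed.

End finite_sums.

Section linear_predictor.
Context {R : realType} {p : nat}.
Implicit Types (x : p.-tuple R) (u v : 'rV[R]_p) (J K : {set 'I_p}).

Definition norm1 u : R := \sum_j `|u ord0 j|.

Lemma linpredD x u v : linpred x (u + v) = linpred x u + linpred x v.
Proof. by rewrite -big_split; apply: eq_bigr => j _; rewrite mxE mulrDr. Qed.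

Lemma linpredZ x c u : linpred x (c *: u) = c * linpred x u.
Proof. by rewrite mulr_sumr; apply: eq_bigr => j _; rewrite mxE mulrCA. Qed.

Lemma linpredB x u v : linpred x (u - v) = linpred x u - linpred x v.
Proof. by rewrite -scaleN1r linpredD linpredZ mulN1r. Qed.

Lemma linpred0 x : linpred x 0 = 0.
Proof. by rewrite -(subrr 0) linpredB subrr. Qed.

Lemma linpred_le x u a : (forall j, `|tnth x j| <= a) ->
  `|linpred x u| <= a * norm1 u.
Proof.
move=> xa; rewrite (le_trans (ler_norm_sum _ _ _))// mulr_sumr.
by apply: ler_sum => j _; rewrite normrM ler_wpM2r.
Qed.

Lemma norm2_ge0 u : 0 <= norm2 u.
Proof. exact: sqrtr_ge0. Qed.

Lemma sqr_norm2 u : norm2 u ^+ 2 = \sum_j u ord0 j ^+ 2.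
Proof. by rewrite sqr_sqrtr// sumr_ge0// => j _; rewrite sqr_ge0. Qed.

Lemma norm2_coord_le u j : `|u ord0 j| <= norm2 u.
Proof.
rewrite -ler_sqr ?nnegrE ?norm2_ge0// sqr_norm2 (bigD1 j)//= real_normK ?num_real//.
by rewrite lerDl sumr_ge0// => k _; rewrite sqr_ge0.
Qed.

Lemma norm2_eq0 u : norm2 u = 0 -> u = 0.
Proof.
move=> u0; apply/rowP => j; rewrite mxE; apply/eqP; rewrite -normr_le0 -u0.
exact: norm2_coord_le.
Qed.

Lemma norm2_gt0 u : u != 0 -> 0 < norm2 u.
Proof.
move=> u0; rewrite lt_neqAle norm2_ge0 andbT eq_sym.
by apply: contra u0 => /eqP/norm2_eq0 ->.
Qed.

Lemma norm2Z c u : norm2 (c *: u) = `|c| * norm2 u.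
Proof.
rewrite /norm2 -sqrtr_sqr -sqrtrM ?sqr_ge0// mulr_sumr.
by congr Num.sqrt; apply: eq_bigr => j _; rewrite mxE exprMn.
Qed.

Lemma sqr_norm1_le k u : sparse k u -> norm1 u ^+ 2 <= k%:R * norm2 u ^+ 2.
Proof.
move=> su; rewrite sqr_norm2.
have u0 j : j \notin supp u -> `|u ord0 j| = 0.
  by rewrite inE negbK => /eqP ->; rewrite normr0.
apply: le_trans (sqr_sum_le_card u0) _.
under eq_bigr => i _ do rewrite real_normK ?num_real//.
by rewrite ler_wpM2r ?ler_nat// sumr_ge0// => j _; rewrite sqr_ge0.
Qed.

Lemma submodel_sparse J k u : (#|J| <= k)%N -> submodel J u -> sparse k u.
Proof.
move=> Jk Ju; apply: leq_trans Jk; apply: subset_leq_card; apply/fintype.subsetP => j.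
by rewrite inE; apply: contraR => /Ju ->.
Qed.

Lemma submodel0 J : submodel J (0 : 'rV[R]_p).
Proof. by move=> j _; rewrite mxE. Qed.

Lemma submodelD J u v : submodel J u -> submodel J v -> submodel J (u + v).
Proof. by move=> Ju Jv j jJ; rewrite mxE Ju// Jv// addr0. Qed.

Lemma submodelZ J c u : submodel J u -> submodel J (c *: u).
Proof. by move=> Ju j jJ; rewrite mxE Ju// mulr0. Qed.

Lemma submodelB J u v : submodel J u -> submodel J v -> submodel J (u - v).
Proof. by move=> Ju Jv; rewrite -scaleN1r; apply/submodelD/submodelZ. Qed.

Lemma submodel_sum J (I : finType) (c : I -> R) (e : I -> 'rV[R]_p) :
  (forall i, submodel J (e i)) -> submodel J (\sum_i c i *: e i).
Proof.
by move=> Je; elim/big_ind : _ => [|u v|i _]; [exact: submodel0|exact: submodelD|exact: submodelZ].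
Qed.

Lemma submodelS J K u : J \subset K -> submodel J u -> submodel K u.
Proof. by move=> /fintype.subsetP JK Ju j jK; rewrite Ju//; apply: contra jK => /JK. Qed.

Lemma submodel_supp u : submodel (supp u) u.
Proof. by move=> j; rewrite inE negbK => /eqP. Qed.

End linear_predictor.

Arguments submodel_supp {R p} u _ _.

Section loglik_expansion.
Context {R : realType} {n p : nat}.
Variables (x : 'I_n -> p.-tuple R) (b0 : 'rV[R]_p).
Implicit Types (u v w : 'rV[R]_p) (y : 'I_n -> bool) (J K : {set 'I_p}).

Let th i := linpred (x i) b0.

Definition fisher u v : R :=
  \sum_i logistic_var (th i) * (linpred (x i) u * linpred (x i) v).

Definition fisher_norm u : R := Num.sqrt (fisher u u).

Definition score y u : R :=
  \sum_i ((y i)%:R - sigmoid (th i)) * linpred (x i) u.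

Lemma fisherC u v : fisher u v = fisher v u.
Proof. by apply: eq_bigr => i _; rewrite (mulrC (linpred _ u)). Qed.

Lemma fisherDl u v w : fisher (u + v) w = fisher u w + fisher v w.
Proof. by rewrite -big_split/=; apply: eq_bigr => i _; rewrite linpredD; ring. Qed.

Lemma fisherZl c u w : fisher (c *: u) w = c * fisher u w.
Proof. by rewrite mulr_sumr/=; apply: eq_bigr => i _; rewrite linpredZ; ring. Qed.

Lemma fisherBl u v w : fisher (u - v) w = fisher u w - fisher v w.
Proof. by rewrite -scaleN1r fisherDl fisherZl mulN1r. Qed.

Lemma fisher0l w : fisher 0 w = 0.
Proof. by rewrite -(subrr 0) fisherBl subrr. Qed.

Lemma fisher_suml (I : finType) (c : I -> R) (e : I -> 'rV[R]_p) w :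
  fisher (\sum_i c i *: e i) w = \sum_i c i * fisher (e i) w.
Proof.
elim/big_ind2 : _ => [|? ? ? ? <- <-|i _]; [exact: fisher0l|exact: fisherDl|exact: fisherZl].
Qed.

Lemma fisher_ge0 u : 0 <= fisher u u.
Proof. by apply: sumr_ge0 => i _; rewrite mulr_ge0 ?logistic_var_ge0// -expr2 sqr_ge0. Qed.

Lemma fisher_norm_ge0 u : 0 <= fisher_norm u.
Proof. exact: sqrtr_ge0. Qed.

Lemma sqr_fisher_norm u : fisher_norm u ^+ 2 = fisher u u.
Proof. by rewrite sqr_sqrtr// fisher_ge0. Qed.

(** Cauchy-Schwarz with the variances as weights. The absolute values stay inside the sum because it
    is applied to cubic remainders of unknown sign. *)
Lemma fisher_abs_le u v :
  \sum_i logistic_var (th i) * (`|linpred (x i) u| * `|linpred (x i) v|) <=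
  fisher_norm u * fisher_norm v.
Proof.
rewrite -ler_sqr ?nnegrE ?mulr_ge0 ?fisher_norm_ge0//; last first.
  by apply: sumr_ge0 => i _; rewrite mulr_ge0 ?logistic_var_ge0// mulr_ge0.
rewrite exprMn !sqr_fisher_norm.
pose a z i := Num.sqrt (logistic_var (th i)) * `|linpred (x i) z|.
have sqa z i : a z i ^+ 2 = logistic_var (th i) * (linpred (x i) z * linpred (x i) z).
  by rewrite exprMn sqr_sqrtr ?logistic_var_ge0// real_normK ?num_real// -expr2.
rewrite [leLHS](_ : _ = (\sum_i a u i * a v i) ^+ 2); last first.
  congr (_ ^+ 2); apply: eq_bigr => i _; rewrite /a [RHS]mulrACA -expr2.
  by rewrite sqr_sqrtr// logistic_var_ge0.
apply: le_trans (sum_cauchy_schwarz _ _) _.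
by rewrite le_eqVlt; apply/orP; left; apply/eqP; congr (_ * _);
  apply: eq_bigr => i _; rewrite sqa.
Qed.

Lemma scoreD y u v : score y (u + v) = score y u + score y v.
Proof. by rewrite -big_split/=; apply: eq_bigr => i _; rewrite linpredD mulrDr. Qed.

Lemma scoreZ y c u : score y (c *: u) = c * score y u.
Proof. by rewrite mulr_sumr/=; apply: eq_bigr => i _; rewrite linpredZ; ring. Qed.

Lemma score0 y : score y 0 = 0.
Proof. by rewrite -(scale0r 0) scoreZ mul0r. Qed.

Lemma score_sum y (I : finType) (c : I -> R) (e : I -> 'rV[R]_p) :
  score y (\sum_i c i *: e i) = \sum_i c i * score y (e i).
Proof.
elim/big_ind2 : _ => [|? ? ? ? <- <-|i _]; [exact: score0|exact: scoreD|exact: scoreZ].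
Qed.

Lemma loglik_diff y u v :
  loglik x y (b0 + u) - loglik x y (b0 + v) = score y (u - v) -
  \sum_i (bregman (th i) (linpred (x i) u) - bregman (th i) (linpred (x i) v)).
Proof.
rewrite -!sumrB; apply: eq_bigr => i _.
by rewrite linpredB !linpredD /bregman -/(th i); ring.
Qed.

(** On this range the cubic error is at most half of the quadratic term, which is why the
    coefficient is 1/4 and not 1/2. *)
Lemma loglik_local y u : (forall i, `|linpred (x i) u| <= 1 / 4) ->
  loglik x y (b0 + u) <= loglik x y b0 + score y u - fisher u u / 4.
Proof.
move=> u4; have := loglik_diff y u 0; rewrite addr0 subr0 => /eqP.
rewrite subr_eq => /eqP ->; rewrite addrC -addrA lerD2l lerD2l lerNl opprK.
rewrite mulr_suml; apply: ler_sum => i _.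
rewrite linpred0 bregman0 subr0.
have := bregman_quadratic (th i) (u4 i).
rewrite ler_norml => /andP[+ _]; rewrite lerBrDr; apply: le_trans.
have := u4 i; have := logistic_var_gt0 (th i).
set v := logistic_var _; set a := linpred _ _ => v0 a4.
have : 0 <= (v * a ^+ 2) * (1 / 4 - `|a|).
  by rewrite mulr_ge0 ?subr_ge0// mulr_ge0 ?sqr_ge0 ?ltW.
lra.
Qed.

Lemma loglik_concave y u l : 0 <= l <= 1 ->
  loglik x y b0 + l * (loglik x y (b0 + u) - loglik x y b0) <=
  loglik x y (b0 + l *: u).
Proof.
move=> l01; rewrite /loglik -sumrB mulr_sumr -big_split/=.
apply: ler_sum => i _; rewrite !linpredD linpredZ -/(th i).
by have := cumulant_convex (th i) (linpred (x i) u) l01; lra.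
Qed.

(** The direction is shrunk to Fisher norm [s], where the local expansion applies, and concavity
    carries the slope found there out to [u]. This controls points arbitrarily far from the
    truth. *)
Lemma loglik_ray y u (eta S s : R) :
  (forall i, `|linpred (x i) u| <= eta * fisher_norm u) ->
  score y u <= S * fisher_norm u ->
  0 < s <= fisher_norm u -> eta * s <= 1 / 4 ->
  loglik x y (b0 + u) <= loglik x y b0 + fisher_norm u * (S - s / 4).
Proof.
move=> u_eta uS /andP[s0 sN] etas.
have N0 := lt_le_trans s0 sN; set N := fisher_norm u in u_eta uS sN N0 *.
have sN0 : 0 <= s / N by rewrite divr_ge0 ?ltW.
have sN1 : 0 <= s / N <= 1 by rewrite sN0/= ler_pdivrMr// mul1r.
have := loglik_concave y u sN1.
have h4 i : `|linpred (x i) ((s / N) *: u)| <= 1 / 4.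
  rewrite linpredZ normrM (ger0_norm sN0).
  rewrite (le_trans (ler_wpM2l sN0 (u_eta i)))//.
  by rewrite mulrCA -mulrA mulVf ?gt_eqF// mulr1.
move=> /le_trans/(_ (loglik_local y h4)).
rewrite -addrA lerD2l scoreZ fisherZl fisherC fisherZl -sqr_fisher_norm -/N => h.
rewrite -lerBlDl -(@ler_pM2l _ (s / N)) ?divr_gt0//.
apply: (le_trans h).
have := ler_wpM2l sN0 uS.
rewrite (_ : s / N * (S * N) = s * S); last by field; rewrite gt_eqF.
rewrite (_ : s / N * (s / N * N ^+ 2) = s ^+ 2); last by field; rewrite gt_eqF.
rewrite (_ : s / N * (N * _) = s * (S - s / 4)); last by field; rewrite gt_eqF.
lra.
Qed.

(** Here [v] is the Fisher projection of [u], so by Pythagoras the quadratic gain is -W^2 / 2, where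
    W is the norm of u - v. Both vectors have norm at most 4 S and predictors at most 4 eta S, so
    the cubic error is at most 4 eta S * W * 8 S = 32 eta S^2 W. *)
Lemma loglik_projection y u v (eta S rho : R) :
  0 <= eta ->
  (forall i, `|linpred (x i) u| <= eta * fisher_norm u) ->
  (forall i, `|linpred (x i) v| <= eta * fisher_norm v) ->
  fisher (u - v) v = 0 ->
  fisher_norm u <= 4 * S -> 16 * eta * S <= 1 ->
  score y (u - v) <= rho * fisher_norm (u - v) ->
  loglik x y (b0 + u) <= loglik x y (b0 + v) + (rho + 32 * eta * S ^+ 2) ^+ 2 / 2.
Proof.
move=> eta0 u_eta v_eta uv uS etaS uvrho.
set w := u - v in uv uvrho.
have uvw : u = w + v by rewrite /w subrK.
have pyth : fisher u u = fisher w w + fisher v v.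
  have -> : fisher u u = fisher (w + v) (w + v) by rewrite -uvw.
  rewrite fisherDl (fisherC w (w + v)) fisherDl (fisherC v (w + v)) fisherDl.
  by rewrite (fisherC v w) uv addr0 add0r.
have vu : fisher_norm v <= fisher_norm u.
  by rewrite ler_sqrt ?fisher_ge0// pyth lerDr fisher_ge0.
have vS := le_trans vu uS.
have u4 i : `|linpred (x i) u| <= eta * (4 * S) by rewrite (le_trans (u_eta i))// ler_wpM2l.
have v4 i : `|linpred (x i) v| <= eta * (4 * S) by rewrite (le_trans (v_eta i))// ler_wpM2l.
rewrite -lerBlDl loglik_diff -/w.
have B i : - (bregman (th i) (linpred (x i) u) - bregman (th i) (linpred (x i) v)) <=
   - (logistic_var (th i) * (linpred (x i) u * linpred (x i) u) / 2
      - logistic_var (th i) * (linpred (x i) v * linpred (x i) v) / 2)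
   + eta * (4 * S) * (logistic_var (th i) * (`|linpred (x i) w| * `|linpred (x i) u|)
     + logistic_var (th i) * (`|linpred (x i) w| * `|linpred (x i) v|)).
  have := @bregman_increment _ (th i) (linpred (x i) u) (linpred (x i) v).
  have h1 : `|linpred (x i) u| <= 1 / 4 by have := u4 i; lra.
  have h2 : `|linpred (x i) v| <= 1 / 4 by have := v4 i; lra.
  move=> /(_ h1 h2); rewrite -linpredB -/w.
  have := logistic_var_gt0 (th i).
  have := u4 i; have := v4 i.
  set t := logistic_var _; set a := linpred _ u; set c := linpred _ v.
  set z := linpred _ w; set M := eta * (4 * S) => cM aM t0.
  rewrite ler_norml => /andP[+ _].
  have -> : t * `|z| * (a ^+ 2 + c ^+ 2) = t * `|z| * (`|a| * `|a| + `|c| * `|c|).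
    by rewrite -!expr2 !real_normK ?num_real.
  have P : 0 <= t * `|z| by rewrite mulr_ge0// ltW.
  have : 0 <= t * `|z| * ((M - `|a|) * `|a| + (M - `|c|) * `|c|).
    by rewrite mulr_ge0// addr_ge0// mulr_ge0// subr_ge0.
  lra.
rewrite -sumrN; set W := fisher_norm w.
apply: le_trans (_ : score y w - W ^+ 2 / 2 + eta * (4 * S) * (W * (fisher_norm u + fisher_norm v)) <= _).
  rewrite -addrA lerD2l (le_trans (ler_sum _ (fun i _ => B i)))//.
  rewrite big_split/= sumrN sumrB -!mulr_suml -!/(fisher _ _) pyth.
  rewrite sqr_fisher_norm -mulr_sumr big_split/= mulrDr.
  apply: lerD; first by lra.
  rewrite -mulrDr ler_wpM2l//; last by rewrite mulrDr lerD// fisher_abs_le.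
  rewrite mulr_ge0// mulr_ge0//; have := fisher_norm_ge0 u; lra.
have W0 : 0 <= W by exact: fisher_norm_ge0.
have S0 : 0 <= S by have := fisher_norm_ge0 u; lra.
have : eta * (4 * S) * (W * (fisher_norm u + fisher_norm v)) <= eta * (4 * S) * (W * (8 * S)).
  by rewrite ler_wpM2l ?mulr_ge0// ler_wpM2l//; lra.
(* Completing the square eliminates W: k W - W^2 / 2 <= k^2 / 2 with k = rho + 32 eta S^2. *)
have := sqr_ge0 (rho + 32 * eta * S ^+ 2 - W).
rewrite -/W in uvrho.
nra.
Qed.

Lemma loglik_le0 y b : loglik x y b <= 0.
Proof.
apply: sumr_le0 => i _; rewrite subr_le0 /cumulant.
set t := linpred _ _.
case: (y i); rewrite ?mul1r ?mul0r; last by rewrite ln_ge0// lerDl expR_ge0.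
rewrite -{1}(expRK t) ler_ln ?posrE ?expR_gt0 ?expR1D_gt0//.
by rewrite lerDr.
Qed.

Lemma max_loglik_ge y J b : submodel J b -> loglik x y b <= max_loglik x y J.
Proof.
move=> Jb; apply: sup_upper_bound; last by exists b.
split; first by exists (loglik x y b), b.
by exists 0 => _ [c _ <-]; exact: loglik_le0.
Qed.

Lemma max_loglik_le y J t : (forall b, submodel J b -> loglik x y b <= t) ->
  max_loglik x y J <= t.
Proof.
move=> h; apply: ge_sup; first by exists (loglik x y 0), 0 => //; exact: submodel0.
by move=> _ [b Jb <-]; exact: h.
Qed.

(** Only the first [m] values of [e] count. Indexing by [nat] lets a basis be enlarged without
    renaming its vectors. *)
Definition fisher_basis J (m : nat) (e : nat -> 'rV[R]_p) : Prop :=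
  [/\ forall i, (i < m)%N -> submodel J (e i),
      forall i j, (i < m)%N -> (j < m)%N -> fisher (e i) (e j) = (i == j)%:R &
      forall u, submodel J u -> u = \sum_(i < m) fisher u (e i) *: e i].

(** A Gram-Schmidt step. The residual [f0] of the j-th unit vector has j-th coordinate 1, so it is
    nonzero, and subtracting u_j [f0] from [u] lands in the submodel of [J], where the old basis
    expands it. *)
Lemma fisher_basis_setU1 J m e j : fisher_basis J m e -> j \notin J ->
  (forall u, submodel (j |: J) u -> u != 0 -> 0 < fisher u u) ->
  exists f, fisher_basis (j |: J) m.+1 (fun i => if i == m then f else e i).
Proof.
move=> [eJ eo ebasis] jJ pos.
have [dj djE] : exists dj : 'rV[R]_p, forall k, dj ord0 k = (k == j)%:R.
  by exists (delta_mx ord0 j) => k; rewrite mxE eqxx.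
have [P PJ PE] : exists2 P : 'rV[R]_p, submodel J P &
    P = \sum_(i < m) fisher dj (e i) *: e i.
  by exists (\sum_(i < m) fisher dj (e i) *: e i) => //; apply: submodel_sum => i; exact: eJ.
have [f0 f0P] : exists f0 : 'rV[R]_p, f0 = dj - P by exists (dj - P).
have f0E k : f0 ord0 k = (k == j)%:R - P ord0 k.
  by rewrite f0P mxE djE; congr (_ + _); rewrite mxE.
have JjJ : J \subset j |: J by exact: finset.subsetUr.
have f0J : submodel (j |: J) f0.
  move=> k; rewrite !inE negb_or => /andP[/negbTE kj kJ].
  by rewrite f0E kj PJ// subrr.
have f0j : f0 ord0 j = 1 by rewrite f0E eqxx PJ// subr0.
have f0_neq0 : f0 != 0.
  by apply/eqP => /rowP/(_ j)/eqP; rewrite f0j mxE oner_eq0.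
have f0pos := pos _ f0J f0_neq0.
have f0e i : (i < m)%N -> fisher f0 (e i) = 0.
  move=> im; rewrite f0P fisherBl PE fisher_suml (bigD1 (Ordinal im))//= big1 => [|k /negbTE ki].
    by rewrite eo// eqxx mulr1 addr0 subrr.
  by rewrite eo// -val_eqE/= in ki *; rewrite ki mulr0.
have [N N0 NE] : exists2 N, 0 < N & fisher f0 f0 = N ^+ 2.
  by exists (fisher_norm f0); rewrite ?sqr_fisher_norm// sqrtr_gt0.
have [f fP] : exists f, f = N^-1 *: f0 by exists (N^-1 *: f0).
have ffE u : fisher u f = N^-1 * fisher u f0.
  by rewrite fisherC fP fisherZl fisherC.
have fe i : (i < m)%N -> fisher f (e i) = 0.
  by move=> im; rewrite fP fisherZl f0e// mulr0.
have ff : fisher f f = 1.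
  by rewrite ffE fP fisherZl NE; field; rewrite gt_eqF.
exists f; split => [i|i k|u uJ].
- rewrite ltnS leq_eqVlt; case: eqVneq => [_ _|_ /= im].
    by rewrite fP; exact: submodelZ.
  by apply: submodelS (eJ _ im).
- rewrite !ltnS (leq_eqVlt i) (leq_eqVlt k).
  have [->|im] := eqVneq i m; have [->|km] := eqVneq k m => //= li lk.
  + exact: fe.
  + by rewrite fisherC fe// (ltn_eqF li).
  + exact: eo.
- have [u' u'P] : exists u' : 'rV[R]_p, u' = u - u ord0 j *: f0.
    by exists (u - u ord0 j *: f0).
  have u'E0 k : u' ord0 k = u ord0 k - u ord0 j * f0 ord0 k.
    by rewrite u'P mxE; congr (_ + _); rewrite mxE; congr (- _); rewrite mxE.
  have u'J : submodel J u'.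
    move=> k kJ; rewrite u'E0; have [->|kj] := eqVneq k j.
      by rewrite f0j mulr1 subrr.
    have kjJ : k \notin j |: J by rewrite !inE negb_or kj.
    by rewrite uJ// f0J// mulr0 subr0.
  have u'E : u' = \sum_(i < m) fisher u (e i) *: e i.
    rewrite {1}(ebasis _ u'J); apply: eq_bigr => i _.
    by rewrite u'P fisherBl fisherZl f0e// mulr0 subr0.
  rewrite big_ord_recr/= eqxx.
  under eq_bigr => i _ do rewrite (ltn_eqF (ltn_ord i)).
  rewrite -u'E.
  have fu : fisher u f0 = u ord0 j * N ^+ 2.
    have -> : fisher u f0 = fisher u' f0 + u ord0 j * fisher f0 f0.
      by rewrite -fisherZl -fisherDl u'P subrK.
    rewrite NE u'E fisher_suml big1 ?add0r// => i _.
    by rewrite [fisher (e i) _]fisherC f0e// mulr0.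
  rewrite ffE fu fP scalerA.
  rewrite (_ : N^-1 * _ * N^-1 = u ord0 j); last by field; rewrite gt_eqF.
  by rewrite u'P subrK.
Qed.

(** The old vectors are kept, so the new ones form an orthonormal basis of the Fisher complement of
    [J] in [K]. *)
Lemma fisher_basis_extend J K m e : fisher_basis J m e -> J \subset K ->
  (forall u, submodel K u -> u != 0 -> 0 < fisher u u) ->
  exists2 e', (forall i, (i < m)%N -> e' i = e i) &
              fisher_basis K (m + #|K :\: J|) e'.
Proof.
move=> Je JK pos; move: {2}#|_| (erefl #|K :\: J|) => r.
elim: r J m e Je JK => [|r IH] J m e Je JK rE.
  exists e => //; rewrite rE addn0.
  suff -> : K = J by [].
  apply/eqP; rewrite finset.eqEsubset JK andbT -finset.setD_eq0; apply/eqP/cards0_eq; exact: rE.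
have /card_gt0P[j jKJ] : (0 < #|K :\: J|)%N by rewrite rE.
move: (jKJ); rewrite inE => /andP[jJ jK].
have jJK : j |: J \subset K by rewrite finset.subUset finset.sub1set jK.
have [f Jf] := fisher_basis_setU1 Je jJ (fun u uJ => pos u (submodelS jJK uJ)).
have rE' : #|K :\: (j |: J)| = r.
  by move: rE; rewrite (cardsD1 j) jKJ add1n finset.setDDl finset.setUC => -[].
have [e' e'E be'] := IH _ _ _ Jf jJK rE'.
exists e' => [i im|]; last by rewrite rE addnS -addSn -rE'.
by rewrite e'E 1?ltnW// (ltn_eqF im).
Qed.

Lemma fisher_basis0 : fisher_basis finset.set0 0 (fun=> 0).
Proof.
split => // u u0; rewrite big_ord0; apply/rowP => j.
by rewrite mxE u0// inE.
Qed.

End loglik_expansion.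

(** * Tail bounds for the score *)

Section lattice_tail.
Context {R : realType} {r : nat}.

(** An integer of absolute value at most M, as sign and magnitude. Zero is coded twice, which is
    harmless in upper bounds. *)
Let lattice_pt M (a : bool * 'I_M.+1) : R := (-1) ^+ a.1 * a.2%:R.

Let sqr_lattice_pt M (a : bool * 'I_M.+1) : lattice_pt a ^+ 2 = a.2%:R ^+ 2.
Proof. by rewrite exprMn sqrr_sign mul1r. Qed.

(** Rounding is towards 0: it never lengthens the vector and changes the coordinate by less than
    1. *)
Let round_coord M (b : R) : `|b| <= M%:R ->
  exists a : bool * 'I_M.+1, lattice_pt a ^+ 2 <= b ^+ 2 /\
    forall c : R, 0 <= c -> c * b * b - c * `|b| <= lattice_pt a * (c * b).
Proof.
move=> bM; pose m := Num.truncn `|b|.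
have /andP[m1 m2] := truncn_itv (normr_ge0 b); rewrite -/m in m1 m2.
have mM : (m < M.+1)%N by rewrite ltnS -(ler_nat R) (le_trans m1).
exists (b < 0, Ordinal mM); split => [|c c0].
  by rewrite sqr_lattice_pt/= -[leRHS]real_normK ?num_real// ler_sqr ?nnegrE.
rewrite /lattice_pt/=; move: m1 m2; rewrite -natr1; set m' := m%:R => m1 m2.
have [b0|b0] := ltP b 0; rewrite ?expr1 ?expr0.
  rewrite ltr0_norm// in m1 m2 *.
  have : 0 <= c * (- b) * (m' + 1 + b) by rewrite !mulr_ge0//; lra.
  nra.
rewrite ger0_norm// in m1 m2 *.
have : 0 <= c * b * (m' + 1 - b) by rewrite !mulr_ge0//; lra.
nra.
Qed.

(** The vector [z] is rescaled to length rho and rounded coordinatewise. The inner product loses at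
    most Z / rho times the l1 norm of the rescaled vector, and that norm is at most sqrt(r) rho <=
    kappa rho^2. *)
Let round_vector M (z : 'I_r -> R) (rho kappa : R) : 0 < rho -> rho <= M%:R ->
  0 <= kappa <= 1 -> r%:R <= (kappa * rho) ^+ 2 -> rho ^+ 2 < \sum_k z k ^+ 2 ->
  exists f : {ffun 'I_r -> bool * 'I_M.+1},
    \sum_k lattice_pt (f k) ^+ 2 <= rho ^+ 2 /\
    (1 - kappa) * rho ^+ 2 <= \sum_k lattice_pt (f k) * z k.
Proof.
move=> rho0 rhoM /andP[k0 k1] rk rhoz; set Z2 := \sum_k z k ^+ 2 in rhoz.
have Z2pos : 0 < Z2 by rewrite (le_lt_trans _ rhoz)// sqr_ge0.
pose Z := Num.sqrt Z2; have Z0 : 0 < Z by rewrite sqrtr_gt0.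
have ZE : Z ^+ 2 = Z2 by rewrite sqr_sqrtr// ltW.
have rhoZ : rho < Z by rewrite -ltr_sqr ?nnegrE ?ltW// ZE.
pose b k := rho / Z * z k.
have sumb : \sum_k b k ^+ 2 = rho ^+ 2.
  under eq_bigr => k _ do rewrite exprMn.
  by rewrite -mulr_sumr -/Z2 -ZE; field; rewrite gt_eqF.
have bM k : `|b k| <= M%:R.
  apply: le_trans rhoM; rewrite -ler_sqr ?nnegrE ?normr_ge0 ?(ltW rho0)//.
  rewrite real_normK ?num_real// -sumb (bigD1 k)//= lerDl.
  by apply: sumr_ge0 => i _; exact: sqr_ge0.
have [f fP] := choice (fun k => round_coord (bM k)).
exists [ffun k => f k]; split.
  rewrite -sumb; apply: ler_sum => k _; rewrite ffunE; exact: (fP k).1.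
pose c := Z / rho; have c0 : 0 <= c by rewrite divr_ge0 ?ltW.
have zE k : z k = c * b k by rewrite /c /b; field; rewrite !gt_eqF.
apply: (@le_trans _ _ (\sum_k (c * b k * b k - c * `|b k|))); last first.
  apply: ler_sum => k _; rewrite ffunE (zE k).
  exact: (fP k).2.
rewrite sumrB -mulr_sumr; under eq_bigr => k _ do rewrite -mulrA -expr2.
rewrite -mulr_sumr sumb.
have h : \sum_k `|b k| <= kappa * rho ^+ 2.
  rewrite -ler_sqr ?nnegrE ?mulr_ge0 ?sqr_ge0 ?sumr_ge0 ?(ltW rho0)//.
  apply: (@le_trans _ _ (r%:R * rho ^+ 2)).
    have := @sqr_sum_le_card R _ [set: 'I_r]%SET (fun k => `|b k|).
    rewrite cardsT card_ord; under [X in _ * X]eq_bigr => k _ do rewrite real_normK ?num_real//.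
    by rewrite sumb; apply => k; rewrite inE.
  by rewrite [leRHS](_ : _ = (kappa * rho) ^+ 2 * rho ^+ 2) ?ler_wpM2r ?sqr_ge0//; ring.
have cE : 1 <= c by rewrite ler_pdivlMr// mul1r ltW.
have := ler_wpM2l c0 h; have : 0 <= (c - 1) * ((1 - kappa) * rho ^+ 2).
  by rewrite mulr_ge0 ?subr_ge0// mulr_ge0 ?sqr_ge0// subr_ge0.
lra.
Qed.

(** The sum factorizes over the coordinates. Since m <= m^2, each factor is dominated by two
    geometric series, one for each sign. *)
Let sum_lattice_weight_le M (kappa : R) : 0 < kappa ->
  \sum_(f : {ffun 'I_r -> bool * 'I_M.+1})
     expR (- (kappa / 2 * \sum_k lattice_pt (f k) ^+ 2)) <=
  (2 / (1 - expR (- (kappa / 2)))) ^+ r.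
Proof.
move=> k0; set x := expR _.
have x1 : x < 1 by rewrite expR_lt1; lra.
have x0 : 0 < x by exact: expR_gt0.
under eq_bigr => f _.
  rewrite mulr_sumr -sumrN expR_sum.
  over.
rewrite -(bigA_distr_bigA (fun (_ : 'I_r) (a : bool * 'I_M.+1) =>
  expR (- (kappa / 2 * lattice_pt a ^+ 2))))/=.
rewrite prodr_const card_ord lerXn2r ?nnegrE ?sumr_ge0//.
  by rewrite divr_ge0// subr_ge0 ltW.
rewrite -(pair_bigA _ (fun a b => expR (- (kappa / 2 * lattice_pt (a, b) ^+ 2))))/=.
have geom : \sum_(i < M.+1) x ^+ i <= 1 / (1 - x).
  rewrite ler_pdivlMr ?subr_gt0// mulrC -opprB mulNr -subrX1 opprB lerBlDr lerDl.
  by rewrite exprn_ge0// ltW.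
apply: (@le_trans _ _ (\sum_(b : bool) \sum_(i < M.+1) x ^+ i)).
  apply: ler_sum => b _; apply: ler_sum => i _.
  rewrite sqr_lattice_pt/= /x -expRM_natl ler_expR mulrN lerN2 mulrC.
  have k2 : 0 <= kappa / 2 by lra.
  rewrite ler_wpM2l// -natrX ler_nat.
  by case: (nat_of_ord i) => // k; rewrite expnS expn1 leq_pmulr.
rewrite big_bool/=; lra.
Qed.

(* A vector longer than [rho] has a large inner product with an integer vector
   of length at most [rho], because rounding costs at most [sqrt r], which is
   negligible against [rho].  The union bound over integer vectors then
   replaces the volumetric net of the usual chi-square tail argument. *)
Lemma lattice_tail (Y : finType) (q : Y -> R) (z : Y -> 'I_r -> R)
    (rho kappa delta : R) :
  (forall y, 0 <= q y) -> 0 < rho -> 0 < kappa <= 1 -> 0 <= delta ->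
  r%:R <= (kappa * rho) ^+ 2 ->
  (forall eta : 'I_r -> R, \sum_k eta k ^+ 2 <= rho ^+ 2 ->
    \sum_y q y * expR (\sum_k eta k * z y k) <=
    expR ((1 + delta) / 2 * \sum_k eta k ^+ 2)) ->
  \sum_(y | rho ^+ 2 < \sum_k z y k ^+ 2) q y <=
  (2 / (1 - expR (- (kappa / 2)))) ^+ r *
  expR (- ((1 - 3 * kappa - delta) * rho ^+ 2 / 2)).
Proof.
move=> q0 rho0 /andP[k0 k1] d0 rk mgf.
pose M := (Num.truncn rho).+1.
have rhoM : rho <= M%:R by have /andP[_ /ltW] := truncn_itv (ltW rho0).
pose F := {ffun 'I_r -> bool * 'I_M.+1}.
pose len (f : F) : R := \sum_k lattice_pt (f k) ^+ 2.
pose ip (f : F) y := \sum_k lattice_pt (f k) * z y k.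
apply: (@le_trans _ _ (\sum_y q y * \sum_(f : F | len f <= rho ^+ 2)
    expR (ip f y - (1 - kappa) * rho ^+ 2))).
  rewrite big_mkcond/=; apply: ler_sum => y _; case: ifPn => [zy|_]; last first.
    by rewrite mulr_ge0// sumr_ge0// => f _; exact: expR_ge0.
  have k01 : 0 <= kappa <= 1 by rewrite ltW.
  have [f [lf ipf]] := round_vector rho0 rhoM k01 rk zy.
  rewrite ler_peMr// (bigD1 f)//= ler_wpDr//.
    by rewrite sumr_ge0// => g _; exact: expR_ge0.
  by rewrite -[leLHS]expR0 ler_expR subr_ge0.
under eq_bigr => y _ do rewrite mulr_sumr.
rewrite exchange_big/=.
(* A factor exp(-(kappa / 2) len f) is set aside to make the sum over lattice points bounded
   independently of rho. What remains increases with len f, and at len f = rho^2 its exponent is -(1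
   - 3 kappa - delta) rho^2 / 2. *)
apply: (@le_trans _ _ (\sum_(f : F) expR (- (kappa / 2 * len f)) *
    expR (- ((1 - 3 * kappa - delta) * rho ^+ 2 / 2)))).
  rewrite big_mkcond/=; apply: ler_sum => f _; case: ifPn => [lf|_]; last first.
    by rewrite mulr_ge0// expR_ge0.
  under eq_bigr => y _ do rewrite expRD mulrA.
  rewrite -mulr_suml.
  apply: le_trans (ler_wpM2r (expR_ge0 _) (mgf _ lf)) _.
  rewrite -!expRD ler_expR -/(len f).
  have : 0 <= (1 + delta + kappa) * (rho ^+ 2 - len f).
    by rewrite mulr_ge0 ?subr_ge0//; lra.
  lra.
by rewrite -mulr_suml ler_wpM2r ?expR_ge0// sum_lattice_weight_le.
Qed.

End lattice_tail.

Section score_tails.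
Context {R : realType} {n p : nat}.
Variables (x : 'I_n -> p.-tuple R) (b0 : 'rV[R]_p).
Implicit Types (u v w : 'rV[R]_p) (y : {ffun 'I_n -> bool}) (J K : {set 'I_p}).

Let th i := linpred (x i) b0.

(** The conditional moment generating function of the score. Given the design the responses are
    independent, so the sum over response vectors is a product of two-term sums, each a Bernoulli
    moment generating function. *)
Lemma sum_expR_loglik_score u :
  \sum_(y : {ffun 'I_n -> bool}) expR (loglik x y b0) * expR (score x b0 y u) =
  expR (\sum_i bregman (th i) (linpred (x i) u)).
Proof.
pose F (i : 'I_n) (b : bool) := expR (b%:R * th i - cumulant (th i) +
  (b%:R - sigmoid (th i)) * linpred (x i) u).
under eq_bigr => y _ do rewrite -expRD -big_split expR_sum.
rewrite -(bigA_distr_bigA F) expR_sum; apply: eq_bigr => i _.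
rewrite big_bool /F mul1r mul0r sub0r mulrBl mul1r sub0r.
set s := th i; set t := linpred _ u; set m := sigmoid s.
have -> : s - cumulant s + (t - m * t) = (s + t) + (- cumulant s - m * t) by ring.
rewrite mulNr /= expRD -[X in _ + X](mul1r (expR _)) -mulrDl.
rewrite [expR (s + t) + 1]addrC -expR_cumulant -expRD /bregman -/m.
by congr expR; ring.
Qed.

Lemma sum_expR_loglik :
  \sum_(y : {ffun 'I_n -> bool}) expR (loglik x y b0) = 1.
Proof.
have := sum_expR_loglik_score 0.
under eq_bigr => y _ do rewrite score0 expR0 mulr1.
move=> ->; rewrite big1 ?expR0// => i _.
by rewrite linpred0 bregman0.
Qed.

(** The Gaussian exponent up to the factor 1 + 2a, which tends to 1 with the predictors; this
    near-exactness preserves the sharp tail exponent. *)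
Lemma bregman_le (s t a : R) : `|t| <= a -> a <= 1 / 4 ->
  bregman s t <= (1 + 2 * a) / 2 * (logistic_var s * (t * t)).
Proof.
move=> ta a4; have t4 := le_trans ta a4.
have := bregman_quadratic s t4; rewrite ler_norml => /andP[_].
rewrite lerBlDr expr2; move/le_trans; apply.
have : 0 <= (a - `|t|) * (logistic_var s * (t * t)).
  by rewrite mulr_ge0 ?subr_ge0// mulr_ge0 ?logistic_var_ge0// -expr2 sqr_ge0.
nra.
Qed.

(** Chernoff's bound for both signs. Variances are at most 1/4 and the correction factor at most
    3/2, so each observation contributes at most (3/16) (t a)^2, rounded up to 1/4. *)
Lemma coordinate_score_tail (a t c : R) (j : 'I_p) :
  (forall i, `|tnth (x i) j| <= a) -> 0 <= t -> t * a <= 1 / 4 ->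
  \sum_(y : {ffun 'I_n -> bool} | c < `|score x b0 y (delta_mx ord0 j)|)
     expR (loglik x y b0) <=
  2 * expR (n%:R * (t * a) ^+ 2 / 4 - t * c).
Proof.
move=> xa t0 ta; set e := delta_mx ord0 j.
have xe i : linpred (x i) e = tnth (x i) j.
  rewrite /linpred (bigD1 j)//= mxE !eqxx mulr1 big1 ?addr0// => k kj.
  by rewrite mxE (negbTE kj) mulr0.
have M s : `|s| = t -> \sum_(y : {ffun 'I_n -> bool}) expR (loglik x y b0) * expR (score x b0 y (s *: e)) <=
    expR (n%:R * (t * a) ^+ 2 / 4).
  move=> st; rewrite sum_expR_loglik_score ler_expR.
  rewrite -mulrA mulr_natl -[X in _ *+ X](card_ord n) -sumr_const.
  apply: ler_sum => i _; rewrite linpredZ xe.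
  have h : `|s * tnth (x i) j| <= t * a by rewrite normrM st ler_wpM2l.
  apply: le_trans (bregman_le (th i) h ta) _.
  have a0 := le_trans (normr_ge0 _) h.
  have h2 : s * tnth (x i) j * (s * tnth (x i) j) <= (t * a) ^+ 2.
    by rewrite -expr2 -[leLHS]real_normK ?num_real// ler_sqr ?nnegrE.
  have h3 := logistic_var_le (th i); have h4 := logistic_var_ge0 (th i).
  have h5 : logistic_var (th i) * (s * tnth (x i) j * (s * tnth (x i) j)) <=
            1 / 4 * (t * a) ^+ 2.
    by rewrite ler_pM// -expr2 sqr_ge0.
  apply: (@le_trans _ _ ((1 + 2 * (t * a)) / 2 * (1 / 4 * (t * a) ^+ 2))).
    by rewrite ler_wpM2l//; lra.
  have : 0 <= (1 / 4 - t * a) * (t * a) ^+ 2 by rewrite mulr_ge0 ?sqr_ge0 ?subr_ge0.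
  have := sqr_ge0 (t * a); lra.
have T s : `|s| = t -> \sum_(y : {ffun 'I_n -> bool} | t * c < score x b0 y (s *: e)) expR (loglik x y b0) <=
    expR (n%:R * (t * a) ^+ 2 / 4 - t * c).
  move=> st; rewrite expRD.
  apply: le_trans (ler_wpM2r (expR_ge0 _) (M s st)).
  rewrite mulr_suml big_mkcond/=; apply: ler_sum => y _; case: ifPn => [ys|_].
    by rewrite -mulrA ler_peMr ?expR_ge0// -expRD -[leLHS]expR0 ler_expR subr_ge0 ltW.
  by rewrite !mulr_ge0 ?expR_ge0.
have [t_eq0|t_neq0] := eqVneq t 0.
  rewrite t_eq0 !mul0r expr0n/= mulr0 mul0r subr0 expR0 mulr1.
  apply: (@le_trans _ _ 1); last by lra.
  rewrite -sum_expR_loglik [leRHS](bigID (fun y : {ffun 'I_n -> bool} => c < `|score x b0 y e|))/= lerDl.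
  by apply: sumr_ge0 => y _; exact: expR_ge0.
have tpos : 0 < t by rewrite lt_neqAle eq_sym t_neq0.
have h := lerD (T t (ger0_norm t0)) (T (- t) (eq_trans (normrN _) (ger0_norm t0))).
apply: le_trans (le_trans h _); last by rewrite [leRHS]mulr_natl mulr2n.
rewrite [leLHS]big_mkcond [X in _ <= X + _]big_mkcond [X in _ <= _ + X]big_mkcond/=.
rewrite -big_split/=; apply: ler_sum => y _; rewrite !scoreZ.
rewrite mulNr -mulrN !ltr_pM2l//; set z := score _ _ _ _.
have E0 := expR_ge0 (loglik x y b0).
have [z0|z0] := leP 0 z.
  rewrite ger0_norm//; case: ifPn => _; last first.
    by rewrite add0r; case: ifPn.
  by case: ifPn => _; rewrite ?addr0// lerDl.
rewrite ltr0_norm//; case: (ltP c (- z)) => _; last first.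
  by rewrite addr0; case: ifPn.
by case: ifPn => _; rewrite ?add0r// lerDl.
Qed.

(** The dual norm of the score on the Fisher complement of [J] in [K] is at most rho. Stated without
    a basis, so that the deterministic comparison of models need not choose one. *)
Definition residual_score_le y J K (rho : R) : Prop :=
  forall w, submodel K w -> (forall v, submodel J v -> fisher x b0 w v = 0) ->
    score x b0 y w <= rho * fisher_norm x b0 w.

(** In an orthonormal basis of the complement the dual norm of the score is the length of the vector
    of basis scores, to which [lattice_tail] applies. Combinations of Fisher norm at most rho have
    predictors at most eta rho, whence delta = 2 eta rho. *)
Lemma residual_score_tail J K (eta rho kappa : R) : J \subset K ->
  (forall u, submodel K u -> u != 0 -> 0 < fisher x b0 u u) ->
  (forall u i, submodel K u -> `|linpred (x i) u| <= eta * fisher_norm x b0 u) ->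
  0 < rho -> 0 <= eta -> eta * rho <= 1 / 4 -> 0 < kappa <= 1 ->
  #|K :\: J|%:R <= (kappa * rho) ^+ 2 ->
  \sum_(y : {ffun 'I_n -> bool} | ~~ `[< residual_score_le y J K rho >])
     expR (loglik x y b0) <=
  (2 / (1 - expR (- (kappa / 2)))) ^+ #|K :\: J| *
  expR (- ((1 - 3 * kappa - 2 * (eta * rho)) * rho ^+ 2 / 2)).
Proof.
move=> JK pos etaP rho0 eta0 etarho k01 rk.
have posJ u : submodel J u -> u != 0 -> 0 < fisher x b0 u u.
  by move=> Ju; apply: pos; apply: submodelS Ju.
have [e0 _ Je0] := fisher_basis_extend (fisher_basis0 x b0) (finset.sub0set J) posJ.
have [e ee0 [eK eo eb]] := fisher_basis_extend Je0 JK pos.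
move: ee0 eK eo eb Je0; rewrite add0n; set m := #|J :\: _|; set r := #|K :\: J|.
move=> ee0 eK eo eb [e0J _ _].
pose z y (k : 'I_r) := score x b0 y (e (m + k)%N).
pose comb (c : 'I_r -> R) := \sum_k c k *: e (m + k)%N.
have comb_norm c : fisher x b0 (comb c) (comb c) = \sum_k c k ^+ 2.
  rewrite fisher_suml; apply: eq_bigr => k _; rewrite expr2; congr (_ * _).
  rewrite fisherC fisher_suml (bigD1 k)//= eo ?ltn_add2l// eqxx mulr1.
  rewrite big1 ?addr0// => l lk; rewrite eo ?ltn_add2l// eqn_add2l.
  by rewrite -val_eqE/= in lk *; rewrite (negbTE lk) mulr0.
apply: le_trans (lattice_tail (q := fun y : {ffun 'I_n -> bool} => expR (loglik x y b0))
  (z := z) _ rho0 k01 _ rk _); last 3 first.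
- by move=> y; exact: expR_ge0.
- by rewrite mulr_ge0// mulr_ge0// ltW.
- move=> c crho.
  have combK : submodel K (comb c).
    by apply: submodel_sum => k; apply: eK; rewrite ltn_add2l.
  have scoreE (y : {ffun 'I_n -> bool}) : \sum_k c k * z y k = score x b0 y (comb c).
    by rewrite /comb score_sum.
  under eq_bigr => y _ do rewrite scoreE.
  rewrite sum_expR_loglik_score ler_expR.
  have crho' : fisher_norm x b0 (comb c) <= rho.
    by rewrite -ler_sqr ?nnegrE ?fisher_norm_ge0 ?(ltW rho0)// sqr_fisher_norm comb_norm.
  rewrite -comb_norm mulr_sumr; apply: ler_sum => i _.
  apply: bregman_le => //; rewrite (le_trans (etaP _ i combK))//.
  by rewrite ler_wpM2l.
rewrite [leLHS]big_mkcond [leRHS]big_mkcond/=; apply: ler_sum => y _.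
case: ifPn => [bad|_]; last by case: ifPn => // _; exact: expR_ge0.
case: ifPn => //; rewrite -leNgt => zrho; exfalso.
move/negP: bad; apply; apply/asboolP => w Kw wJ.
pose c k := fisher x b0 w (e (m + k)%N).
have wE : w = comb (fun k : 'I_r => c k).
  rewrite {1}(eb w Kw) big_split_ord/= big1 ?add0r// => i _.
  by rewrite ee0 ?ltn_ord// wJ ?scale0r//; exact: e0J.
have -> : fisher_norm x b0 w = Num.sqrt (\sum_(k < r) c k ^+ 2).
  by rewrite -comb_norm -wE.
have -> : score x b0 y w = \sum_(k < r) c k * z y k by rewrite {1}wE score_sum.
apply: le_trans (ler_norm _) _.
rewrite -ler_sqr ?nnegrE ?mulr_ge0 ?sqrtr_ge0 ?(ltW rho0)//.
rewrite real_normK ?num_real// exprMn sqr_sqrtr; last first.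
  by apply: sumr_ge0 => k _; exact: sqr_ge0.
apply: le_trans (sum_cauchy_schwarz _ _) _.
by rewrite mulrC ler_wpM2r// sumr_ge0// => k _; exact: sqr_ge0.
Qed.

End score_tails.

(** * Selection on a good event *)

Section BIC_selection.
Context {R : realType} {n p : nat}.
Variables (x : 'I_n -> p.-tuple R) (b0 : 'rV[R]_p) (y : {ffun 'I_n -> bool}).
Variables (q : nat) (eta S D L : R).
Implicit Types (u v w : 'rV[R]_p) (J K : {set 'I_p}).

Let J0 := supp b0.

Hypotheses (eta0 : 0 < eta) (S0 : 0 < S) (D0 : 0 < D) (etaS : 32 * eta * S <= 1).
Hypothesis J0q : (#|J0| <= q)%N.
Hypothesis linpred_fisher : forall u i, sparse (2 * q) u ->
  `|linpred (x i) u| <= eta * fisher_norm x b0 u.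
Hypothesis score_fisher : forall u, sparse (2 * q) u ->
  score x b0 y u <= S * fisher_norm x b0 u.
Hypothesis norm2_fisher : forall u, sparse (2 * q) u ->
  D * norm2 u <= fisher_norm x b0 u.

Let fisher_pos u : sparse (2 * q) u -> u != 0 -> 0 < fisher x b0 u u.
Proof.
move=> su u0; rewrite -sqr_fisher_norm exprn_gt0// (lt_le_trans _ (norm2_fisher su))//.
by rewrite mulr_gt0// norm2_gt0.
Qed.

(** Beyond Fisher norm 4 S the ray bound with s = 4 S has slope S - s/4 = 0, so such points do not
    beat the truth. Nearer points are compared with the truth shifted by their Fisher projection on
    the true model. *)
Lemma max_loglik_overfit J rho : J0 \subset J -> (#|J| <= q)%N ->
  residual_score_le x b0 y J0 J rho ->
  max_loglik x y J <= max_loglik x y J0 + (rho + 32 * eta * S ^+ 2) ^+ 2 / 2.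
Proof.
move=> J0J Jq res; apply: max_loglik_le => b Jb.
have q2 K : (#|K| <= q)%N -> (#|K| <= 2 * q)%N.
  by move=> /leq_trans; apply; rewrite mul2n -addnn leq_addr.
have Ju : submodel J (b - b0).
  by apply: submodelB => //; apply: submodelS (submodel_supp b0).
set u := b - b0 in Ju.
have -> : b = b0 + u by rewrite /u addrCA subrr addr0.
have su : sparse (2 * q) u by apply: submodel_sparse Ju; exact: q2.
have b0J0 : loglik x y b0 <= max_loglik x y J0 by apply/max_loglik_ge/submodel_supp.
have [uS|uS] := leP (fisher_norm x b0 u) (4 * S); last first.
  have s4 : 0 < 4 * S <= fisher_norm x b0 u by rewrite ltW// andbT mulr_gt0.
  have /(_ _)/le_trans := loglik_ray (fun i => linpred_fisher i su) (score_fisher su) s4.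
  apply; first by have := mulr_gt0 eta0 S0; have := etaS; lra.
  have -> : S - 4 * S / 4 = 0 by lra.
  rewrite mulr0 addr0 (le_trans b0J0)// lerDl.
  by rewrite divr_ge0// sqr_ge0.
have posJ0 v : submodel J0 v -> v != 0 -> 0 < fisher x b0 v v.
  by move=> J0v; apply: fisher_pos; apply: submodel_sparse J0v; exact: q2.
have [e _ [eJ eo eb]] := fisher_basis_extend (fisher_basis0 x b0) (finset.sub0set J0) posJ0.
move: eJ eo eb; rewrite add0n; set m := #|_ :\: _| => eJ eo eb.
have [v vE] : exists v, v = \sum_(i < m) fisher x b0 u (e i) *: e i by eexists.
have J0v : submodel J0 v by rewrite vE; apply: submodel_sum => i; exact: eJ.
have sv : sparse (2 * q) v by apply: submodel_sparse J0v; exact: q2.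
have orth z : submodel J0 z -> fisher x b0 (u - v) z = 0.
  move=> J0z; rewrite fisherC (eb z J0z) fisher_suml big1// => i _.
  suff -> : fisher x b0 (e i) (u - v) = 0 by rewrite mulr0.
  rewrite fisherC fisherBl vE fisher_suml (bigD1 i)//= eo// eqxx mulr1.
  rewrite big1 ?addr0 ?subrr// => k ki; rewrite eo//.
  by rewrite -val_eqE/= in ki *; rewrite (negbTE ki) mulr0.
have etaS16 : 16 * eta * S <= 1 by have := mulr_gt0 eta0 S0; have := etaS; lra.
have resuv : score x b0 y (u - v) <= rho * fisher_norm x b0 (u - v).
  apply: res; last exact: orth.
  by apply: submodelB => //; apply: submodelS J0v.
apply: le_trans (loglik_projection (ltW eta0) (fun i => linpred_fisher i su)
  (fun i => linpred_fisher i sv) (orth v J0v) uS etaS16 resuv) _.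
rewrite lerD2r; apply: max_loglik_ge.
by apply: submodelD => //; exact: submodel_supp.
Qed.

(** A missed signal m forces Euclidean distance at least m from the truth, hence Fisher norm at
    least D m. The ray bound is used at the smaller of D m and the radius 1 / (4 eta) of the local
    expansion; as 8 S <= s, its slope S - s/4 is at most -s/8. *)
Lemma max_loglik_missing J j : j \in J0 -> j \notin J -> (#|J| <= q)%N ->
  8 * S <= D * `|b0 ord0 j| -> 
  max_loglik x y J <= max_loglik x y J0 -
    D * `|b0 ord0 j| * Num.min (D * `|b0 ord0 j|) (1 / (4 * eta)) / 8.
Proof.
move=> jJ0 jJ Jq Sj; apply: max_loglik_le => b Jb; set m := `|_| in Sj *.
set u := b - b0; have -> : b = b0 + u by rewrite /u addrCA subrr addr0.
have su : sparse (2 * q) u.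
  apply: (@submodel_sparse _ _ (J :|: J0)%SET).
    by rewrite (leq_trans (leq_card_setU _ _))// mul2n -addnn leq_add.
  apply: submodelB; first by apply: submodelS Jb; exact: finset.subsetUl.
  apply: submodelS (submodel_supp b0); exact: finset.subsetUr.
have mu : m <= norm2 u.
  apply: le_trans (norm2_coord_le u j).
  by rewrite /u !mxE Jb// sub0r normrN.
set s := Num.min _ _.
have DN : D * m <= fisher_norm x b0 u by rewrite (le_trans _ (norm2_fisher su))// ler_pM2l.
have e4 : 1 / (4 * eta) * eta = 1 / 4 by field; rewrite gt_eqF.
have Ss : 8 * S <= s.
  rewrite /s le_min Sj/= ler_pdivlMr ?mulr_gt0//; have := etaS; lra.
have s0 : 0 < s by rewrite (lt_le_trans _ Ss)// mulr_gt0.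
have sDm : s <= D * m by rewrite /s ge_min lexx.
have sN : 0 < s <= fisher_norm x b0 u by rewrite s0 (le_trans sDm).
have etas : eta * s <= 1 / 4.
  by rewrite -e4 mulrC ler_pM2r// /s ge_min lexx orbT.
have := loglik_ray (fun i => linpred_fisher i su) (score_fisher su) sN etas.
move/le_trans; apply; apply: lerD; first by apply/max_loglik_ge/submodel_supp.
set N := fisher_norm x b0 u in DN *.
have : 0 <= (N - D * m) * s by rewrite mulr_ge0 ?subr_ge0// ltW.
have : 0 <= N * (s - 8 * S) by rewrite mulr_ge0 ?subr_ge0// fisher_norm_ge0.
lra.
Qed.

Hypothesis L0 : 0 <= L.

(** A model missing a signal saves at most |J0| L of penalty, while twice the loss of
    [max_loglik_missing] is a quarter of the product; hence the factor 4. An overfitting model pays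
    L for each extra covariate against twice its gain. *)
Lemma BIC_unique_minimizer (gamma : R) (rho : {set 'I_p} -> R) :
  ln n%:R + 2 * gamma * ln p%:R = L ->
  (forall J, J0 \proper J -> (#|J| <= q)%N -> residual_score_le x b0 y J0 J (rho J)) ->
  (forall J, J0 \proper J -> (#|J| <= q)%N ->
     (rho J + 32 * eta * S ^+ 2) ^+ 2 < #|J :\: J0|%:R * L) ->
  (forall j, j \in J0 -> 8 * S <= D * `|b0 ord0 j|) ->
  (forall j, j \in J0 -> 4 * (#|J0|%:R * L) <
     D * `|b0 ord0 j| * Num.min (D * `|b0 ord0 j|) (1 / (4 * eta))) ->
  unique_BIC_minimizer gamma x y q J0.
Proof.
move=> LE res resL Sj Lj; split => // J Jq JJ0; rewrite /BIC LE.
have [J0J|/subsetPn[j jJ0 jJ]] := boolP (J0 \subset J).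
  have J0pJ : J0 \proper J by rewrite finset.properEneq eq_sym JJ0.
  have := max_loglik_overfit J0J Jq (res _ J0pJ Jq).
  have := resL _ J0pJ Jq.
  have -> : #|J| = (#|J0| + #|J :\: J0|)%N.
    by rewrite -(cardsID J0 J) (finset.setIidPr J0J).
  rewrite natrD mulrDl; lra.
have := max_loglik_missing jJ0 jJ Jq (Sj _ jJ0); have := Lj _ jJ0.
have : 0 <= #|J|%:R * L by rewrite mulr_ge0.
lra.
Qed.

End BIC_selection.

(** * Conditional probability of misselection *)

Section sums.
Context {R : realType}.

Lemma sum_union_bound (Y I : finType) (w : Y -> R) (P : pred Y) (A : pred I)
    (Q : I -> pred Y) : (forall y, 0 <= w y) ->
  (forall y, P y -> exists2 i, A i & Q i y) ->
  \sum_(y | P y) w y <= \sum_(i | A i) \sum_(y | Q i y) w y.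
Proof.
move=> w0 PQ.
under [leRHS]eq_bigr => i _ do rewrite big_mkcond.
rewrite exchange_big/= big_mkcond/=; apply: ler_sum => y _.
have nneg (B : pred I) : 0 <= \sum_(i | B i) (if Q i y then w y else 0).
  by apply: sumr_ge0 => i _; case: ifP.
case: ifPn => // /PQ[i Ai Qi].
by rewrite (bigD1 i)//= Qi lerDl nneg.
Qed.

(** Expanding the product of [f i + g i] over subsets J leaves exactly the supersets of J0, because
    [g] vanishes on J0. The whole sum is thus at most (1 + t)^p <= 1 + 2pt, and the term J = J0 is
    the 1. *)
Lemma sum_proper_supersets_le p (J0 : {set 'I_p}) (t : R) :
  0 <= t -> p%:R * t <= 1 / 4 ->
  \sum_(J : {set 'I_p} | J0 \proper J) t ^+ #|J :\: J0| <= 2 * (p%:R * t).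
Proof.
move=> t0 pt4.
pose f (i : 'I_p) : R := if i \in J0 then 1 else t.
pose g (i : 'I_p) : R := if i \in J0 then 0 else 1.
have f0 i : 0 <= f i by rewrite /f; case: ifP.
have g0 i : 0 <= g i by rewrite /g; case: ifP.
have termE (J : {set 'I_p}) : J0 \subset J ->
    \prod_i (if i \in J then f i else g i) = t ^+ #|J :\: J0|.
  move=> J0J; rewrite -prodr_const [RHS]big_mkcond/=; apply: eq_bigr => i _.
  rewrite !inE /f /g; have := fintype.subsetP J0J i.
  by case: (i \in J0); case: (i \in J) => // /(_ isT).
have h : 1 + \sum_(J : {set 'I_p} | J0 \proper J) t ^+ #|J :\: J0| <= (1 + t) ^+ p.
  apply: (@le_trans _ _ (\prod_(i < p) (f i + g i))); last first.
    rewrite -[X in _ ^+ X](card_ord p) -prodr_const; apply: ler_prod => i _.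
    by rewrite addr_ge0//= /f /g; case: ifP => _; lra.
  rewrite bigA_distr [leRHS](bigD1 J0)//= termE// finset.setDv cards0 expr0 lerD2l.
  rewrite [leRHS]big_mkcond [leLHS]big_mkcond/=; apply: ler_sum => J _.
  case: ifPn => [J0J|_].
    have -> : J != J0 by rewrite eq_sym finset.proper_neq.
    by rewrite termE// fintype.proper_sub.
  by case: ifP => // _; apply: prodr_ge0 => i _; case: ifP.
have : (1 + t) ^+ p <= 1 + 2 * (p%:R * t).
  apply: (@le_trans _ _ (expR (p%:R * t))).
    rewrite expRM_natl lerXn2r ?nnegrE ?expR_ge0 ?addr_ge0//.
    exact: expR_ge1Dx.
  have pt0 : 0 <= p%:R * t by rewrite mulr_ge0.
  have := @expR_le_quadratic R (p%:R * t).
  rewrite ger0_norm// => /(_ pt4)/le_trans; apply.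
  by nra.
lra.
Qed.

End sums.

(** * Union bound over coordinates and overfitting models, for a fixed design *)

Section design.
Context {R : realType} {n p : nat}.
Variables (x : 'I_n -> p.-tuple R) (b0 : 'rV[R]_p).

Lemma score_norm1_le (y : 'I_n -> bool) (G : R) (u : 'rV[R]_p) :
  (forall j, `|score x b0 y (delta_mx ord0 j)| <= G) ->
  score x b0 y u <= G * norm1 u.
Proof.
move=> sG; rewrite {1}(row_sum_delta u) score_sum mulr_sumr.
apply: ler_sum => j _; apply: le_trans (ler_norm _) _.
by rewrite normrM mulrC ler_wpM2r.
Qed.

Definition good_response (J0 : {set 'I_p}) (q : nat) (G : R)
    (rho : {set 'I_p} -> R) (y : {ffun 'I_n -> bool}) : Prop :=
  (forall j, `|score x b0 y (delta_mx ord0 j)| <= G) /\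
  (forall J : {set 'I_p}, J0 \proper J -> (#|J| <= q)%N -> residual_score_le x b0 y J0 J (rho J)).

(** Chosen so that 4 theta (1 + eps/2) = eps/8: rounding costs 3 theta and the moment generating
    function costs theta. *)
Definition rounding_level (eps : R) : R := eps / (32 + 16 * eps).

(** Half its square is (1 + eps/2) (1 + nu) r log p: below the penalty level 1 + eps, to leave room
    for the cubic error, and above the exponent 1 + eps/4 that the union bound asks for. *)
Definition residual_radius (eps nu Lam : R) (J0 J : {set 'I_p}) : R :=
  Num.sqrt (2 * (#|J :\: J0|%:R * ((1 + eps / 2) * (1 + nu) * Lam))).

(** Each kind of failure receives p^(-nu) / 4. For the coordinates, the Chernoff exponent at [t] is
    (nu + 3) log p, and 2 p^(-2) <= 1/4 since p >= 3. For the models, each extra covariate costs a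
    factor [s] with p s <= p^(-nu) / 16. *)
Lemma good_response_tail (J0 : {set 'I_p}) (q : nat) (eps nu a eta : R) :
  let Lam := ln p%:R in
  let theta := rounding_level eps in
  let rho := residual_radius eps nu Lam J0 in
  let t := Num.sqrt (Lam / n%:R) in
  let G := (a ^+ 2 / 4 + nu + 3) * Num.sqrt (n%:R * Lam) in
  0 < eps -> 0 < nu -> (0 < n)%N -> (3 <= p)%N ->
  (forall i j, `|tnth (x i) j| <= a) -> t * a <= 1 / 4 -> 0 <= eta ->
  (forall (K : {set 'I_p}) u, (#|K| <= q)%N -> submodel K u -> u != 0 -> 0 < fisher x b0 u u) ->
  (forall (K : {set 'I_p}) u i, (#|K| <= q)%N -> submodel K u ->
     `|linpred (x i) u| <= eta * fisher_norm x b0 u) ->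
  (forall J : {set 'I_p}, (#|J| <= q)%N -> eta * rho J <= theta / 2) ->
  1 <= 2 * theta ^+ 2 * Lam ->
  ln (2 / (1 - expR (- (theta / 2)))) <= eps / 8 * Lam ->
  ln 16 <= eps / 4 * Lam ->
  \sum_(y : {ffun 'I_n -> bool} | ~~ `[< good_response J0 q G rho y >])
     expR (loglik x y b0) <= expR (- (nu * Lam)) / 2.
Proof.
move=> Lam theta rho t G eps0 nu0 n0 p3 xa ta eta0 pos etaP etarho tL WL L16.
have n0' : 0 < n%:R :> R by rewrite ltr0n.
have p0 : (0 < p)%N by apply: leq_trans p3.
have pE : p%:R = expR Lam :> R by rewrite lnK// posrE ltr0n.
have Lam0 : 0 < Lam by rewrite ln_gt0// ltr1n (leq_trans _ p3).
have th0 : 0 < theta by rewrite divr_gt0//; lra.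
have th1 : theta <= 1 / 16.
  by rewrite /theta /rounding_level ler_pdivrMr; lra.
have th_eps : 4 * theta * (1 + eps / 2) = eps / 8.
  by rewrite /theta /rounding_level; field; rewrite gt_eqF//; lra.
have w0 (y : {ffun 'I_n -> bool}) : 0 <= expR (loglik x y b0) by exact: expR_ge0.
pose bad1 (j : 'I_p) (y : {ffun 'I_n -> bool}) := G < `|score x b0 y (delta_mx ord0 j)|.
pose bad2 (J : {set 'I_p}) (y : {ffun 'I_n -> bool}) := ~~ `[< residual_score_le x b0 y J0 J (rho J) >].
pose A2 (J : {set 'I_p}) := (J0 \proper J) && (#|J| <= q)%N.
apply: (@le_trans _ _ (\sum_j \sum_(y | bad1 j y) expR (loglik x y b0) +
    \sum_(J | A2 J) \sum_(y | bad2 J y) expR (loglik x y b0))).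
  pose B1 y := [exists j, bad1 j y].
  pose B2 y := [exists J, A2 J && bad2 J y].
  apply: (@le_trans _ _ (\sum_(b : bool) \sum_(y | if b then B1 y else B2 y)
      expR (loglik x y b0))).
    apply: sum_union_bound => // y /asboolPn ngood.
    have [b1|/existsPn b1] := boolP (B1 y); first by exists true.
    have [b2|/existsPn b2] := boolP (B2 y); first by exists false.
    exfalso; apply: ngood; split => [j|J J0J Jq].
      by have := b1 j; rewrite -leNgt.
    by have := b2 J; rewrite /A2 J0J Jq/= negbK => /asboolP.
  rewrite big_bool; apply: lerD.
    by apply: sum_union_bound => // y /existsP[j jy]; exists j.
  by apply: sum_union_bound => // y /existsP[J /andP[? ?]]; exists J.
have tail1 : \sum_j \sum_(y | bad1 j y) expR (loglik x y b0) <= expR (- (nu * Lam)) / 4.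
  apply: (@le_trans _ _ (\sum_(j < p) 2 * expR (- ((nu + 3) * Lam)))).
    apply: ler_sum => j _.
    have t0 : 0 <= t by exact: sqrtr_ge0.
    apply: le_trans (@coordinate_score_tail _ _ _ x b0 a t G j (fun i => xa i j) t0 ta) _.
    rewrite ler_pM2l// ler_expR le_eqVlt; apply/orP; left; apply/eqP.
    have -> : t * G = (a ^+ 2 / 4 + nu + 3) * Lam.
      rewrite /G mulrCA -sqrtrM ?divr_ge0// ?ltW//.
      rewrite (_ : _ * (n%:R * Lam) = Lam ^+ 2); last by field; rewrite gt_eqF.
      by rewrite sqrtr_sqr gtr0_norm.
    rewrite exprMn sqr_sqrtr ?divr_ge0 ?ltW//.
    by field; rewrite gt_eqF.
  rewrite sumr_const card_ord -[leLHS]mulr_natl pE mulrCA -expRD.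
  rewrite (_ : Lam - (nu + 3) * Lam = - (nu * Lam) + - (2%:R * Lam)); last by ring.
  have e2 : expR (- (2%:R * Lam)) = (p%:R ^+ 2)^-1 by rewrite expRN expRM_natl pE.
  rewrite expRD e2 mulrCA ler_pM2l ?expR_gt0//.
  have p3' : 3 <= p%:R :> R by rewrite ler_nat.
  rewrite ler_pdivrMr ?exprn_gt0//; nra.
have tail2 : \sum_(J | A2 J) \sum_(y | bad2 J y) expR (loglik x y b0) <= expR (- (nu * Lam)) / 4.
  pose s := expR (- ((1 + eps / 4) * (1 + nu) * Lam)).
  have ps : p%:R * s <= expR (- (nu * Lam)) / 16.
    have -> : 16 = expR (ln 16) :> R by rewrite lnK// posrE.
    rewrite -expRN -expRD pE -expRD ler_expR.
    have : 0 < eps * nu * Lam by rewrite !mulr_gt0.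
    lra.
  have ps4 : p%:R * s <= 1 / 4.
    have : expR (- (nu * Lam)) < 1 by rewrite expR_lt1 oppr_lt0 mulr_gt0.
    lra.
  apply: (@le_trans _ _ (\sum_(J : {set 'I_p} | J0 \proper J) s ^+ #|J :\: J0|)); last first.
    by have := @sum_proper_supersets_le R p J0 s (expR_ge0 _) ps4; have := expR_gt0 (- (nu * Lam)); lra.
  rewrite big_mkcond [leRHS]big_mkcond/=; apply: ler_sum => J _.
  rewrite /A2; case: (boolP (J0 \proper J)) => //= J0J.
  case: ifPn => [Jq|_]; last by rewrite exprn_ge0// expR_ge0.
  set r := #|J :\: J0|.
  have r0 : (0 < r)%N.
    rewrite card_gt0; apply/set0Pn; have [_ [j jJ jJ0]] := properP J0J.
    by exists j; rewrite inE jJ0.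
  have r0' : 0 < r%:R :> R by rewrite ltr0n.
  have tau0 : 0 < (1 + eps / 2) * (1 + nu) * Lam by rewrite !mulr_gt0//; lra.
  have rho2 : rho J ^+ 2 = 2 * (r%:R * ((1 + eps / 2) * (1 + nu) * Lam)).
    by rewrite sqr_sqrtr// mulr_ge0// mulr_ge0// ltW.
  have rho0 : 0 < rho J by rewrite sqrtr_gt0 mulr_gt0// mulr_gt0.
  have etaJ := etarho J Jq.
  have JJ : J0 \subset J by exact: fintype.proper_sub.
  apply: le_trans (@residual_score_tail _ _ _ x b0 J0 J eta (rho J) theta JJ
    (fun u => pos J u Jq) (fun u i => etaP J u i Jq) rho0 eta0 _ _ _) _.
  - lra.
  - by rewrite th0; lra.
  - rewrite exprMn rho2 -/r.
    have : 0 <= r%:R * (2 * theta ^+ 2 * Lam - 1) by rewrite mulr_ge0 ?subr_ge0// ltW.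
    have : 0 <= r%:R * (theta ^+ 2 * Lam) * ((1 + eps / 2) * (1 + nu) - 1).
      rewrite mulr_ge0//; first by rewrite mulr_ge0 ?ltW// mulr_gt0// exprn_gt0.
      by have := mulr_gt0 eps0 nu0; lra.
    lra.
  have W0 : 0 < 2 / (1 - expR (- (theta / 2))).
    by rewrite divr_gt0// subr_gt0 expR_lt1; lra.
  (* The exponent per extra covariate: of 1 + eps/2, an amount eps/8 goes to the rounding and the
     moment generating function, and eps/8 to the lattice constant, leaving 1 + eps/4. *)
  rewrite -[X in X ^+ _]lnK ?posrE//  -/r -!expRM_natl -expRD ler_expR rho2.
  have := ler_wpM2l (ltW r0') WL.
  have : 0 <= (theta - 2 * (eta * rho J)) * (r%:R * ((1 + eps / 2) * (1 + nu) * Lam)).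
    by rewrite mulr_ge0//; [lra|rewrite mulr_ge0// ltW].
  have e1 : (4 * theta * (1 + eps / 2)) * (r%:R * ((1 + nu) * Lam)) =
     eps / 8 * (r%:R * ((1 + nu) * Lam)) by rewrite th_eps.
  have : 0 < r%:R * (eps * nu * Lam) by rewrite !mulr_gt0.
  nra.
lra.
Qed.

End design.

(** * Explicit thresholds and the misselection bound for a fixed design *)

Section conditional_bound.
Context {R : realType}.
Variables (eps nu a0 a c1 : R).
Hypotheses (eps0 : 0 < eps) (nu0 : 0 < nu) (a0_gt0 : 0 < a0) (a_gt0 : 0 < a) (c1_gt0 : 0 < c1).

(** [B] is the level of the coordinate scores in units of sqrt(n log p), and [W] the lattice
    constant per dimension. [mu] solves (1 + mu) (1 + eps/2) = 1 + 3 eps/4. With c1 n the curvature,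
    [M1], [M2], [M3] are the constants of (eta S)^2, of the bound on (eta rho)^2, and of (eta
    S^2)^2. *)
Let B := a ^+ 2 / 4 + nu + 3.
Let theta := rounding_level eps.
Let W := 2 / (1 - expR (- (theta / 2))).
Let mu := eps / (4 + 2 * eps).
Let M1 := 4 * a ^+ 2 * B ^+ 2 / c1 ^+ 2.
Let M2 := 4 * a ^+ 2 * ((1 + eps / 2) * (1 + nu)) / c1.
Let M3 := 8 * a ^+ 2 * B ^+ 4 / c1 ^+ 3.

(** In all three thresholds each summand serves one requirement, a sum standing in for a maximum.
    For p: the rounding condition, the absorption of ln W and of ln 16, and p >= 3. For n: [etaS],
    [eta_rho], [overfit_gap], and admissibility of [t] in the coordinate bound. For the signal:
    [signal_score] and the two branches of [missing_gap]. *)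
Definition threshold_p : R :=
  expR (1 / (2 * theta ^+ 2) + 8 / eps * ln W + 4 / eps * ln 16 + ln 3).
Definition threshold_n : R :=
  32 ^+ 2 * M1 + 4 * M2 / theta ^+ 2 + 2 * (32 ^+ 2 * (1 + mu^-1) * M3) / eps + 16 * a ^+ 2.
Definition threshold_signal : R := 64 * B ^+ 2 / c1 ^+ 2 + 5 / c1 + 32 * a * a0 / c1.

Let B0 : 0 < B. Proof. by rewrite /B; have := sqr_ge0 a; have := nu0; lra. Qed.
Let th0 : 0 < theta. Proof. by rewrite divr_gt0//; have := eps0; lra. Qed.
Let mu0 : 0 < mu. Proof. by rewrite divr_gt0//; have := eps0; lra. Qed.
Let M10 : 0 < M1. Proof. by rewrite divr_gt0 ?exprn_gt0 ?mulr_gt0 ?exprn_gt0. Qed.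
Let tau0 : 0 < (1 + eps / 2) * (1 + nu).
Proof. by rewrite mulr_gt0//; have := eps0; have := nu0; lra. Qed.
Let M20 : 0 < M2. Proof. by rewrite divr_gt0// mulr_gt0// mulr_gt0 ?exprn_gt0. Qed.
Let M30 : 0 < M3. Proof. by rewrite divr_gt0 ?exprn_gt0// mulr_gt0 ?exprn_gt0// mulr_gt0 ?exprn_gt0. Qed.

Let threshold_terms : [/\ 32 ^+ 2 * M1 <= threshold_n, 4 * M2 / theta ^+ 2 <= threshold_n,
  2 * (32 ^+ 2 * (1 + mu^-1) * M3) / eps <= threshold_n, 16 * a ^+ 2 <= threshold_n
  & 0 < threshold_n].
Proof.
have c32 : 0 < 32 ^+ 2 :> R by rewrite exprn_gt0.
have h1 : 0 < 32 ^+ 2 * M1 by exact: mulr_gt0.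
have h2 : 0 < 4 * M2 / theta ^+ 2 by apply: divr_gt0; [exact: mulr_gt0|exact: exprn_gt0].
have h3 : 0 < 2 * (32 ^+ 2 * (1 + mu^-1) * M3) / eps.
  apply: divr_gt0 => //; apply: mulr_gt0 => //; apply: mulr_gt0 => //; apply: mulr_gt0 => //.
  by apply: addr_gt0 => //; rewrite invr_gt0.
have h4 : 0 < 16 * a ^+ 2 by apply: mulr_gt0 => //; exact: exprn_gt0.
rewrite /threshold_n.
move: h1 h2 h3 h4; set T1 := 32 ^+ 2 * M1; set T2 := _ / theta ^+ 2.
set T3 := _ / eps; set T4 := 16 * _ => h1 h2 h3 h4.
by split; lra.
Qed.

Let threshold_signal_terms : [/\ 64 * B ^+ 2 / c1 ^+ 2 <= threshold_signal,
  5 / c1 <= threshold_signal, 32 * a * a0 / c1 <= threshold_signal & 0 < threshold_signal].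
Proof.
have h1 : 0 < 64 * B ^+ 2 / c1 ^+ 2.
  by apply: divr_gt0; [apply: mulr_gt0 => //|]; exact: exprn_gt0.
have h2 : 0 < 5 / c1 by exact: divr_gt0.
have h3 : 0 < 32 * a * a0 / c1.
  by apply: divr_gt0 => //; apply: mulr_gt0 => //; exact: mulr_gt0.
rewrite /threshold_signal.
move: h1 h2 h3; set T1 := _ / c1 ^+ 2; set T2 := 5 / _; set T3 := _ / c1 => h1 h2 h3.
by split; lra.
Qed.

Lemma threshold_n_gt0 : 0 < threshold_n.
Proof. by case: threshold_terms. Qed.

Lemma threshold_signal_gt0 : 0 < threshold_signal.
Proof. by case: threshold_signal_terms. Qed.

Variables (n p q : nat) (x : 'I_n -> p.-tuple R) (b0 : 'rV[R]_p) (gamma : R).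
Hypotheses (n0 : (0 < n)%N) (p2 : (2 <= p)%N) (q0 : (1 <= q)%N).

Let J0 := supp b0.
Let Lam := ln p%:R : R.
Let L := ln n%:R + 2 * gamma * ln p%:R.

Hypotheses (b0a : norm2 b0 <= a0) (J0q : (#|J0| <= q)%N).
Hypothesis xa : forall i j, `|tnth (x i) j| <= a.
Hypothesis curvature : forall u, sparse (2 * q) u ->
  c1 * n%:R * norm2 u ^+ 2 <= fisher x b0 u u.
Hypothesis large_p : threshold_p <= p%:R.
Hypothesis large_n : threshold_n * (q%:R ^+ 3 * Lam) <= n%:R.
Hypothesis large_signal : forall j, j \in J0 ->
  threshold_signal * (q%:R * L) <= n%:R * b0 ord0 j ^+ 2.
Hypothesis large_penalty : 2 * ((1 + eps) * (1 + nu) * Lam) < L.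

Let n0R : 0 < n%:R :> R. Proof. by rewrite ltr0n. Qed.
Let Q : R := q%:R.
Let Q1 : 1 <= Q. Proof. by rewrite ler1n. Qed.
(** [K] bounds the l1 norm of 2q-sparse vectors by their Fisher norm. Multiplied by the covariate
    bound it controls linear predictors, multiplied by the coordinate score level [G] it controls
    the score. *)
Let K := Num.sqrt (2 * Q / (c1 * n%:R)).
Let eta := a * K.
Let G := B * Num.sqrt (n%:R * Lam).
Let S := G * K.
Let D := Num.sqrt (c1 * n%:R).

Let Lam0 : 0 < Lam. Proof. by rewrite ln_gt0// ltr1n. Qed.
Let K0 : 0 < K. Proof. by rewrite sqrtr_gt0 divr_gt0 ?mulr_gt0// (lt_le_trans _ Q1). Qed.
Let eta0 : 0 < eta. Proof. by rewrite mulr_gt0. Qed.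
Let S0 : 0 < S. Proof. by rewrite !mulr_gt0// sqrtr_gt0 mulr_gt0. Qed.
Let D0 : 0 < D. Proof. by rewrite sqrtr_gt0 mulr_gt0. Qed.
Let D2 : D ^+ 2 = c1 * n%:R. Proof. by rewrite sqr_sqrtr// mulr_ge0// ltW. Qed.

Let K2 : K ^+ 2 = 2 * Q / (c1 * n%:R).
Proof. by rewrite sqr_sqrtr// divr_ge0// mulr_ge0// ltW. Qed.

Let eta2 : eta ^+ 2 = 2 * a ^+ 2 * Q / (c1 * n%:R).
Proof. by rewrite exprMn K2; field; rewrite !gt_eqF. Qed.

Let S2 : S ^+ 2 = 2 * B ^+ 2 * Q * Lam / c1.
Proof.
rewrite !exprMn K2 sqr_sqrtr ?mulr_ge0 ?(ltW Lam0)//; field.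
by rewrite !gt_eqF.
Qed.

Let norm1_fisher u : sparse (2 * q) u -> norm1 u <= K * fisher_norm x b0 u.
Proof.
move=> su; rewrite -ler_sqr ?nnegrE ?mulr_ge0 ?fisher_norm_ge0 ?(ltW K0) ?sumr_ge0//.
apply: le_trans (sqr_norm1_le su) _.
rewrite exprMn K2 sqr_fisher_norm natrM -/Q.
have -> : 2 * Q * norm2 u ^+ 2 = 2 * Q / (c1 * n%:R) * (c1 * n%:R * norm2 u ^+ 2).
  by field; rewrite !gt_eqF.
by rewrite ler_wpM2l ?curvature// divr_ge0// mulr_ge0// ltW.
Qed.

Let linpred_fisher u i : sparse (2 * q) u -> `|linpred (x i) u| <= eta * fisher_norm x b0 u.
Proof.
move=> su; apply: le_trans (linpred_le u (xa i)) _.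
by rewrite -mulrA ler_wpM2l ?norm1_fisher// ltW.
Qed.

Let norm2_fisher u : sparse (2 * q) u -> D * norm2 u <= fisher_norm x b0 u.
Proof.
move=> su; rewrite -ler_sqr ?nnegrE ?mulr_ge0 ?fisher_norm_ge0 ?(ltW D0) ?norm2_ge0//.
by rewrite exprMn D2 sqr_fisher_norm curvature.
Qed.

(** Every size requirement on n has this form; k = 3 occurs only for the cubic error in
    [overfit_gap]. *)
Let scale_n (M e : R) (k : nat) : 0 <= M -> 0 < e -> (k <= 3)%N ->
  M / e <= threshold_n -> M * Q ^+ k * Lam <= e * n%:R.
Proof.
move=> M0 e0 k3 Me; rewrite -ler_pdivrMl// mulrC.
apply: le_trans large_n.
have -> : M * Q ^+ k * Lam / e = M / e * (Q ^+ k * Lam) by field; rewrite gt_eqF.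
rewrite ler_pM ?divr_ge0 ?mulr_ge0 ?exprn_ge0 ?(ltW Lam0) ?(ltW e0)//.
by rewrite ler_wpM2r ?(ltW Lam0)// ler_weXn2l.
Qed.

Let etaS : 32 * eta * S <= 1.
Proof.
rewrite -[leRHS]ger0_norm// -[leLHS]ger0_norm; last by rewrite !mulr_ge0// ltW.
rewrite -ler_sqr ?nnegrE// !real_normK ?num_real// expr1n.
have -> : (32 * eta * S) ^+ 2 = 32 ^+ 2 * eta ^+ 2 * S ^+ 2 by rewrite -!exprMn.
rewrite eta2 S2.
have -> : 32 ^+ 2 * (2 * a ^+ 2 * Q / (c1 * n%:R)) * (2 * B ^+ 2 * Q * Lam / c1) =
   32 ^+ 2 * M1 * Q ^+ 2 * Lam / n%:R by rewrite /M1; field; rewrite !gt_eqF.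
rewrite ler_pdivrMr//; apply: scale_n => //.
  by apply: mulr_ge0; [exact: exprn_ge0|exact: ltW].
by rewrite divr1; case: threshold_terms.
Qed.

Let rho := residual_radius eps nu Lam J0.

Let rho2 (J : {set 'I_p}) : rho J ^+ 2 = 2 * (#|J :\: J0|%:R * ((1 + eps / 2) * (1 + nu) * Lam)).
Proof.
rewrite sqr_sqrtr// mulr_ge0// mulr_ge0// mulr_ge0 ?(ltW Lam0)//; exact: ltW.
Qed.

Let eta_rho (J : {set 'I_p}) : (#|J| <= q)%N -> eta * rho J <= theta / 2.
Proof.
move=> Jq; have h1 : 0 <= eta * rho J by apply: mulr_ge0 (ltW eta0) (sqrtr_ge0 _).
have h2 : 0 <= theta / 2 by apply: divr_ge0 (ltW th0) _.
rewrite -ler_sqr ?nnegrE//.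
have -> : (eta * rho J) ^+ 2 = eta ^+ 2 * rho J ^+ 2 by rewrite -exprMn.
rewrite rho2 eta2.
have rQ : #|J :\: J0|%:R <= Q.
  by rewrite ler_nat (leq_trans _ Jq)// subset_leq_card// finset.subsetDl.
apply: (@le_trans _ _ (2 * a ^+ 2 * Q / (c1 * n%:R) *
    (2 * (Q * ((1 + eps / 2) * (1 + nu) * Lam))))).
  rewrite ler_wpM2l//; last first.
    by rewrite ler_wpM2l// ler_wpM2r// mulr_ge0 ?(ltW Lam0)// ltW.
  by rewrite -eta2 sqr_ge0.
have -> : 2 * a ^+ 2 * Q / (c1 * n%:R) * (2 * (Q * ((1 + eps / 2) * (1 + nu) * Lam))) =
   M2 * Q ^+ 2 * Lam / n%:R by rewrite /M2; field; rewrite !gt_eqF.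
rewrite ler_pdivrMr//; apply: scale_n; rewrite ?(ltW M20)//.
  by rewrite exprn_gt0// divr_gt0.
have -> : M2 / (theta / 2) ^+ 2 = 4 * M2 / theta ^+ 2 by field; rewrite gt_eqF.
by case: threshold_terms.
Qed.

(** Young's inequality with weight mu raises 1 + eps/2 to 1 + 3 eps/4 in front of the residual score
    and leaves (1 + 1/mu) A^2, of order q^3 (log p)^2 / n. The remaining gap to the penalty is at
    least (eps/2) log p, which the lower bound on n makes large enough. *)
Let overfit_gap (J : {set 'I_p}) : J0 \proper J ->
  (rho J + 32 * eta * S ^+ 2) ^+ 2 < #|J :\: J0|%:R * L.
Proof.
move=> J0J; set r : R := #|J :\: J0|%:R; set A := 32 * eta * S ^+ 2.
have r1 : 1 <= r.
  rewrite ler1n card_gt0; apply/set0Pn; have [_ [j jJ jJ0]] := properP J0J.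
  by exists j; rewrite inE jJ0.
have A2 : (1 + mu^-1) * A ^+ 2 <= eps / 2 * Lam.
  have -> : A ^+ 2 = 32 ^+ 2 * eta ^+ 2 * (S ^+ 2) ^+ 2 by rewrite -!exprMn.
  rewrite eta2 S2.
  have -> : (1 + mu^-1) * (32 ^+ 2 * (2 * a ^+ 2 * Q / (c1 * n%:R)) *
      (2 * B ^+ 2 * Q * Lam / c1) ^+ 2) =
     32 ^+ 2 * (1 + mu^-1) * M3 * Q ^+ 3 * Lam / n%:R * Lam.
    by rewrite /M3; field; rewrite !gt_eqF.
  rewrite ler_wpM2r ?(ltW Lam0)// ler_pdivrMr//; apply: scale_n => //.
  - apply: mulr_ge0 (ltW M30); apply: mulr_ge0; first exact: exprn_ge0.
    by rewrite addr_ge0// invr_ge0 ltW.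
  - by rewrite divr_gt0.
  have -> : 32 ^+ 2 * (1 + mu^-1) * M3 / (eps / 2) = 2 * (32 ^+ 2 * (1 + mu^-1) * M3) / eps.
    by field; rewrite !gt_eqF.
  by case: threshold_terms.
have young : (rho J + A) ^+ 2 <= (1 + mu) * rho J ^+ 2 + (1 + mu^-1) * A ^+ 2.
  have -> : (1 + mu) * rho J ^+ 2 + (1 + mu^-1) * A ^+ 2 =
    (rho J + A) ^+ 2 + mu * (rho J - mu^-1 * A) ^+ 2 by field; rewrite gt_eqF.
  by rewrite lerDl mulr_ge0 ?sqr_ge0// ltW.
apply: (le_lt_trans young); rewrite rho2 -/r.
have mue : (1 + mu) * (1 + eps / 2) = 1 + 3 / 4 * eps.
  by rewrite /mu; field; rewrite gt_eqF//; have := eps0; lra.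
have -> : (1 + mu) * (2 * (r * ((1 + eps / 2) * (1 + nu) * Lam))) =
   2 * (r * ((1 + 3 / 4 * eps) * (1 + nu) * Lam)) by rewrite -mue; ring.
have h1 : r * (2 * ((1 + eps) * (1 + nu) * Lam)) < r * L.
  by rewrite ltr_pM2l// (lt_le_trans _ r1).
have h2 : 0 <= (r - 1) * (eps * Lam).
  by rewrite mulr_ge0 ?subr_ge0//; exact: mulr_ge0 (ltW eps0) (ltW Lam0).
have h3 : 0 <= r * (eps * nu * Lam).
  by rewrite mulr_ge0 ?(le_trans _ r1)//; exact: mulr_ge0 (mulr_ge0 (ltW eps0) (ltW nu0)) (ltW Lam0).
lra.
Qed.

Let L0 : 0 < L.
Proof.
apply: le_lt_trans large_penalty; rewrite mulr_ge0// mulr_ge0 ?(ltW Lam0)//.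
by rewrite mulr_ge0// addr_ge0// ltW.
Qed.

Let LamL : 2 * Lam <= L.
Proof.
apply: le_trans (ltW large_penalty).
have : 0 <= eps * nu * Lam by exact: mulr_ge0 (mulr_ge0 (ltW eps0) (ltW nu0)) (ltW Lam0).
have : 0 <= eps * Lam by exact: mulr_ge0 (ltW eps0) (ltW Lam0).
have : 0 <= nu * Lam by exact: mulr_ge0 (ltW nu0) (ltW Lam0).
lra.
Qed.

Let signal_terms (C : R) : 0 <= C -> C <= threshold_signal -> forall j, j \in J0 ->
  C * (Q * L) <= n%:R * b0 ord0 j ^+ 2.
Proof.
move=> C0 Cs j jJ0; apply: le_trans (large_signal jJ0).
by rewrite ler_wpM2r// mulr_ge0 ?(ltW L0).
Qed.

Let Dm2 j : (D * `|b0 ord0 j|) ^+ 2 = c1 * (n%:R * b0 ord0 j ^+ 2).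
Proof. by rewrite exprMn D2 real_normK ?num_real// mulrA. Qed.

Let Dm0 j : 0 <= D * `|b0 ord0 j|. Proof. by rewrite mulr_ge0// ltW. Qed.

Let signal_score j : j \in J0 -> 8 * S <= D * `|b0 ord0 j|.
Proof.
move=> jJ0; have h8 : 0 <= 8 * S by apply: mulr_ge0 (ltW S0).
rewrite -ler_sqr ?nnegrE//.
rewrite Dm2.
have -> : (8 * S) ^+ 2 = 8 ^+ 2 * S ^+ 2 by rewrite -exprMn.
rewrite S2.
have [h _ _ _] := threshold_signal_terms.
have h0 : 0 <= 64 * B ^+ 2 / c1 ^+ 2.
  by apply: divr_ge0 (sqr_ge0 _); apply: mulr_ge0 (sqr_ge0 _).
have := ler_wpM2l (ltW c1_gt0) (signal_terms h0 h jJ0).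
apply: le_trans.
have -> : c1 * (64 * B ^+ 2 / c1 ^+ 2 * (Q * L)) = 64 * B ^+ 2 * Q / c1 * L.
  by field; rewrite gt_eqF.
have -> : 8 ^+ 2 * (2 * B ^+ 2 * Q * Lam / c1) = 64 * B ^+ 2 * Q / c1 * (2 * Lam).
  by ring.
by rewrite ler_wpM2l// divr_ge0 ?(ltW c1_gt0)// mulr_ge0// mulr_ge0 ?sqr_ge0.
Qed.

Let card_signal : #|J0|%:R * (threshold_signal * (Q * L)) <= n%:R * a0 ^+ 2.
Proof.
apply: (@le_trans _ _ (n%:R * norm2 b0 ^+ 2)); last first.
  by rewrite ler_wpM2l// ler_sqr ?nnegrE ?norm2_ge0// ltW.
rewrite sqr_norm2 mulr_sumr mulr_natl -sumr_const.
rewrite [leRHS](bigID (mem J0))/= ler_wpDr//; last by apply: ler_sum => j; exact: large_signal.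
by rewrite sumr_ge0// => j _; rewrite mulr_ge0 ?sqr_ge0.
Qed.

(** The first branch of the minimum is a loss quadratic in the signal, for which the size of that
    one signal suffices; the second is only linear and also uses the norm bound on the true
    parameter. *)
Let missing_gap j : j \in J0 -> 4 * (#|J0|%:R * L) <
  D * `|b0 ord0 j| * Num.min (D * `|b0 ord0 j|) (1 / (4 * eta)).
Proof.
move=> jJ0; have kQ : #|J0|%:R <= Q by rewrite ler_nat.
set k : R := #|J0|%:R in kQ *.
have k1 : 1 <= k by rewrite ler1n card_gt0; apply/set0Pn; exists j.
have k0 : 0 < k by rewrite (lt_le_trans _ k1).
have [_ t5 t32 _] := threshold_signal_terms.
have QL0 : 0 < Q * L by rewrite mulr_gt0// (lt_le_trans _ Q1).
have kQL : k * L <= Q * L by rewrite ler_wpM2r// ltW.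
rewrite minr_pMr//; rewrite lt_min; apply/andP; split.
  rewrite -expr2 Dm2.
  have h0 : 0 <= 5 / c1 by rewrite divr_ge0// ltW.
  have := ler_wpM2l (ltW c1_gt0) (signal_terms h0 t5 jJ0).
  have -> : c1 * (5 / c1 * (Q * L)) = 5 * (Q * L) by field; rewrite gt_eqF.
  by move: QL0 kQL; lra.
rewrite [ltRHS]mulrA mulr1 ltr_pdivlMr ?mulr_gt0//.
have h1 : 0 <= 4 * (k * L) * (4 * eta).
  by apply: mulr_ge0; apply: mulr_ge0 => //; [exact: mulr_ge0 (ltW k0) (ltW L0)|exact: ltW].
rewrite -ltr_sqr ?nnegrE//.
have -> : (4 * (k * L) * (4 * eta)) ^+ 2 =
  4 ^+ 2 * (k ^+ 2 * L ^+ 2) * (4 ^+ 2 * eta ^+ 2) by rewrite -!exprMn.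
rewrite Dm2 eta2.
(* [k] squared signals, each of order at least [Q * L / n], sum to at most
   [a0 ^+ 2]; this is [m2], and it supplies the factor [k] that a single signal lacks. *)
have h0 : 0 <= 32 * a * a0 / c1 by rewrite divr_ge0 ?(ltW c1_gt0)// !mulr_ge0// ltW.
have m1 := signal_terms h0 t32 jJ0.
have m2 : k * (32 * a * a0 / c1 * (Q * L)) <= n%:R * a0 ^+ 2.
  by apply: le_trans card_signal; rewrite ler_wpM2l ?(ltW k0)// ler_wpM2r// ltW.
rewrite -(@ltr_pM2l _ (n%:R * a0 ^+ 2)) ?mulr_gt0 ?exprn_gt0//.
apply: (@lt_le_trans _ _ (k * (32 * a * a0 / c1 * (Q * L)) *
   (c1 * (32 * a * a0 / c1 * (Q * L))))); last first.
  rewrite ler_pM//.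
  - by rewrite mulr_ge0 ?(ltW k0)// mulr_ge0// ltW.
  - by rewrite mulr_ge0 ?(ltW c1_gt0)// mulr_ge0// ltW.
  - by rewrite ler_wpM2l ?(ltW c1_gt0).
have -> : n%:R * a0 ^+ 2 * (4 ^+ 2 * (k ^+ 2 * L ^+ 2) * (4 ^+ 2 * (2 * a ^+ 2 * Q / (c1 * n%:R)))) =
  512 * (a ^+ 2 * a0 ^+ 2 / c1 * (k * L * (k * L * Q))) by field; rewrite !gt_eqF.
have -> : k * (32 * a * a0 / c1 * (Q * L)) * (c1 * (32 * a * a0 / c1 * (Q * L))) =
  1024 * (a ^+ 2 * a0 ^+ 2 / c1 * (k * L * (Q * L * Q))) by field; rewrite gt_eqF.
have F0 : 0 < a ^+ 2 * a0 ^+ 2 / c1 by rewrite divr_gt0// mulr_gt0 ?exprn_gt0.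
have Q0 : 0 < Q by rewrite (lt_le_trans _ Q1).
have : a ^+ 2 * a0 ^+ 2 / c1 * (k * L * (k * L * Q)) <= a ^+ 2 * a0 ^+ 2 / c1 * (k * L * (Q * L * Q)).
  by rewrite ler_wpM2l ?(ltW F0)// ler_wpM2l ?mulr_ge0 ?(ltW k0) ?(ltW L0)// ler_wpM2r ?(ltW Q0).
have : 0 < a ^+ 2 * a0 ^+ 2 / c1 * (k * L * (Q * L * Q)).
  by rewrite mulr_gt0// mulr_gt0// ?mulr_gt0.
lra.
Qed.

Let Lam_large : [/\ 1 <= 2 * theta ^+ 2 * Lam, ln W <= eps / 8 * Lam,
  ln 16 <= eps / 4 * Lam & (3 <= p)%N].
Proof.
have W1 : 1 < W.
  rewrite /W; set e := expR _; have e0 : 0 < e by exact: expR_gt0.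
  have e1 : e < 1 by rewrite expR_lt1 oppr_lt0 divr_gt0.
  by rewrite ltr_pdivlMr ?subr_gt0// mul1r; lra.
have lW : 0 < ln W by rewrite ln_gt0.
have l16 : 0 < ln 16 :> R by rewrite ln_gt0// ltr1n.
have l3 : 0 < ln 3 :> R by rewrite ln_gt0// ltr1n.
have h1 : 0 < 1 / (2 * theta ^+ 2) by rewrite divr_gt0// mulr_gt0// exprn_gt0.
have h2 : 0 < 8 / eps * ln W by rewrite mulr_gt0// divr_gt0.
have h3 : 0 < 4 / eps * ln 16 by rewrite mulr_gt0// divr_gt0.
have p0R : 0 < p%:R :> R by rewrite ltr0n (leq_trans _ p2).
have h : 1 / (2 * theta ^+ 2) + 8 / eps * ln W + 4 / eps * ln 16 + ln 3 <= Lam.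
  by rewrite -ler_expR /Lam lnK ?posrE.
split.
- have : 1 / (2 * theta ^+ 2) <= Lam by lra.
  have th2 : 0 < 2 * theta ^+ 2 by apply: mulr_gt0 => //; exact: exprn_gt0.
  by rewrite ler_pdivrMr// [leRHS]mulrC.
- have : 8 / eps * ln W <= Lam by lra.
  rewrite -ler_pdivlMl ?divr_gt0// => /le_trans; apply.
  by rewrite invf_div.
- have : 4 / eps * ln 16 <= Lam by lra.
  rewrite -ler_pdivlMl ?divr_gt0// => /le_trans; apply.
  by rewrite invf_div.
- have : ln 3 <= Lam by lra.
  by rewrite /Lam ler_ln ?posrE// ler_nat.
Qed.

Lemma misselection_weight_le :
  \sum_(y : {ffun 'I_n -> bool} | ~~ `[< unique_BIC_minimizer gamma x y q J0 >])
     expR (loglik x y b0) <= expR (- (nu * Lam)) / 2.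
Proof.
have [l1 l2 l3 p3] := Lam_large.
have fisher_pos (J : {set 'I_p}) u : (#|J| <= q)%N -> submodel J u -> u != 0 -> 0 < fisher x b0 u u.
  move=> Jq Ju u0; have su : sparse (2 * q) u.
    by apply: submodel_sparse Ju; rewrite (leq_trans Jq)// mul2n -addnn leq_addr.
  apply: lt_le_trans (curvature su); rewrite mulr_gt0 ?exprn_gt0 ?norm2_gt0//.
  exact: mulr_gt0.
have lin (J : {set 'I_p}) u i : (#|J| <= q)%N -> submodel J u ->
    `|linpred (x i) u| <= eta * fisher_norm x b0 u.
  move=> Jq Ju; apply: linpred_fisher; apply: submodel_sparse Ju.
  by rewrite (leq_trans Jq)// mul2n -addnn leq_addr.
have ta : Num.sqrt (Lam / n%:R) * a <= 1 / 4.
  rewrite -ler_sqr ?nnegrE// ?mulr_ge0 ?sqrtr_ge0 ?(ltW a_gt0)//.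
  rewrite exprMn sqr_sqrtr ?divr_ge0 ?(ltW Lam0)//.
  have -> : Lam / n%:R * a ^+ 2 = a ^+ 2 * Q ^+ 0 * Lam / n%:R by rewrite expr0; ring.
  rewrite ler_pdivrMr//; apply: scale_n; rewrite ?sqr_ge0// ?exprn_gt0 ?divr_gt0//.
  have -> : a ^+ 2 / (1 / 4) ^+ 2 = 16 * a ^+ 2 by field.
  by case: threshold_terms.
have := good_response_tail (J0 := J0) eps0 nu0 n0 p3 xa ta (ltW eta0) fisher_pos lin eta_rho l1 l2 l3.
apply: le_trans; rewrite big_mkcond [leRHS]big_mkcond/=; apply: ler_sum => y _.
case: ifPn => [bad|_]; last by case: ifP => // _; exact: expR_ge0.
case: ifPn => //; rewrite negbK => /asboolP[sG res].
exfalso; move/negP: bad; apply; apply/asboolP.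
apply: (@BIC_unique_minimizer _ _ _ x b0 y q eta S D L eta0 S0 D0 etaS J0q
  (fun u i => @linpred_fisher u i) _ norm2_fisher (ltW L0) gamma rho) => //.
  move=> u su; have h : score x b0 y u <= G * norm1 u by apply: score_norm1_le sG.
  apply: (le_trans h); have -> : S * fisher_norm x b0 u = G * (K * fisher_norm x b0 u).
    by rewrite mulrA.
  apply: ler_wpM2l (norm1_fisher su).
  by apply: mulr_ge0 (ltW B0) (sqrtr_ge0 _).
by move=> J J0J _; exact: overfit_gap.
Qed.

End conditional_bound.

(** * Independence and conditioning *)

Section independent_product.
Context {d d' : measure_display} {T : measurableType d} {U : measurableType d'}
  {R : realType} (P : probability T R).
Local Open Scope ereal_scope.
Import HBNNSimple.

(* The functions [f] with [E[f(Z) F] = E[f(Z)] c] form a monotone class. *)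
Lemma ge0_integral_comp_factor (Z : T -> U) (F : T -> R) (c : \bar R) :
  measurable_fun setT Z -> measurable_fun setT F -> (forall w, 0 <= F w)%R ->
  0 <= c -> c \is a fin_num ->
  (forall B, measurable B ->
     \int[P]_w (\1_B (Z w) * F w)%:E = \int[P]_w (\1_B (Z w))%:E * c) ->
  forall f : U -> R, measurable_fun setT f -> (forall u, 0 <= f u)%R ->
  \int[P]_w (f (Z w) * F w)%:E = \int[P]_w (f (Z w))%:E * c.
Proof.
move=> mZ mF F0 c0 cfin HB f mf f0.
have mf' : measurable_fun setT (EFin \o f) by exact/measurable_EFinP.
pose h := nnsfun_approx measurableT mf'.
have mhZ m : measurable_fun setT (fun w => h m (Z w)).
  by apply: measurableT_comp.
have hcvg u : EFin \o h ^~ u @ \oo --> (f u)%:E.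
  by apply: (@cvg_nnsfun_approx _ _ _ setT measurableT (EFin \o f) mf') => // v _; rewrite lee_fin.
have nd u a b : (a <= b)%N -> (h a u <= h b u)%R.
  by move=> ab; exact/lefP/nd_nnsfun_approx.
have LHS : \int[P]_w (f (Z w) * F w)%:E =
    lim (\int[P]_w (h m (Z w) * F w)%:E @[m --> \oo]).
  rewrite -monotone_convergence//=.
  - apply: eq_integral => w _; apply/esym/cvg_lim => //.
    under eq_fun do rewrite EFinM.
    by rewrite EFinM; apply: cvgeZr => //; exact: hcvg.
  - by move=> m; apply/measurable_EFinP; exact: measurable_funM.
  - by move=> m w _; rewrite lee_fin mulr_ge0.
  - by move=> w _ a b ab; rewrite lee_fin ler_wpM2r// nd.
have RHS : \int[P]_w (f (Z w))%:E = lim (\int[P]_w (h m (Z w))%:E @[m --> \oo]).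
  rewrite -monotone_convergence//=.
  - by apply: eq_integral => w _; apply/esym/cvg_lim => //; exact: hcvg.
  - by move=> m; apply/measurable_EFinP.
  - by move=> m w _; rewrite lee_fin.
  - by move=> w _ a b ab; rewrite lee_fin nd.
rewrite LHS RHS -limeMr//; last first.
  apply/ereal_nondecreasing_is_cvgn => a b ab; apply: ge0_le_integral => //=.
  - by move=> ? _; rewrite lee_fin.
  - by apply/measurable_EFinP.
  - by apply/measurable_EFinP.
  - by move=> ? _; rewrite lee_fin nd.
apply: congr_lim; apply/funext => m.
have mind (r : R) : measurable_fun setT (fun w => \1_(h m @^-1` [set r]) (Z w) : R).
  by apply: (measurableT_comp (f := \1_(h m @^-1` [set r]) : U -> R)).
have r_ge0 (r : R) w : (0 <= r * \1_(h m @^-1` [set r]) (Z w))%R.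
  by rewrite -lee_fin EFinM; exact: nnfun_muleindic_ge0.
transitivity (\int[P]_w (\sum_(r \in range (h m))
    (r * \1_(h m @^-1` [set r]) (Z w) * F w)%:E)).
  apply: eq_integral => w _; rewrite fimfunE.
  rewrite EFinM -fsumEFin// ge0_mule_fsuml//.
  by move=> r; rewrite lee_fin.
rewrite ge0_integral_fsum//; last 2 first.
- by move=> r; apply/measurable_EFinP; apply: measurable_funM => //; exact: measurable_funM.
- by move=> r w _; rewrite lee_fin mulr_ge0.
transitivity ((\sum_(r \in range (h m)) \int[P]_w (r * \1_(h m @^-1` [set r]) (Z w))%:E) * c).
  rewrite ge0_mule_fsuml; last first.
    by move=> r; apply: integral_ge0 => w _; rewrite lee_fin.
  apply: eq_fsbigr => r /set_mem[u _ hur].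
  have r0 : (0 <= r)%R by rewrite -hur.
  under eq_integral do rewrite -mulrA EFinM.
  rewrite ge0_integralZl//; last 2 first.
  - by apply/measurable_EFinP; exact: measurable_funM.
  - by move=> w _; rewrite lee_fin mulr_ge0.
  under [X in _ = X * _]eq_integral do rewrite EFinM.
  by rewrite HB// ge0_integralZl// ?muleA//; exact/measurable_EFinP.
congr (_ * _); rewrite -ge0_integral_fsum//.
- by apply: eq_integral => w _; rewrite fimfunE -fsumEFin.
- by move=> r; apply/measurable_EFinP; exact: measurable_funM.
- by move=> r w _; rewrite lee_fin.
Qed.

Lemma integral_prod_independent n (Z : 'I_n -> T -> U) (f : 'I_n -> U -> R) (M : R) :
  (forall i, measurable_fun setT (Z i)) -> mutually_independent P Z ->
  (forall i, measurable_fun setT (f i)) -> (forall i u, 0 <= f i u <= M)%R ->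
  \int[P]_w (\prod_i f i (Z i w))%:E = \prod_i \int[P]_w (f i (Z i w))%:E.
Proof.
move=> mZ indep mf fM.
(* Independence speaks of events only. Induction on the list of indices whose function need not be
   an indicator: the empty list is independence itself, and [ge0_integral_comp_factor] frees one
   index at a time. The bound [Num.max M 1] makes room for indicators. *)
suff main (s : seq 'I_n) (g : 'I_n -> U -> R) :
    (forall i, measurable_fun setT (g i)) -> (forall i u, 0 <= g i u <= Num.max M 1)%R ->
    (forall i, i \notin s -> exists2 B, measurable B & g i = \1_B) ->
    \int[P]_w (\prod_i g i (Z i w))%:E = \prod_i \int[P]_w (g i (Z i w))%:E.
  apply: (main (index_enum 'I_n)) => //.
  - by move=> i u; have /andP[-> /= h] := fM i u; rewrite le_max h.
  - by move=> i; rewrite mem_index_enum.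
elim: s g => [|k s IH] g mg gM gs.
  have /choice[B BP] : forall i, exists B, measurable B /\ g i = \1_B.
    by move=> i; have [B mB gB] := gs i isT; exists B.
  have := indep [set: 'I_n]%SET B (fun i => (BP i).1).
  set A := [set w | _] => PA.
  have mA : measurable A.
    have -> : A = \bigcap_(i in [set: 'I_n]) (Z i @^-1` B i).
      apply/seteqP; split => w; rewrite /A /=.
        by move=> h i _; apply: h; rewrite inE.
      by move=> h i _; exact: h.
    apply: fin_bigcap_measurable => // i _.
    by rewrite -[X in measurable X]setTI; apply: mZ => //; exact: (BP i).1.
  transitivity (P A).
    rewrite -[in RHS](setIT A) -integral_indic//; apply: eq_integral => w _.
    congr EFin; rewrite indicE; case: (boolP (w \in A)) => wA.
      rewrite big1// => i _; rewrite (BP i).2 indicE mem_set//.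
      by move/set_mem: wA; apply; rewrite inE.
    have [i iB] : exists i, ~ B i (Z i w).
      by apply/existsNP => h; move/negP: wA; apply; apply/mem_set => i _; exact: h.
    by rewrite (bigD1 i)//= (BP i).2 indicE memNset// mul0r.
  rewrite PA; apply: eq_big => [i|i _]; first by rewrite inE.
  rewrite -[in LHS](setIT (Z i @^-1` _)) -integral_indic//.
    by apply: eq_integral => w _; rewrite (BP i).2.
  by rewrite -[X in measurable X]setTI; apply: mZ => //; exact: (BP i).1.
pose F w := (\prod_(i | i != k) g i (Z i w))%R.
pose c := \prod_(i | i != k) \int[P]_w (g i (Z i w))%:E.
have mgZ i : measurable_fun setT (fun w => g i (Z i w)).
  exact: measurableT_comp.
have mF : measurable_fun setT F.
  rewrite (_ : F = fun w => \prod_(i <- [seq i <- index_enum 'I_n | i != k]) g i (Z i w))%R.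
    by apply: measurable_prod.
  by apply/funext => w; rewrite big_filter.
have F0 w : (0 <= F w)%R.
  by apply: prodr_ge0 => i _; have /andP[] := gM i (Z i w).
have int0 i : 0 <= \int[P]_w (g i (Z i w))%:E.
  by apply: integral_ge0 => w _; rewrite lee_fin; have /andP[] := gM i (Z i w).
have c0 : 0 <= c by apply: prode_ge0.
have cfin : c \is a fin_num.
  apply: prode_fin_num => i _; rewrite ge0_fin_numE//.
  apply: (@le_lt_trans _ _ (\int[P]_w (cst (Num.max M 1)%:E w))).
    apply: ge0_le_integral => //.
    - by move=> w _; rewrite lee_fin; have /andP[] := gM i (Z i w).
    - exact/measurable_EFinP.
    - by move=> w _; rewrite lee_fin; have /andP[] := gM i (Z i w).
  rewrite integral_cst// [X in _ * X](_ : _ = 1); last exact: (@probability_setT _ _ _ P).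
  by rewrite mule1 ltry.
transitivity (\int[P]_w (g k (Z k w) * F w)%:E).
  by apply: eq_integral => w _; rewrite (bigD1 k).
rewrite (bigD1 k)//= -/c.
apply: ge0_integral_comp_factor => // [B mB|u]; last by have /andP[] := gM k u.
pose g' i := if i == k then \1_B else g i.
have := IH g'.
have -> : \int[P]_w (\prod_i g' i (Z i w))%:E = \int[P]_w (\1_B (Z k w) * F w)%:E.
  apply: eq_integral => w _; rewrite (bigD1 k)//= {1}/g' eqxx; congr (_ * _)%:E.
  by apply: eq_bigr => i ik; rewrite /g' (negbTE ik).
have -> : \prod_i \int[P]_w (g' i (Z i w))%:E = \int[P]_w (\1_B (Z k w))%:E * c.
  rewrite (bigD1 k)//= {1}/g' eqxx; congr (_ * _).
  by apply: eq_bigr => i ik; rewrite /g' (negbTE ik).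
apply.
- move=> i; rewrite /g'; case: ifP => // _; exact: measurable_indic.
- move=> i u; rewrite /g'; case: ifP => // _; rewrite indicE.
  by case: (u \in B) => /=; rewrite ?mulr1n ?mulr0n ?ler01 ?lexx ?le_max ?lexx ?ler01 ?orbT.
- move=> i iS; rewrite /g'; case: eqVneq => [_|ik]; first by exists B.
  by apply: gs; rewrite inE negb_or ik.
Qed.

End independent_product.

(** * The conditional law of the responses given the design, in integrated form *)

Section weighted_law.
Context {d d' : measure_display} {T : measurableType d} {V : measurableType d'}
  {R : realType} (P : probability T R).
Variables (Z : T -> V) (F : T -> \bar R).
Hypotheses (mZ : measurable_fun setT Z) (mF : measurable_fun setT F).
Hypothesis F0 : forall w, (0 <= F w)%E.

Let mpre D : measurable D -> measurable (Z @^-1` D).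
Proof. by move=> mD; rewrite -[X in measurable X]setTI; exact: mZ. Qed.

Let law (D : set V) : \bar R := (\int[P]_(w in Z @^-1` D) F w)%E.

Let law0 : law set0 = 0%E.
Proof. by rewrite /law preimage_set0 integral_set0. Qed.

Let law_ge0 D : (0 <= law D)%E.
Proof. by apply: integral_ge0. Qed.

Let law_sigma_additive : semi_sigma_additive law.
Proof.
move=> A mA tA mUA; rewrite /law; apply: cvg_toP.
  apply: ereal_nondecreasing_is_cvgn => m k mk.
  by apply: lee_sum_nneg_natr => // i _ _; exact: integral_ge0.
rewrite preimage_bigcup ge0_integral_bigcup//=.
- by move=> k; exact: mpre.
- exact: measurable_funTS.
- apply/trivIsetP => i j _ _ ij; rewrite -preimage_setI.
  by move/trivIsetP : tA => /(_ i j I I ij) ->; rewrite preimage_set0.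
Qed.

HB.instance Definition _ := isMeasure.Build _ _ _ law law0 law_ge0 law_sigma_additive.

Lemma weighted_law_measure : exists m : {measure set V -> \bar R},
  forall D, m D = (\int[P]_(w in Z @^-1` D) F w)%E.
Proof. by exists (law : {measure set V -> \bar R}). Qed.

End weighted_law.

Section tuple_law.
Context {d d' : measure_display} {T : measurableType d} {U : measurableType d'}
  {R : realType} (P : probability T R) {n : nat}.

(** Both sides are finite measures in [D], and they agree on rectangles, which are stable under
    intersection and generate the product sigma-algebra. *)
Lemma weighted_law_tuple_unique (Z : T -> n.-tuple U) (F1 F2 : T -> \bar R) :
  measurable_fun setT Z ->
  measurable_fun setT F1 -> measurable_fun setT F2 ->
  (forall w, 0 <= F1 w)%E -> (forall w, 0 <= F2 w)%E ->
  (\int[P]_w F1 w < +oo)%E ->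
  (forall B : 'I_n -> set U, (forall i, measurable (B i)) ->
    (\int[P]_(w in [set w | forall i, B i (tnth (Z w) i)]) F1 w =
     \int[P]_(w in [set w | forall i, B i (tnth (Z w) i)]) F2 w)%E) ->
  forall D, measurable D ->
    (\int[P]_(w in Z @^-1` D) F1 w = \int[P]_(w in Z @^-1` D) F2 w)%E.
Proof.
move=> mZ mF1 mF2 F10 F20 fin rect D mD.
have [m1 m1E] := weighted_law_measure P mZ mF1 F10.
have [m2 m2E] := weighted_law_measure P mZ mF2 F20.
pose G : set (set (n.-tuple U)) := [set A | exists2 B : 'I_n -> set U,
  (forall i, measurable (B i)) & A = [set t | forall i, B i (tnth t i)]].
rewrite -m1E -m2E; apply: (measure_unique G (fun=> setT)) => //.
- apply/seteqP; split.
    apply: smallest_sub; first exact: smallest_sigma_algebra.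
    move=> A; rewrite -bigcup_seq => -[i _ [B mB <-]].
    apply: sub_sigma_algebra; exists (fun k => if k == i then B else setT).
      by move=> k; case: ifP.
    apply/seteqP; split => t /=.
      by move=> [_ Bt] k; case: ifPn => // /eqP ->.
    by move=> /(_ i); rewrite eqxx.
  apply: smallest_sub; first exact: sigma_algebra_measurable.
  move=> _ [B mB ->].
  rewrite (_ : [set t | _] = \bigcap_(i in [set: 'I_n]) ((@tnth _ _ ^~ i) @^-1` B i)).
    apply: fin_bigcap_measurable => // i _.
    by rewrite -[X in measurable X]setTI; apply: measurable_tnth.
  apply/seteqP; split => t /=; first by move=> h i _; exact: h.
  by move=> h i; exact: h.
- move=> _ _ [B1 mB1 ->] [B2 mB2 ->].
  exists (fun i => B1 i `&` B2 i) => [i|]; first exact: measurableI.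
  apply/seteqP; split => t /=; first by move=> [h1 h2] i.
  by move=> h; split => i; have [] := h i.
- by move=> _; exists (fun=> setT) => //; apply/seteqP; split.
- by apply/seteqP; split => // t _; exists 0%N.
- by move=> _ [B mB ->]; rewrite m1E m2E; exact: rect.
- by move=> k; rewrite m1E preimage_setT.
Qed.

End tuple_law.

Section logistic_model.
Context {d : measure_display} {T : measurableType d} {R : realType} (P : probability T R).
Context {p : nat} (b0 : 'rV[R]_p).

Definition response_density (b : bool) (x : p.-tuple R) : R :=
  expR (b%:R * linpred x b0 - cumulant (linpred x b0)).

Lemma expR_loglik n (x : 'I_n -> p.-tuple R) (y : 'I_n -> bool) :
  expR (loglik x y b0) = \prod_i response_density (y i) (x i).
Proof. by rewrite expR_sum. Qed.

Lemma response_density_true x : response_density true x = sigmoid (linpred x b0).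
Proof. by rewrite /response_density mul1r expRD expRN expR_cumulant. Qed.

Lemma response_density_false x : response_density false x = 1 - sigmoid (linpred x b0).
Proof. by rewrite /response_density mul0r sub0r expRN expR_cumulant onem_sigmoid. Qed.

Lemma response_density_ge0 b x : 0 <= response_density b x.
Proof. exact: expR_ge0. Qed.

Lemma response_density_le1 b x : response_density b x <= 1.
Proof.
case: b; rewrite ?response_density_true ?response_density_false.
  exact/ltW/sigmoid_lt1.
by rewrite lerBlDr lerDl ltW// sigmoid_gt0.
Qed.

Lemma measurable_linpred (b : 'rV[R]_p) : measurable_fun setT (fun x : p.-tuple R => linpred x b).
Proof.
apply: measurable_sum => j; apply: measurable_funM => //; exact: measurable_tnth.
Qed.

Lemma measurable_cumulant : measurable_fun setT (@cumulant R).
Proof.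
apply: (measurableT_comp (@measurable_ln R)).
exact: measurable_funD.
Qed.

Lemma measurable_response_density b : measurable_fun setT (response_density b).
Proof.
apply: measurableT_comp => //; apply: measurable_funB.
  apply: measurable_funM => //; exact: measurable_linpred.
exact: measurableT_comp measurable_cumulant (measurable_linpred _).
Qed.

(** Inverting the logit identifies [pr] with the sigmoid of the linear predictor. The case of
    response 0 follows by subtraction from the law of the covariate, all quantities being finite. *)
Lemma logistic_regression_density (X : {RV P >-> p.-tuple R}) (Y : {RV P >-> bool}) :
  logistic_regression X Y b0 -> forall (B : set (p.-tuple R)) b, measurable B ->
  P [set w | B (X w) /\ Y w = b] =
  (\int[P]_(w in X @^-1` B) (response_density b (X w))%:E)%E.
Proof.
move=> [pr [mpr pr01 prE] prlog] B b mB.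
have prd x : pr x = response_density true x.
  have [/andP[pr0 pr1] lpr] := prlog x.
  rewrite response_density_true /sigmoid -lpr lnK ?posrE; last first.
    by rewrite divr_gt0// subr_gt0.
  by field; rewrite subr_eq0 gt_eqF//= subrK oner_eq0.
have mXB : measurable (X @^-1` B).
  by rewrite -[X in measurable X]setTI; apply: measurable_funP.
have mden c : measurable_fun (X @^-1` B) (fun w => (response_density c (X w))%:E).
  apply/measurable_EFinP; apply: measurable_funTS.
  by apply: measurableT_comp => //; exact: measurable_response_density.
have true_case : P [set w | B (X w) /\ Y w = true] =
    (\int[P]_(w in X @^-1` B) (response_density true (X w))%:E)%E.
  by rewrite prE//; apply: eq_integral => w _; rewrite prd.
case: b => //.
have mYt c : measurable [set w | B (X w) /\ Y w = c].
  rewrite (_ : [set w | _] = X @^-1` B `&` Y @^-1` [set c])//.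
  by apply: measurableI => //; rewrite -[X in measurable X]setTI; apply: measurable_funP.
have split_P : (P (X @^-1` B) = P [set w | B (X w) /\ Y w = true] +
    P [set w | B (X w) /\ Y w = false])%E.
  rewrite -measureU//; last by apply/seteqP; split => w //= -[[_ ->] [_]].
  congr (P _); apply/seteqP; split => w /=.
    by case E : (Y w) => BX; [left|right].
  by move=> [[]|[]].
have split_int : (P (X @^-1` B) = \int[P]_(w in X @^-1` B) (response_density true (X w))%:E +
    \int[P]_(w in X @^-1` B) (response_density false (X w))%:E)%E.
  rewrite -ge0_integralD//.
  - rewrite -[LHS]mul1e -integral_cst//; apply: eq_integral => w _.
    by rewrite response_density_true response_density_false -EFinD addrC subrK.
  - by move=> w _; rewrite lee_fin response_density_ge0.
  - by move=> w _; rewrite lee_fin response_density_ge0.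
have fin : (\int[P]_(w in X @^-1` B) (response_density true (X w))%:E)%E \is a fin_num.
  by rewrite -true_case fin_num_measure.
move: split_int fin; rewrite split_P true_case.
set A := (\int[P]_(w in _) (response_density true _)%:E)%E => + fin.
by move=> /(congr1 (fun z => z - A)%E); rewrite ![(A + _)%E]addeC !addeK.
Qed.

(** This says that exp (loglik X y b0) is the conditional probability of [y] given the whole design,
    without conditional expectations. On rectangles of designs both sides factor over the
    observations. *)
Lemma iid_logistic_law n (X : 'I_n -> {RV P >-> p.-tuple R})
    (Y : 'I_n -> {RV P >-> bool}) (y : {ffun 'I_n -> bool}) (D : set (n.-tuple (p.-tuple R))) :
  iid_logistic_sample X Y b0 -> measurable D ->
  P [set w | D [tuple X i w | i < n] /\ forall i, Y i w = y i] =
  (\int[P]_(w in [set w | D [tuple X i w | i < n]])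
     (expR (loglik (fun i => X i w) y b0))%:E)%E.
Proof.
move=> [indep _ logi] mD.
pose Z w := [tuple X i w | i < n].
have mZ : measurable_fun setT Z.
  apply/measurable_fun_tnthP => i.
  rewrite (_ : _ \o _ = X i)//; apply/funext => w /=; by rewrite tnth_mktuple.
pose E := [set w | forall i, Y i w = y i].
have mE : measurable E.
  rewrite (_ : E = \bigcap_(i in [set: 'I_n]) (Y i @^-1` [set y i])).
    apply: fin_bigcap_measurable => // i _.
    by rewrite -[X in measurable X]setTI; apply: measurable_funP.
  apply/seteqP; split => w /=; first by move=> h i _; exact: h.
  by move=> h i; exact: h.
pose F1 w : \bar R := (\1_E w)%:E.
pose F2 w : \bar R := (expR (loglik (fun i => X i w) y b0))%:E.
have mF2 : measurable_fun setT F2.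
  apply/measurable_EFinP.
  rewrite (_ : (fun w => _) = fun w => \prod_i response_density (y i) (X i w)).
    apply: measurable_prod => i _; apply: measurableT_comp => //.
    exact: measurable_response_density.
  by apply/funext => w; rewrite expR_loglik.
have int1 A : measurable A -> (\int[P]_(w in A) F1 w = P (A `&` E))%E.
  by move=> mA; rewrite integral_indic// setIC.
have mpre A : measurable A -> measurable (Z @^-1` A).
  by move=> mA; rewrite -[X in measurable X]setTI; exact: mZ.
transitivity (\int[P]_(w in Z @^-1` D) F1 w)%E; first by rewrite int1//; exact: mpre.
apply: (@weighted_law_tuple_unique _ _ _ _ _ _ _ _ F1 F2) => //.
- exact/measurable_EFinP.
- by move=> w; rewrite lee_fin.
- by move=> w; rewrite lee_fin expR_ge0.
- by rewrite int1// (le_lt_trans (probability_le1 _ _))// ?ltry//; exact: measurableI.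
move=> B mB.
pose U := (p.-tuple R * bool)%type.
pose W (i : 'I_n) (w : T) : U := (X i w, Y i w).
have mW i : measurable_fun setT (W i) by exact: measurable_fun_pair.
(* A function of the covariate alone, but defined on the pair, since independence is given for the
   pairs. *)
pose f (i : 'I_n) (u : U) : R := \1_(B i) u.1 * response_density (y i) u.1.
have mf i : measurable_fun setT (f i).
  apply: measurable_funM.
    by apply: (measurableT_comp (f := \1_(B i) : p.-tuple R -> R)).
  by apply: (measurableT_comp (measurable_response_density (y i))).
have f01 i u : 0 <= f i u <= 1.
  rewrite /f indicE; case: (_ \in _); rewrite /= ?mulr1n ?mulr0n ?mul0r ?mul1r ?lexx ?ler01//.
  by rewrite response_density_ge0 response_density_le1.
have mX i : measurable_fun setT (X i) by [].
have mBX i : measurable (X i @^-1` B i).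
  by rewrite -[X in measurable X]setTI; exact: mX.
have mRect : measurable [set w | forall i, B i (tnth (Z w) i)].
  rewrite (_ : [set w | _] = \bigcap_(i in [set: 'I_n]) (X i @^-1` B i)).
    by apply: fin_bigcap_measurable.
  by apply/seteqP; split => w /=; [move=> h i _; have := h i; rewrite tnth_mktuple
    |move=> h i; rewrite tnth_mktuple; exact: h].
rewrite int1//.
have := indep [set: 'I_n]%SET (fun i => B i `*` [set y i]) (fun i => measurableX (mB i) _).
have -> : [set w | forall i, i \in [set: 'I_n]%SET -> (B i `*` [set y i]) (X i w, Y i w)] =
    [set w | forall i, B i (tnth (Z w) i)] `&` E.
  apply/seteqP; split => w /=.
    by move=> h; split => i; have [|/= h1 h2] := h i; rewrite ?inE// tnth_mktuple.
  by move=> [h1 h2] i _; split => /=; [have := h1 i; rewrite tnth_mktuple|exact: h2].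
move=> /(_ (fun=> I)) ->.
have -> : (\int[P]_(w in [set w | forall i, B i (tnth (Z w) i)]) F2 w =
    \int[P]_w (\prod_i f i (W i w))%:E)%E.
  rewrite integral_mkcond; apply: eq_integral => w _; rewrite patchE.
  rewrite /F2 expR_loglik /f big_split/=.
  case: ifPn => wB; congr EFin.
    rewrite [X in _ = X * _]big1 ?mul1r// => i _; rewrite indicE mem_set//.
    by have := set_mem wB i; rewrite tnth_mktuple.
  have [i iB] : exists i, ~ B i (X i w).
    apply/existsNP => h; move/negP: wB; apply; apply/mem_set => i.
    by rewrite tnth_mktuple.
  by rewrite (bigD1 i)//= indicE memNset// !mul0r.
rewrite (integral_prod_independent (M := 1) mW indep mf f01).
apply: eq_big => [i|i _]; first by rewrite inE.
transitivity (P [set w | B i (X i w) /\ Y i w = y i]) => //.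
rewrite (logistic_regression_density (logi i))// integral_mkcond.
apply: eq_integral => w _; rewrite patchE /f/= indicE.
have -> : (w \in X i @^-1` B i) = (X i w \in B i).
  by apply/idP/idP => /set_mem wB; exact/mem_set.
by case: ifPn => _; rewrite ?mul1r ?mul0r.
Qed.

End logistic_model.

(** * Measurability of the selection event *)

Section rational_coefficients.
Context {R : realType} {n p : nat}.

Lemma cumulant_lipschitz (s t : R) : cumulant t - cumulant s <= `|t - s|.
Proof.
have := bregman_ge0 t (s - t); rewrite /bregman addrCA subrr addr0.
have s0 := sigmoid_gt0 t; have s1 := sigmoid_lt1 t.
have := ler_norm (t - s); have := normr_ge0 (t - s); nra.
Qed.

Lemma loglik_lipschitz (x : 'I_n -> p.-tuple R) (y : 'I_n -> bool) (b c : 'rV[R]_p) :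
  loglik x y b - loglik x y c <=
  2 * (\sum_i \sum_j `|tnth (x i) j|) * norm1 (b - c).
Proof.
rewrite -sumrB (mulrC 2) -mulrA mulr_suml; apply: ler_sum => i _.
have h : `|linpred (x i) (b - c)| <= (\sum_j `|tnth (x i) j|) * norm1 (b - c).
  apply: linpred_le => j; rewrite (bigD1 j)//= lerDl.
  by apply: sumr_ge0 => k _.
rewrite mulrCA; apply: le_trans (ler_wpM2l _ h) => //.
have := cumulant_lipschitz (linpred (x i) b) (linpred (x i) c).
rewrite distrC -linpredB; have := ler_norm (linpred (x i) (b - c)).
rewrite linpredB; case: (y i) => /=; rewrite ?mulr1n ?mulr0n ?mul1r ?mul0r; last first.
  by have := normr_ge0 (linpred (x i) b - linpred (x i) c); lra.
lra.
Qed.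

Definition rational_vector (J : {set 'I_p}) (r : {ffun 'I_p -> rat}) : 'rV[R]_p :=
  \row_j (if j \in J then ratr (r j) else 0).

Lemma submodel_rational_vector J r : submodel J (rational_vector J r).
Proof. by move=> j jJ; rewrite mxE (negbTE jJ). Qed.

Lemma rational_vector_dense (J : {set 'I_p}) (b : 'rV[R]_p) (e : R) :
  submodel J b -> 0 < e -> exists r, norm1 (b - rational_vector J r) <= p%:R * e.
Proof.
move=> Jb e0.
have /choice[r rP] : forall j, exists r : rat, `|b ord0 j - ratr r| < e.
  move=> j; have be : b ord0 j - e < b ord0 j + e by rewrite ltrBlDr -addrA ltrDl addr_gt0.
  have [r] := rat_in_itvoo be; rewrite in_itv/= => /andP[r1 r2]; exists r.
  by rewrite ltr_norml; apply/andP; split; lra.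
exists [ffun j => r j]; rewrite mulr_natl -[X in _ *+ X](card_ord p) -sumr_const.
apply: ler_sum => j _; rewrite !mxE ffunE; case: ifPn => jJ; first exact/ltW.
by rewrite Jb// subr0 normr0 ltW.
Qed.

(** The log-likelihood is Lipschitz in the parameter and rational vectors are dense in the submodel,
    so the supremum is effectively countable; this makes it measurable in the design. *)
Lemma lt_max_loglikP (x : 'I_n -> p.-tuple R) (y : 'I_n -> bool) J (c : R) :
  c < max_loglik x y J <-> exists r, c < loglik x y (rational_vector J r).
Proof.
split=> [cJ|[r cr]]; last first.
  by apply: (lt_le_trans cr); apply: max_loglik_ge; exact: submodel_rational_vector.
have [b Jb cb] : exists2 b, submodel J b & c < loglik x y b.
  apply: contrapT => h; move: cJ; rewrite ltNge => /negP; apply.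
  apply: max_loglik_le => b Jb; rewrite leNgt; apply/negP => cb.
  by apply: h; exists b.
set g := loglik x y b - c; have g0 : 0 < g by rewrite subr_gt0.
pose M := 2 * (\sum_i \sum_j `|tnth (x i) j|).
have M0 : 0 <= M by rewrite mulr_ge0// sumr_ge0// => i _; rewrite sumr_ge0.
pose e := g / (M * p%:R + 1).
have Mp : 0 < M * p%:R + 1 by rewrite ltr_wpDl// mulr_ge0.
have e0 : 0 < e by rewrite divr_gt0.
have [r hr] := rational_vector_dense Jb e0; exists r.
have := loglik_lipschitz x y b (rational_vector J r); rewrite -/M.
have := ler_wpM2l M0 hr.
have : M * (p%:R * e) < g.
  have -> : M * (p%:R * e) = g * (M * p%:R / (M * p%:R + 1)) by rewrite /e; ring.
  rewrite -[ltRHS]mulr1 ltr_pM2l//.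
  by rewrite ltr_pdivrMr// mul1r ltrDl.
rewrite /g; lra.
Qed.

End rational_coefficients.

Section measurable_selection.
Context {R : realType} {n p : nat}.
Let dsgn := n.-tuple (p.-tuple R).
Implicit Types (y : 'I_n -> bool) (J : {set 'I_p}).

Lemma measurable_loglik y (b : 'rV[R]_p) :
  measurable_fun [set: dsgn] (fun x => loglik (tnth x) y b).
Proof.
apply: measurable_sum => i.
have mt : measurable_fun [set: dsgn] (fun x => linpred (tnth x i) b).
  apply: (measurableT_comp (f := fun z : p.-tuple R => linpred z b)).
    exact: measurable_linpred.
  exact: measurable_tnth.
apply: measurable_funB; first exact: measurable_funM.
exact: measurableT_comp (@measurable_cumulant R) mt.
Qed.

Lemma measurable_max_loglik y J :
  measurable_fun [set: dsgn] (fun x => max_loglik (tnth x) y J).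
Proof.
move=> mD; apply: (measurability _ (RGenOInfty.measurableE R)) => //.
move=> _ [_ [c ->] <-]; rewrite setTI.
rewrite (_ : _ @^-1` _ = \bigcup_r ((fun x : dsgn => loglik (tnth x) y (rational_vector J r)) @^-1` `]c, +oo[)).
  apply: countable_bigcupT_measurable => // r.
  by rewrite -[X in measurable X]setTI; apply: measurable_loglik.
apply/seteqP; split => x /=; rewrite in_itv/= andbT.
  by move=> /lt_max_loglikP[r cr]; exists r => //=; rewrite in_itv/= andbT.
by move=> [r _ /=]; rewrite in_itv/= andbT => cr; apply/lt_max_loglikP; exists r.
Qed.

Lemma measurable_unique_BIC gamma y q (J0 : {set 'I_p}) :
  measurable [set x : dsgn | unique_BIC_minimizer gamma (tnth x) y q J0].
Proof.
have mBIC J : measurable_fun [set: dsgn] (fun x => BIC gamma (tnth x) y J).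
  apply: measurable_funD => //; apply: measurable_funM => //.
  exact: measurable_max_loglik.
have [J0q|J0q] := boolP (#|J0| <= q)%N; last first.
  rewrite (_ : [set x | _] = set0)//; apply/seteqP; split => x //= -[J0q' _].
  by rewrite J0q' in J0q.
rewrite (_ : [set x | _] = \bigcap_(J in [set J : {set 'I_p} | (#|J| <= q)%N /\ J != J0])
   [set x : dsgn | BIC gamma (tnth x) y J0 < BIC gamma (tnth x) y J]).
  apply: fin_bigcap_measurable => // J _.
  have := measurable_fun_ltr (mBIC J0) (mBIC J).
  move=> /(_ measurableT [set true]); rewrite setTI; exact.
apply/seteqP; split => x /=.
  by move=> [_ h] J /= [Jq JJ0]; exact: h.
by move=> h; split => // J Jq JJ0; apply: h.
Qed.

End measurable_selection.

(** * Concentration of the Fisher information *)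

Section iid_concentration.
Context {d d' : measure_display} {T : measurableType d} {U : measurableType d'}
  {R : realType} (P : probability T R).

Lemma bounded_integrable (f : T -> R) (M : R) :
  measurable_fun setT f -> (forall w, `|f w| <= M) ->
  P.-integrable setT (EFin \o f).
Proof.
move=> mf fM; apply: (@le_integrable _ _ _ _ _ measurableT _ (cst M%:E)).
- exact/measurable_EFinP.
- move=> w _ /=; rewrite lee_fin (le_trans (fM w))//; exact: ler_norm.
- exact: finite_measure_integrable_cst.
Qed.

Lemma integral_identically_distributed n (Z : 'I_n -> T -> U) (f : U -> R) i k :
  (forall i, measurable_fun setT (Z i)) -> identically_distributed P Z ->
  measurable_fun setT f -> (forall u, 0 <= f u) ->
  (\int[P]_w (f (Z i w))%:E = \int[P]_w (f (Z k w))%:E)%E.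
Proof.
move=> mZ idZ mf f0.
have push j : (\int[P]_w (f (Z j w))%:E = \int[pushforward P (Z j)]_u (f u)%:E)%E.
  rewrite ge0_integral_pushforward ?preimage_setT//; first exact/measurable_EFinP.
  by move=> u _; rewrite lee_fin.
rewrite !push; apply: eq_measure_integral => A mA _; exact: idZ.
Qed.

(** Chernoff's bound with [l] = e / (8 b^2), the minimizer of 4 b^2 l^2 - l e. The condition e <= b
    keeps l |g - m| within 1/4, where the exponential is bounded by a quadratic. *)
Lemma iid_mean_tail n (Z : 'I_n -> T -> U) (g : U -> R) (i0 : 'I_n) (m b e : R) :
  (forall i, measurable_fun setT (Z i)) -> mutually_independent P Z ->
  identically_distributed P Z ->
  measurable_fun setT g -> (forall u, `|g u| <= b) -> 0 < b -> 0 <= e <= b ->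
  (\int[P]_w (g (Z i0 w))%:E = m%:E)%E ->
  (P [set w | n%:R * e < \sum_i g (Z i w) - n%:R * m]%R <=
   (expR (- (n%:R * e ^+ 2 / (16 * b ^+ 2))))%:E)%E.
Proof.
move=> mZ indep idZ mg gb b0 /andP[e0 eb] gm.
have mgZ i : measurable_fun setT (fun w => g (Z i w)) by exact: measurableT_comp.
have ig : P.-integrable setT (fun w => (g (Z i0 w))%:E).
  by apply: (bounded_integrable (M := b)).
have mb : `|m| <= b.
  rewrite -lee_fin -abse_EFin -gm -[b%:E]mule1 -(@probability_setT _ _ _ P) -integral_cst//.
  apply: le_trans (le_abse_integral _ _ _) _ => //; first exact/measurable_EFinP.
  apply: ge0_le_integral => //.
  - by apply/measurable_EFinP; apply: measurableT_comp.
  - by move=> w _ /=; rewrite lee_fin.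
pose l := e / (8 * b ^+ 2); have l0 : 0 <= l by rewrite divr_ge0// mulr_ge0// sqr_ge0.
have small u : `|l * (g u - m)| <= 1 / 4.
  rewrite normrM (ger0_norm l0).
  have h : `|g u - m| <= 2 * b by rewrite (le_trans (ler_normB _ _))// mulr_natl mulr2n lerD.
  apply: le_trans (ler_wpM2l l0 h) _.
  rewrite /l (_ : _ * (2 * b) = e / b * (1 / 4)); last by field; rewrite gt_eqF.
  by rewrite ler_piMl// ler_pdivrMr// mul1r.
have mgf : (\int[P]_w (expR (l * (g (Z i0 w) - m)))%:E <= (expR (4 * b ^+ 2 * l ^+ 2))%:E)%E.
  apply: (@le_trans _ _ (\int[P]_w (1 - l * m + 4 * b ^+ 2 * l ^+ 2 + l * g (Z i0 w))%:E)%E).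
    apply: ge0_le_integral => //.
    - apply/measurable_EFinP; apply: measurableT_comp => //; apply: measurable_funM => //.
      exact: measurable_funB.
    - by apply/measurable_EFinP; apply: measurable_funD => //; exact: measurable_funM.
    - move=> w _; rewrite lee_fin.
      apply: le_trans (expR_le_quadratic (small _)) _.
      have h : (g (Z i0 w) - m) ^+ 2 <= 4 * b ^+ 2.
        have -> : 4 * b ^+ 2 = (2 * b) ^+ 2 by ring.
        rewrite -[leLHS]real_normK ?num_real// ler_sqr ?nnegrE ?mulr_ge0// ?(ltW b0)//.
        by rewrite (le_trans (ler_normB _ _))// mulr_natl mulr2n lerD.
      have := ler_wpM2l (sqr_ge0 l) h; rewrite -exprMn; lra.
  under eq_integral do rewrite EFinD.
  rewrite integralD//; last 2 first.
  - exact: finite_measure_integrable_cst.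
  - under eq_fun do rewrite EFinM; exact: integrableZl.
  rewrite integral_cst// [X in (_ * X + _)%E](_ : _ = 1%E); last exact: (@probability_setT _ _ _ P).
  rewrite mule1.
  under eq_integral do rewrite EFinM.
  rewrite integralZl// gm -EFinM -EFinD lee_fin.
  have := expR_ge1Dx (4 * b ^+ 2 * l ^+ 2); lra.
pose f (i : 'I_n) (u : U) := expR (l * (g u - m)).
have mf i : measurable_fun setT (f i).
  apply: measurableT_comp => //; apply: measurable_funM => //.
  exact: measurable_funB.
have fM i u : 0 <= f i u <= expR (1 / 4).
  by rewrite expR_ge0/= ler_expR (le_trans (ler_norm _)).
have prodE := integral_prod_independent mZ indep mf fM.
set A := [set w | _ < _].
have mA : measurable A.
  have ms : measurable_fun setT (fun w => \sum_i g (Z i w) - n%:R * m).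
    by apply: measurable_funB => //; exact: measurable_sum.
  have := measurable_fun_ltr (measurable_cst (n%:R * e)) ms.
  by move=> /(_ measurableT [set true]); rewrite setTI; exact.
pose c := expR (- (l * (n%:R * e))).
apply: (@le_trans _ _ (\int[P]_w (c%:E * (\prod_i f i (Z i w))%:E))%E).
  rewrite -[A]setIT -integral_indic//; apply: ge0_le_integral => //.
  - by apply/measurable_EFinP.
  - apply/measurable_EFinP; apply: measurable_funM => //; apply: measurable_prod => i _.
    exact: measurableT_comp.
  move=> w _; rewrite indicE; case: (boolP (w \in A)) => [/set_mem wA|_] /=; last first.
    by rewrite mulr0n -EFinM lee_fin mulr_ge0 ?expR_ge0// prodr_ge0// => i _; exact: expR_ge0.
  rewrite mulr1n -EFinM lee_fin /f -expR_sum -expRD -[leLHS]expR0 ler_expR.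
  rewrite -mulr_sumr sumrB sumr_const card_ord -(mulr_natl m) addrC -mulrBr mulr_ge0// subr_ge0.
  exact/ltW.
rewrite ge0_integralZl//; last 3 first.
- apply/measurable_EFinP; apply: measurable_prod => i _; exact: measurableT_comp.
- by move=> w _; rewrite lee_fin prodr_ge0// => i _; exact: expR_ge0.
- by rewrite lee_fin expR_ge0.
rewrite prodE.
apply: (@le_trans _ _ (c%:E * \prod_(i < n) (expR (4 * b ^+ 2 * l ^+ 2))%:E)%E).
  rewrite lee_pmul2l ?lte_fin ?expR_gt0//.
  suff : (0 <= \prod_(i < n) \int[P]_w (f i (Z i w))%:E <=
      \prod_(i < n) (expR (4 * b ^+ 2 * l ^+ 2))%:E)%E by case/andP.
  elim/big_ind2 : _ => [|x1 x2 y1 y2 /andP[? ?] /andP[? ?]|i _].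
  - by rewrite lee01 lexx.
  - by rewrite mule_ge0// lee_pmul.
  rewrite integral_ge0 => [|w _]; last by rewrite lee_fin expR_ge0.
  rewrite /= (integral_identically_distributed i i0 mZ idZ)// => u; exact: expR_ge0.
rewrite prodEFin -EFinM lee_fin prodr_const card_ord -expRM_natl -expRD ler_expR.
rewrite le_eqVlt; apply/orP; left; apply/eqP; rewrite /l; field.
by rewrite gt_eqF.
Qed.

End iid_concentration.

Section finite_union.
Context {d : measure_display} {T : measurableType d} {R : realType} (P : probability T R).

Lemma measure_finite_cover (I : finType) (A : set T) (B : I -> set T) :
  measurable A -> (forall i, measurable (B i)) ->
  (forall w, A w -> exists i, B i w) -> (P A <= \sum_i P (B i))%E.
Proof.
move=> mA mB AB.
have -> : (\sum_i P (B i) = \int[P]_w \sum_i (\1_(B i) w)%:E)%E.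
  rewrite ge0_integral_sum//.
  - by apply: eq_bigr => i _; rewrite integral_indic// setIT.
  - by move=> i; exact/measurable_EFinP.
rewrite -[A]setIT -integral_indic//; apply: ge0_le_integral => //.
- exact/measurable_EFinP.
- by apply: emeasurable_sum => i; exact/measurable_EFinP.
- move=> w _; rewrite indicE; case: (boolP (w \in A)) => /= [/set_mem /AB[i Bi]|_].
    rewrite (bigD1 i)//= indicE mem_set//= mulr1n leeDl//.
    by apply: sume_ge0 => k _; rewrite lee_fin.
  by apply: sume_ge0 => k _; rewrite lee_fin.
Qed.

End finite_union.

Section clipping.
Context {R : realType}.

(** Covariates are bounded only almost surely, whereas the concentration bound asks for functions
    bounded everywhere. Clipping provides this and changes nothing on good designs. *)
Definition clip (a z : R) : R := Num.max (- a) (Num.min a z).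

Lemma clip_le a z : 0 <= a -> `|clip a z| <= a.
Proof.
move=> a0; rewrite ler_norml /clip le_max lexx/= ge_max ge_min lexx/= andbT.
by rewrite (le_trans _ a0)// oppr_le0.
Qed.

Lemma clip_id a z : `|z| <= a -> clip a z = z.
Proof. by rewrite ler_norml /clip => /andP[z1 z2]; rewrite (min_idPr z2) (max_idPr z1). Qed.

Lemma measurable_clip a : measurable_fun setT (clip a).
Proof. by apply: measurable_maxr => //; exact: measurable_minr. Qed.

End clipping.

Section fisher_information.
Context {R : realType} {p : nat} (b0 : 'rV[R]_p) (a : R).

Definition fisher_entry (j k : 'I_p) (x : p.-tuple R) : R :=
  logistic_var (linpred x b0) * (clip a (tnth x j) * clip a (tnth x k)).

Lemma fisher_entry_le j k x : 0 <= a -> `|fisher_entry j k x| <= a ^+ 2 / 4.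
Proof.
move=> a0; rewrite /fisher_entry normrM (ger0_norm (logistic_var_ge0 _)) normrM.
have := logistic_var_le (linpred x b0); have := logistic_var_ge0 (linpred x b0).
have : `|clip a (tnth x j)| * `|clip a (tnth x k)| <= a ^+ 2.
  by rewrite expr2 ler_pM// clip_le.
have : 0 <= `|clip a (tnth x j)| * `|clip a (tnth x k)| by rewrite mulr_ge0.
set z := _ * _; set v := logistic_var _ => z0 za v0 v4.
by apply: le_trans (ler_pM v0 z0 v4 za) _; lra.
Qed.

Lemma measurable_logistic_var : measurable_fun setT (@logistic_var R).
Proof.
have ms : measurable_fun setT (@sigmoid R).
  rewrite (_ : @sigmoid R = fun t => expR (t - cumulant t)).
    apply: measurableT_comp => //; apply: measurable_funB => //.
    exact: measurable_cumulant.
  by apply/funext => t; rewrite expRD expRN expR_cumulant.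
by apply: measurable_funM => //; exact: measurable_funB.
Qed.

Lemma measurable_fisher_entry j k : measurable_fun setT (fisher_entry j k).
Proof.
apply: measurable_funM.
  exact: measurableT_comp measurable_logistic_var (measurable_linpred _).
by apply: measurable_funM; apply: measurableT_comp (measurable_clip _) (measurable_tnth _).
Qed.

Lemma sum_fisher_entry (u : 'rV[R]_p) x :
  \sum_(jk : 'I_p * 'I_p) u ord0 jk.1 * u ord0 jk.2 * fisher_entry jk.1 jk.2 x =
  logistic_var (linpred x b0) * (\sum_j clip a (tnth x j) * u ord0 j) ^+ 2.
Proof.
rewrite expr2 mulr_suml mulr_sumr -(pair_bigA _ (fun j k => u ord0 j * u ord0 k * fisher_entry j k x))/=.
apply: eq_bigr => j _; rewrite mulr_sumr mulr_sumr; apply: eq_bigr => k _.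
by rewrite /fisher_entry; ring.
Qed.

(** An entrywise error n kappa / (4q) perturbs the quadratic form by at most that times the squared
    l1 norm, which is at most 2q times the squared Euclidean norm. Half of the curvature
    survives. *)
Lemma fisher_curvature n (x : 'I_n -> p.-tuple R) (m : 'I_p * 'I_p -> R) (q : nat) (kappa : R) :
  (0 < q)%N -> 0 < kappa -> (forall i j, `|tnth (x i) j| <= a) ->
  (forall jk, `|\sum_i fisher_entry jk.1 jk.2 (x i) - n%:R * m jk| <= n%:R * (kappa / (4 * q%:R))) ->
  (forall u, sparse (2 * q) u ->
     kappa * norm2 u ^+ 2 <= \sum_jk u ord0 jk.1 * u ord0 jk.2 * m jk) ->
  forall u, sparse (2 * q) u -> kappa / 2 * n%:R * norm2 u ^+ 2 <= fisher x b0 u u.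
Proof.
move=> q0 k0 xa dev pop u su.
have q0R : 0 < q%:R :> R by rewrite ltr0n.
have fE : fisher x b0 u u = \sum_jk u ord0 jk.1 * u ord0 jk.2 * \sum_i fisher_entry jk.1 jk.2 (x i).
  under [RHS]eq_bigr => jk _ do rewrite mulr_sumr.
  rewrite exchange_big/=; apply: eq_bigr => i _; rewrite sum_fisher_entry expr2.
  by congr (_ * (_ * _)); apply: eq_bigr => j _; rewrite clip_id.
have n1 : \sum_(jk : 'I_p * 'I_p) `|u ord0 jk.1| * `|u ord0 jk.2| = norm1 u ^+ 2.
  rewrite -(pair_bigA _ (fun j k => `|u ord0 j| * `|u ord0 k|))/= expr2 mulr_suml.
  by apply: eq_bigr => j _; rewrite mulr_sumr.
have D : \sum_jk u ord0 jk.1 * u ord0 jk.2 * (n%:R * m jk - \sum_i fisher_entry jk.1 jk.2 (x i))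
   <= n%:R * (kappa / (4 * q%:R)) * norm1 u ^+ 2.
  rewrite -n1 mulr_sumr; apply: ler_sum => jk _.
  apply: le_trans (ler_norm _) _; rewrite normrM normrM mulrC ler_wpM2r ?mulr_ge0//.
  by rewrite distrC.
have := ler_wpM2l (ler0n R n) (pop u su).
have := sqr_norm1_le su; rewrite natrM.
move: D; under eq_bigr => jk _ do rewrite mulrBr.
rewrite sumrB -fE; under [X in X - _ <= _]eq_bigr => jk _ do rewrite mulrCA.
rewrite -mulr_sumr => D n1u popu.
have : n%:R * (kappa / (4 * q%:R)) * norm1 u ^+ 2 <=
   n%:R * (kappa / (4 * q%:R)) * (2 * q%:R * norm2 u ^+ 2).
  by rewrite ler_wpM2l// mulr_ge0// divr_ge0 ?mulr_ge0// ltW.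
have -> : n%:R * (kappa / (4 * q%:R)) * (2 * q%:R * norm2 u ^+ 2) =
  kappa / 2 * n%:R * norm2 u ^+ 2 by field; rewrite gt_eqF.
lra.
Qed.

End fisher_information.

(** * Lower bound on the population information *)

Section population_information.
Context {d : measure_display} {T : measurableType d} {R : realType} (P : probability T R).
Context {p : nat} (X : T -> p.-tuple R) (b0 : 'rV[R]_p) (q : nat) (a0 a1 a2 a : R).
Hypotheses (mX : measurable_fun setT X) (a0_gt0 : 0 < a0) (a1_gt0 : 0 < a1)
  (a2_gt0 : 0 < a2) (a_gt0 : 0 < a).
Hypotheses (b0a : norm2 b0 <= a0) (b0q : sparse (2 * q) b0).
Hypothesis second_moment : forall u, sparse (2 * q) u -> norm2 u = 1 ->
  (a1%:E <= \int[P]_w (linpred (X w) u ^+ 2)%:E)%E.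
Hypothesis third_moment : forall u, sparse (2 * q) u -> norm2 u = 1 ->
  (\int[P]_w (`|linpred (X w) u| ^+ 3)%:E <= a2%:E)%E.
Hypothesis X_bounded : forall j, {ae P, forall w, `|tnth (X w) j| <= a}.

(** A truncation level for |X'b0|, chosen so that (a2 + a0^3 a2) / K = a1 / 2. At least a1 / 2 of
    the second moment is then left to the information term, and the factor 4 e^K turns it into the
    constant a1 / (8 e^K). *)
Let K := 2 * (a2 * (1 + a0 ^+ 3)) / a1.

Definition population_curvature : R := a1 / (8 * expR (2 * (a2 * (1 + a0 ^+ 3)) / a1)).

Let M0 : 0 < a2 * (1 + a0 ^+ 3).
Proof. by rewrite mulr_gt0// addr_gt0// exprn_gt0. Qed.

Let K0 : 0 < K.
Proof. by rewrite divr_gt0// mulr_gt0. Qed.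

Lemma population_curvature_gt0 : 0 < population_curvature.
Proof. by rewrite divr_gt0// mulr_gt0// expR_gt0. Qed.

Let mlin u : measurable_fun setT (fun w => linpred (X w) u).
Proof. exact: measurableT_comp (measurable_linpred u) mX. Qed.

Let mcube u : measurable_fun setT (fun w => (`|linpred (X w) u| ^+ 3)%:E).
Proof.
apply/measurable_EFinP; apply: measurable_funX; exact: measurableT_comp.
Qed.

Let mvar u : measurable_fun setT
  (fun w => (logistic_var (linpred (X w) b0) * linpred (X w) u ^+ 2)%:E).
Proof.
apply/measurable_EFinP; apply: measurable_funM; last exact: measurable_funX.
exact: measurableT_comp (measurable_logistic_var) (mlin _).
Qed.

Let third_moment_b0 : (\int[P]_w (`|linpred (X w) b0| ^+ 3)%:E <= (a0 ^+ 3 * a2)%:E)%E.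
Proof.
have [b00|b00] := eqVneq b0 0.
  rewrite (eq_integral (fun=> 0%E)) => [|w _]; last by rewrite b00 linpred0 normr0 expr0n.
  rewrite integral0 lee_fin.
  by apply: mulr_ge0; [apply: exprn_ge0|]; exact: ltW.
have N0 := norm2_gt0 b00.
pose v := (norm2 b0)^-1 *: b0.
have v1 : norm2 v = 1 by rewrite norm2Z gtr0_norm ?invr_gt0// mulVf// gt_eqF.
have sv : sparse (2 * q) v.
  apply: leq_trans b0q; apply: subset_leq_card; apply/fintype.subsetP => j.
  by rewrite !inE mxE mulf_eq0 negb_or => /andP[].
have b0v w : linpred (X w) b0 = norm2 b0 * linpred (X w) v.
  by rewrite linpredZ mulrA mulfV ?mul1r// gt_eqF.
under eq_integral => w _ do rewrite b0v normrM (gtr0_norm N0) exprMn EFinM.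
rewrite ge0_integralZl//; last by rewrite lee_fin exprn_ge0// ltW.
apply: (@le_trans _ _ ((norm2 b0 ^+ 3)%:E * a2%:E)%E).
  by apply: lee_wpmul2l (third_moment sv v1); rewrite lee_fin exprn_ge0// ltW.
by rewrite -EFinM lee_fin ler_wpM2r ?(ltW a2_gt0)// lerXn2r ?nnegrE ?norm2_ge0// ltW.
Qed.

(* Where [|X'b0| <= K] the logistic variance is bounded below; the third moments
   control the second moment of the rest, in the form [x^2 <= x^2 |y| / K]. *)
Let pointwise (s t : R) :
  s ^+ 2 <= 4 * expR K * (logistic_var t * s ^+ 2) + K^-1 * (`|s| ^+ 3 + `|t| ^+ 3).
Proof.
have v0 := logistic_var_ge0 t; have s2 := sqr_ge0 s.
have [tK|tK] := leP `|t| K.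
  have h : 1 <= 4 * expR K * logistic_var t.
    have := logistic_var_ge t; rewrite ler_pdivrMr// => h.
    have : expR (- K) <= logistic_var t * 4 by apply: le_trans h; rewrite ler_expR lerN2.
    have w4 : 0 < logistic_var t * 4 by apply: mulr_gt0 => //; exact: logistic_var_gt0.
    rewrite expRN invf_ple ?posrE ?expR_gt0//.
    rewrite -div1r ler_pdivrMr// => h2.
    by apply: (le_trans h2); rewrite le_eqVlt; apply/orP; left; apply/eqP; ring.
  have := ler_wpM2r s2 h; rewrite mul1r -(mulrA (4 * expR K)) => h2; apply: (le_trans h2).
  by rewrite lerDl mulr_ge0 ?invr_ge0 ?(ltW K0)// addr_ge0// exprn_ge0.
apply: (@le_trans _ _ (K^-1 * (`|s| ^+ 3 + `|t| ^+ 3))); last first.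
  by rewrite lerDr; apply: mulr_ge0; [rewrite mulr_ge0// expR_ge0|exact: mulr_ge0].
rewrite ler_pdivlMl//.
rewrite -[s ^+ 2]real_normK ?num_real//.
have := normr_ge0 s; have := normr_ge0 t; set y := `|t| in tK *; set x := `|s| => y0 x0.
have h1 : K * x ^+ 2 <= y * x ^+ 2 by rewrite ler_wpM2r ?exprn_ge0// ltW.
apply: (le_trans h1).
have [xy|yx] := leP x y.
  have : 0 <= y * (y ^+ 2 - x ^+ 2) by rewrite mulr_ge0// subr_ge0 lerXn2r.
  have : 0 <= x ^+ 3 by rewrite exprn_ge0.
  lra.
have : 0 <= x ^+ 2 * (x - y) by rewrite mulr_ge0 ?sqr_ge0// subr_ge0 ltW.
have : 0 <= y ^+ 3 by rewrite exprn_ge0.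
lra.
Qed.

Let information_ge u : sparse (2 * q) u -> norm2 u = 1 ->
  (population_curvature%:E <=
   \int[P]_w (logistic_var (linpred (X w) b0) * linpred (X w) u ^+ 2)%:E)%E.
Proof.
move=> su u1; set I := integral _ _ _.
have vnn w : (0 <= (logistic_var (linpred (X w) b0) * linpred (X w) u ^+ 2)%:E)%E.
  by rewrite lee_fin mulr_ge0 ?logistic_var_ge0 ?sqr_ge0.
have I0 : (0 <= I)%E by exact: integral_ge0.
have E0 : 0 < 4 * expR K by rewrite mulr_gt0// expR_gt0.
have h : (a1%:E <= (4 * expR K)%:E * I + (K^-1)%:E * (a2%:E + (a0 ^+ 3 * a2)%:E))%E.
  apply: (le_trans (second_moment su u1)).
  apply: (@le_trans _ _ (\int[P]_w ((4 * expR K)%:E *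
     (logistic_var (linpred (X w) b0) * linpred (X w) u ^+ 2)%:E +
     (K^-1)%:E * ((`|linpred (X w) u| ^+ 3)%:E + (`|linpred (X w) b0| ^+ 3)%:E)))%E).
    apply: ge0_le_integral => //.
    - by move=> w _; rewrite lee_fin sqr_ge0.
    - by apply/measurable_EFinP; exact: measurable_funX.
    - by apply: emeasurable_funD; apply: measurable_funeM => //; exact: emeasurable_funD.
    - move=> w _; have := pointwise (linpred (X w) u) (linpred (X w) b0).
      by rewrite -lee_fin => /le_trans; apply.
  have c0 u' w : (0 <= (`|linpred (X w) u'| ^+ 3)%:E)%E by rewrite lee_fin exprn_ge0.
  rewrite ge0_integralD//; last 4 first.
  - by move=> w _; rewrite mule_ge0// lee_fin ltW.
  - by apply: measurable_funeM.
  - by move=> w _; rewrite mule_ge0 ?adde_ge0// lee_fin invr_ge0 ltW.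
  - by apply: measurable_funeM; exact: emeasurable_funD.
  rewrite ge0_integralZl//.
  rewrite ge0_integralZl//; last 3 first.
  - exact: emeasurable_funD.
  - by move=> w _; rewrite adde_ge0.
  - by rewrite lee_fin invr_ge0 ltW.
  rewrite ge0_integralD//.
  rewrite leeD2l// lee_wpmul2l// ?lee_fin ?invr_ge0 ?(ltW K0)// leeD//.
  exact: third_moment.
have : I \is a fin_num \/ I = +oo%E.
  by case: (I) I0 => [r||] //; [left|right].
case=> [fI|->]; last by rewrite leey.
move: h; rewrite -(fineK fI) -EFinD !lee_fin /= => h.
have KE : K^-1 * (a2 + a0 ^+ 3 * a2) = a1 / 2.
  by rewrite /K; field; rewrite !gt_eqF// addr_gt0// exprn_gt0.
rewrite KE in h.
rewrite /population_curvature -/K ler_pdivrMr ?mulr_gt0 ?expR_gt0//.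
lra.
Qed.

(** The clipped entries have finite means, which define [m]. Its quadratic form is the information
    of the unclipped covariate because clipping is almost surely the identity; scaling reduces the
    bound to unit vectors. *)
Lemma population_information_matrix : exists m : 'I_p * 'I_p -> R,
  (forall jk, (\int[P]_w (fisher_entry b0 a jk.1 jk.2 (X w))%:E = (m jk)%:E)%E) /\
  (forall u, sparse (2 * q) u -> population_curvature * norm2 u ^+ 2 <=
     \sum_jk u ord0 jk.1 * u ord0 jk.2 * m jk).
Proof.
have int jk : P.-integrable setT (EFin \o (fun w => fisher_entry b0 a jk.1 jk.2 (X w))).
  apply: (bounded_integrable P (M := a ^+ 2 / 4)).
    exact: measurableT_comp (measurable_fisher_entry _ _ _ _) mX.
  by move=> w; rewrite fisher_entry_le// ltW.
pose m jk := fine (\int[P]_w (fisher_entry b0 a jk.1 jk.2 (X w))%:E)%E.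
have mE jk : (\int[P]_w (fisher_entry b0 a jk.1 jk.2 (X w))%:E = (m jk)%:E)%E.
  by rewrite fineK//; have := integrable_fin_num measurableT (int jk).
exists m; split => // u su.
have [->|u0] := eqVneq u 0.
  rewrite big1 => [|jk _]; last by rewrite mxE !mul0r.
  by rewrite sqr_norm2 big1 ?mulr0// => j _; rewrite mxE expr0n.
have N0 := norm2_gt0 u0; set N := norm2 u in N0 *.
pose v := N^-1 *: u.
have v1 : norm2 v = 1 by rewrite norm2Z gtr0_norm ?invr_gt0// mulVf// gt_eqF.
have sv : sparse (2 * q) v.
  apply: leq_trans su; apply: subset_leq_card; apply/fintype.subsetP => j.
  by rewrite !inE mxE mulf_eq0 negb_or => /andP[].
have uv j : u ord0 j = N * v ord0 j by rewrite mxE mulrA mulfV ?mul1r// gt_eqF.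
have -> : \sum_jk u ord0 jk.1 * u ord0 jk.2 * m jk =
    N ^+ 2 * \sum_jk v ord0 jk.1 * v ord0 jk.2 * m jk.
  by rewrite mulr_sumr; apply: eq_bigr => jk _; rewrite !uv; ring.
rewrite mulrC ler_pM2l ?exprn_gt0// -lee_fin.
apply: (le_trans (information_ge sv v1)).
rewrite le_eqVlt; apply/orP; left; apply/eqP.
have -> : (\sum_jk v ord0 jk.1 * v ord0 jk.2 * m jk)%:E =
    (\int[P]_w (\sum_jk v ord0 jk.1 * v ord0 jk.2 * fisher_entry b0 a jk.1 jk.2 (X w))%:E)%E.
  under eq_integral => w _ do rewrite -sumEFin.
  rewrite integral_sum//; last first.
    by move=> jk; under eq_fun do rewrite EFinM; apply: integrableZl => //; exact: int.
  rewrite -sumEFin; apply: eq_bigr => jk _.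
  under eq_integral => w _ do rewrite EFinM.
  by rewrite integralZl//; last exact: int; rewrite mE EFinM.
under [RHS]eq_integral => w _ do rewrite sum_fisher_entry.
apply: ae_eq_integral => //.
  apply/measurable_EFinP; apply: measurable_funM.
    exact: measurableT_comp measurable_logistic_var (mlin _).
  apply: measurable_funX; apply: measurable_sum => j; apply: measurable_funM => //.
  apply: measurableT_comp (measurable_clip _) _.
  exact: measurableT_comp (measurable_tnth _) mX.
have : {ae P, forall w, forall j, `|tnth (X w) j| <= a}.
  exact: filter_forall.
apply: filterS => w wX _; congr (_ * _ ^+ 2)%:E.
by apply: eq_bigr => j _; rewrite clip_id.
Qed.

End population_information.

(** * Good designs have high probability *)

Section good_design.
Context {d : measure_display} {T : measurableType d} {R : realType} (P : probability T R).
Context {n p : nat} (X : 'I_n -> {RV P >-> p.-tuple R}) (Y : 'I_n -> {RV P >-> bool})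
  (b0 : 'rV[R]_p) (q : nat) (a0 a1 a2 a : R) (i0 : 'I_n).
Hypotheses (a0_gt0 : 0 < a0) (a1_gt0 : 0 < a1) (a2_gt0 : 0 < a2) (a_gt0 : 0 < a).
Hypotheses (b0a : norm2 b0 <= a0) (b0q : sparse (2 * q) b0) (q0 : (0 < q)%N).
Hypothesis sample : iid_logistic_sample X Y b0.
Hypothesis second_moment : forall u, sparse (2 * q) u -> norm2 u = 1 ->
  (a1%:E <= \int[P]_w (linpred (X i0 w) u ^+ 2)%:E)%E.
Hypothesis third_moment : forall u, sparse (2 * q) u -> norm2 u = 1 ->
  (\int[P]_w (`|linpred (X i0 w) u| ^+ 3)%:E <= a2%:E)%E.
Hypothesis X_bounded : forall j, {ae P, forall w, `|tnth (X i0 w) j| <= a}.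

Let kappa := population_curvature a0 a1 a2.
Let b := a ^+ 2 / 4 + kappa.
Let e := kappa / (4 * q%:R).

Let kappa0 : 0 < kappa. Proof. exact: population_curvature_gt0. Qed.

Let mZ i : measurable_fun setT (fun w => (X i w, Y i w)).
Proof. exact: measurable_fun_pair. Qed.

(** The almost sure bound is given for one observation; identical distribution transfers it to the
    others through the measurable event of exceeding it. *)
Let unbounded_null i j : P [set w | a < `|tnth (X i w) j|] = 0%E.
Proof.
have [_ idZ _] := sample.
have mB : measurable [set u : p.-tuple R * bool | a < `|tnth u.1 j|].
  have mt : measurable_fun setT (fun u : p.-tuple R * bool => `|tnth u.1 j|).
    apply: measurableT_comp => //.
    exact: measurableT_comp (measurable_tnth j) (@measurable_fst _ _ _ _).
  have := measurable_fun_ltr (measurable_cst a) mt.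
  by move=> /(_ measurableT [set true]); rewrite setTI; exact.
have := idZ i i0 _ mB => /= ->.
have mA : measurable [set w | a < `|tnth (X i0 w) j|].
  by have := @mZ i0 measurableT _ mB; rewrite setTI.
have := X_bounded j.
move=> [N [mN N0 AN]]; apply/eqP; rewrite eq_le measure_ge0 andbT -N0.
apply: le_measure; rewrite ?inE// => w /= aw; apply: AN => /=.
by apply/negP; rewrite -ltNge.
Qed.

(** A bad design has either a covariate beyond the bound, a null event, or one of p^2 matrix entries
    deviating with one of two signs, hence the factor 2 p^2. Adding kappa in [b] guarantees e <= b,
    as the concentration bound requires. *)
Lemma good_design : exists G : set (n.-tuple (p.-tuple R)),
  [/\ measurable G,
      forall x, G x -> (forall i j, `|tnth (tnth x i) j| <= a) /\
        (forall u, sparse (2 * q) u ->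
           kappa / 2 * n%:R * norm2 u ^+ 2 <= fisher (tnth x) b0 u u) &
      (P [set w | ~ G [tuple X i w | i < n]] <=
       (2 * p%:R ^+ 2 * expR (- (n%:R * e ^+ 2 / (16 * b ^+ 2))))%:E)%E].
Proof.
have q0R : 0 < q%:R :> R by rewrite ltr0n.
have [indep idZ _] := sample.
have mX0 : measurable_fun setT (X i0) by [].
have [m [mE pop]] := population_information_matrix mX0 a0_gt0 a1_gt0 a2_gt0 a_gt0
  b0a b0q second_moment third_moment X_bounded.
have e0 : 0 <= e by rewrite divr_ge0 ?mulr_ge0// ltW.
have b_gt0 : 0 < b by rewrite addr_gt0// divr_gt0// exprn_gt0.
have eb : e <= b.
  apply: (@le_trans _ _ kappa); last by rewrite /b lerDr divr_ge0// sqr_ge0.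
  rewrite /e ler_pdivrMr ?mulr_gt0// ler_peMr ?(ltW kappa0)//.
  by have : 1 <= q%:R :> R; [rewrite ler1n|lra].
pose dev (x : n.-tuple (p.-tuple R)) jk : R :=
  \sum_i fisher_entry b0 a jk.1 jk.2 (tnth x i) - n%:R * m jk.
pose G : set (n.-tuple (p.-tuple R)) := [set x |
  (forall ij : 'I_n * 'I_p, `|tnth (tnth x ij.1) ij.2| <= a) /\
  (forall jk, `|dev x jk| <= n%:R * e)].
have mdev jk : measurable_fun setT (dev ^~ jk).
  apply: measurable_funB => //; apply: measurable_sum => i.
  exact: measurableT_comp (measurable_fisher_entry _ _ _ _) (measurable_tnth i).
have mle (f : n.-tuple (p.-tuple R) -> R) c : measurable_fun setT f -> measurable [set x | `|f x| <= c].
  move=> mf; have mf' : measurable_fun setT (fun x => `|f x|) by exact: measurableT_comp.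
  have := measurable_fun_ler mf' (measurable_cst c).
  by move=> /(_ measurableT [set true]); rewrite setTI; exact.
have mG : measurable G.
  rewrite (_ : G = \bigcap_(ij in [set: 'I_n * 'I_p]) [set x | `|tnth (tnth x ij.1) ij.2| <= a] `&`
     \bigcap_(jk in [set: 'I_p * 'I_p]) [set x | `|dev x jk| <= n%:R * e]).
    apply: measurableI; apply: fin_bigcap_measurable => // ij _; apply: mle => //.
    exact: measurableT_comp (measurable_tnth ij.2) (measurable_tnth ij.1).
  apply/seteqP; split => x /=; first by move=> [h1 h2]; split => ij _ /=.
  by move=> [h1 h2]; split => ij; [exact: (h1 ij)|exact: (h2 ij)].
exists G; split => // [x [xa xdev]|].
  split=> [i j|]; first exact: (xa (i, j)).
  by apply: (@fisher_curvature _ _ b0 a n _ m q kappa) => // i j; exact: (xa (i, j)).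
have mXt : measurable_fun setT (fun w => [tuple X i w | i < n]).
  apply/measurable_fun_tnthP => i.
  by rewrite (_ : _ \o _ = X i)//; apply/funext => w /=; rewrite tnth_mktuple.
pose B (o : ('I_n * 'I_p) + (('I_p * 'I_p) * bool)) : set T := match o with
  | inl ij => [set w | a < `|tnth (X ij.1 w) ij.2|]
  | inr (jk, s) => [set w | n%:R * e <
      \sum_i (-1) ^+ s * fisher_entry b0 a jk.1 jk.2 (X i w) - n%:R * ((-1) ^+ s * m jk)]
  end.
have ment jk i : measurable_fun setT (fun w => fisher_entry b0 a jk.1 jk.2 (X i w)).
  by apply: measurableT_comp => //; exact: measurable_fisher_entry.
have mB o : measurable (B o).
  case: o => [[i j]|[jk s]] /=.
    have mt : measurable_fun setT (fun w => `|tnth (X i w) j|).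
      apply: measurableT_comp => //.
      by apply: (measurableT_comp (measurable_tnth j)).
    have := measurable_fun_ltr (measurable_cst a) mt.
    by move=> /(_ measurableT [set true]); rewrite setTI; exact.
  have ms : measurable_fun setT (fun w => \sum_i (-1) ^+ s * fisher_entry b0 a jk.1 jk.2 (X i w)
      - n%:R * ((-1) ^+ s * m jk)).
    by apply: measurable_funB => //; apply: measurable_sum => i; exact: measurable_funM.
  have := measurable_fun_ltr (measurable_cst (n%:R * e)) ms.
  by move=> /(_ measurableT [set true]); rewrite setTI; exact.
have mGc : measurable [set w | ~ G [tuple X i w | i < n]].
  by have := mXt measurableT _ (measurableC mG); rewrite setTI.
apply: le_trans (measure_finite_cover P mGc mB _) _.
  move=> w; apply: contra_notP => /forallNP nB; split=> [[i j]|jk] /=.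
    by have := nB (inl (i, j)) => /=/negP; rewrite tnth_mktuple -leNgt.
  have h s := nB (inr (jk, s)).
  have devE (s : bool) : \sum_i (-1) ^+ s * fisher_entry b0 a jk.1 jk.2 (X i w) - n%:R * ((-1) ^+ s * m jk)
      = (-1) ^+ s * dev [tuple X i w | i < n] jk.
    rewrite mulrBr mulr_sumr (mulrCA n%:R); congr (_ - _).
    by apply: eq_bigr => i _; rewrite tnth_mktuple.
  have h' (s : bool) : (-1) ^+ s * dev [tuple X i w | i < n] jk <= n%:R * e.
    by rewrite leNgt -devE; apply/negP; exact: h.
  have := h' true; rewrite expr1 mulN1r => h1.
  have := h' false; rewrite expr0 mul1r => h2.
  by rewrite ler_norml h2 andbT; lra.
rewrite big_sumType/= [X in (X + _)%E]big1; last by move=> [i j] _; exact: unbounded_null.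
rewrite add0e.
apply: (@le_trans _ _ (\sum_(o : ('I_p * 'I_p) * bool)
    (expR (- (n%:R * e ^+ 2 / (16 * b ^+ 2))))%:E)%E); last first.
  rewrite sumEFin lee_fin sumr_const card_prod card_prod !card_ord card_bool.
  rewrite -[leLHS]mulr_natl !natrM le_eqVlt; apply/orP; left; apply/eqP; ring.
apply: lee_sum => -[jk s] _ /=.
have mg : measurable_fun setT (fun u : p.-tuple R * bool => (-1) ^+ s * fisher_entry b0 a jk.1 jk.2 u.1).
  apply: measurable_funM => //.
  exact: measurableT_comp (measurable_fisher_entry _ _ _ _) (@measurable_fst _ _ _ _).
apply: (iid_mean_tail (i0 := i0) mZ indep idZ mg) => //.
- move=> u; rewrite normrM normr_sign mul1r /b.
  by have := fisher_entry_le b0 jk.1 jk.2 u.1 (ltW a_gt0); have := kappa0; lra.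
- by rewrite e0.
- under eq_integral do rewrite EFinM.
  rewrite integralZl//=; first by rewrite mE.
  apply: (bounded_integrable P (M := a ^+ 2 / 4)) => // w.
  by rewrite fisher_entry_le// ltW.
Qed.

End good_design.

(** * The theorem *)

Section conditioning_on_design.
Context {d : measure_display} {T : measurableType d} {R : realType} (P : probability T R).
Context {n p : nat} (X : 'I_n -> {RV P >-> p.-tuple R}) (Y : 'I_n -> {RV P >-> bool})
  (b0 : 'rV[R]_p).
Hypothesis sample : iid_logistic_sample X Y b0.

Let Xt w := [tuple X i w | i < n].
Let Yt w : {ffun 'I_n -> bool} := [ffun i => Y i w].

Let mXt : measurable_fun setT Xt.
Proof.
apply/measurable_fun_tnthP => i.
by rewrite (_ : _ \o _ = X i)//; apply/funext => w /=; rewrite tnth_mktuple.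
Qed.

Let mpre A : measurable A -> measurable [set w | A (Xt w)].
Proof. by move=> mA; have := @mXt measurableT _ mA; rewrite setTI. Qed.

Let mYt y : measurable [set w | Yt w = y].
Proof.
rewrite (_ : [set w | _] = \bigcap_(i in [set: 'I_n]) (Y i @^-1` [set y i])).
  apply: fin_bigcap_measurable => // i _.
  by rewrite -[X in measurable X]setTI; apply: measurable_funP.
apply/seteqP; split => w /=; first by move=> <- i _; rewrite /= ffunE.
by move=> h; apply/ffunP => i; rewrite ffunE; exact: h.
Qed.

Lemma measurable_sample_event (D : {ffun 'I_n -> bool} -> set (n.-tuple (p.-tuple R))) :
  (forall y, measurable (D y)) -> measurable [set w | D (Yt w) (Xt w)].
Proof.
move=> mD.
rewrite (_ : [set w | _] = \bigcup_(y in [set: {ffun 'I_n -> bool}])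
   ([set w | Yt w = y] `&` [set w | D y (Xt w)])).
  by apply: fin_bigcup_measurable => // y _; apply: measurableI; [exact: mYt|exact: mpre].
apply/seteqP; split => w /=; first by move=> Dw; exists (Yt w).
by move=> [y _ [<-]].
Qed.

(** The event is split by the observed response vector. On good designs each piece is an integral of
    exp (loglik), and exchanging sum and integral leaves the conditional weight of [D], bounded
    pointwise by [c]. *)
Lemma probability_le_design (D : {ffun 'I_n -> bool} -> set (n.-tuple (p.-tuple R)))
    (G : set (n.-tuple (p.-tuple R))) (c : R) : 0 <= c ->
  (forall y, measurable (D y)) -> measurable G ->
  (forall x, G x -> \sum_(y | `[< D y x >]) expR (loglik (tnth x) y b0) <= c) ->
  (P [set w | D (Yt w) (Xt w)] <= P [set w | ~ G (Xt w)] + c%:E)%E.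
Proof.
move=> c0 mD mG Gc.
pose E (o : unit + {ffun 'I_n -> bool}) : set T := match o with
  | inl _ => [set w | ~ G (Xt w)]
  | inr y => [set w | (G `&` D y) (Xt w) /\ forall i, Y i w = y i] end.
have mE o : measurable (E o).
  case: o => [_|y] /=; first exact: (@mpre (~` G) (measurableC mG)).
  rewrite (_ : [set w | _] = [set w | (G `&` D y) (Xt w)] `&` [set w | Yt w = y]).
    by apply: measurableI; [apply: mpre; exact: measurableI|exact: mYt].
  apply/seteqP; split => w /= [h1 h2]; split => //.
    by apply/ffunP => i; rewrite ffunE.
  by move=> i; rewrite -h2 ffunE.
apply: le_trans (measure_finite_cover P (measurable_sample_event mD) mE _) _.
  move=> w /= Dw; have [Gw|nG] := pselect (G (Xt w)); last by exists (inl tt).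
  by exists (inr (Yt w)) => /=; split => // i; rewrite ffunE.
rewrite big_sumType/= (bigD1 tt)//= big1 ?adde0; last by case.
apply: leeD2l.
under eq_bigr => y _ do rewrite (iid_logistic_law _ sample (measurableI _ _ mG (mD y))).
have mf y : measurable_fun setT (fun w => (expR (loglik (fun i => X i w) y b0))%:E).
  apply/measurable_EFinP; apply: measurableT_comp => //.
  rewrite (_ : (fun w => _) = (fun x => loglik (tnth x) y b0) \o Xt).
    exact: measurableT_comp (measurable_loglik y b0) mXt.
  by apply/funext => w /=; congr loglik; apply/funext => i; rewrite tnth_mktuple.
under eq_bigr => y _ do rewrite integral_mkcond.
have nn (A : set T) y w : (0 <= ((fun w => (expR (loglik (fun i => X i w) y b0))%:E) \_ A) w)%E.
  by rewrite patchE; case: ifP => // _; rewrite lee_fin expR_ge0.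
rewrite -ge0_integral_sum//; last first.
  move=> y; apply/(measurable_restrictT _ _).1; last exact: measurable_funTS.
  by apply: mpre; exact: measurableI.
rewrite -[leRHS]mule1 -(@probability_setT _ _ _ P) -integral_cst//.
apply: ge0_le_integral => //.
- by move=> w _; apply: sume_ge0.
- apply: emeasurable_sum => y; apply/(measurable_restrictT _ _).1; last exact: measurable_funTS.
  by apply: mpre; exact: measurableI.
- move=> w _; have [Gw|nG] := pselect (G (Xt w)); last first.
    rewrite big1 ?lee_fin// => y _; rewrite patchE memNset// => -[].
    by move=> /nG.
  have := Gc _ Gw; rewrite -lee_fin -sumEFin; apply: le_trans.
  rewrite [leRHS]big_mkcond; apply: lee_sum => y _; rewrite patchE.
  have -> : (fun i => X i w) = tnth (Xt w) by apply/funext => i; rewrite tnth_mktuple.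
  case: ifPn => [/set_mem [_ Dy]|_].
    by rewrite asboolT.
  by case: ifP => _; [rewrite lee_fin; exact: expR_ge0|exact: lexx].
Qed.

End conditioning_on_design.

Lemma min_sq_signal_pos (R : realType) p (b : 'rV[R]_p) j : j \in supp b ->
  exists r, [/\ min_sq_signal b = r%:E, 0 < r &
    forall k, k \in supp b -> r <= b ord0 k ^+ 2].
Proof.
move=> jb.
have le k : k \in supp b -> (min_sq_signal b <= (`|b ord0 k| ^+ 2)%:E)%E.
  by move=> kb; apply: (bigmin_le_cond _ (fun k => (`|b ord0 k| ^+ 2)%:E)).
have pos : (0 < min_sq_signal b)%E.
  rewrite /min_sq_signal; elim/big_ind : _ => [|x y x0 y0|k]; first exact: ltry.
    by rewrite lt_min x0 y0.
  by rewrite inE => bk; rewrite lte_fin exprn_gt0// normr_gt0.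
move: (le) pos; case: (min_sq_signal b) => [r||] lek pos //.
  exists r; split => // k kb; rewrite -lee_fin; have := lek k kb.
  by rewrite real_normK ?num_real.
by have := lek j jb; rewrite leye_eq.
Qed.

Theorem theorem2p3 (R : realType) (eps nu a0 a1 a2 a3 : R)
    (heps : 0 < eps) (hnu : 0 < nu)
    (ha0 : 0 < a0) (ha1 : 0 < a1) (ha2 : 0 < a2) (ha3 : 0 < a3) :
  exists C0 C1 C2 C3 : R,
    [/\ 0 < C0, 0 < C1, 0 < C2 & 0 < C3] /\
    forall (gamma : R) (n p q : nat)
      (hgamma : 0 <= gamma) (hn : (2 <= n)%N) (hp : (2 <= p)%N) (hq : (1 <= q)%N)
      (d : measure_display) (T : measurableType d) (P : probability T R)
      (X : 'I_n -> {RV P >-> p.-tuple R}) (Y : 'I_n -> {RV P >-> bool})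
      (beta0 : 'rV[R]_p),
      let J0 := supp beta0 in
      let X1 := X (Ordinal (ltnW hn)) in
      iid_logistic_sample X Y beta0 ->
      norm2 beta0 <= a0 ->
      (#|J0| <= q)%N ->
      (forall u : 'rV[R]_p, sparse (2 * q) u -> norm2 u = 1 ->
         (a1%:E <= 'E_P[(fun w => linpred (X1 w) u ^+ 2)%R])%E) ->
      (forall u : 'rV[R]_p, sparse (2 * q) u -> norm2 u = 1 ->
         ('E_P[(fun w => `|linpred (X1 w) u| ^+ 3)%R] <= a2%:E)%E) ->
      (forall j : 'I_p, {ae P, forall w, `|tnth (X1 w) j| <= a3}) ->
      C0 <= p%:R ->
      (Order.max (C1 * (q%:R ^+ 3 * ln p%:R))%:E
                 (C2%:E * ((q%:R * ln (n%:R * p%:R `^ (2 * gamma)))%:E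
                           / min_sq_signal beta0))
       <= n%:R%:E)%E ->
      p%:R `^ ((1 + eps) * (1 + nu) - gamma) < Num.sqrt n%:R ->
      (((1 - expR (- (C3 * (n%:R / q%:R ^+ 3)))) * (1 - 1 / p%:R `^ nu))%:E
       <= P [set w | unique_BIC_minimizer gamma (fun i => X i w)
                       (fun i => Y i w) q J0])%E.
Proof.
pose kappa := population_curvature a0 a1 a2.
have kappa0 : 0 < kappa by exact: population_curvature_gt0.
pose c1 := kappa / 2; have c1_gt0 : 0 < c1 by rewrite divr_gt0.
pose b := a3 ^+ 2 / 4 + kappa.
have b_gt0 : 0 < b by rewrite addr_gt0// divr_gt0// exprn_gt0.
(* With this constant the concentration exponent n kappa^2 / (16^2 b^2 q^2) is at least (nu + 4) log
   p. The 2 p^2 bad events then cost at most 2 p^(-2) p^(-nu) <= p^(-nu) / 2, as p >= 2. *)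
pose C1' := 16 ^+ 2 * b ^+ 2 * (nu + 4) / kappa ^+ 2.
have C1'_gt0 : 0 < C1'.
  apply: divr_gt0; last exact: exprn_gt0.
  by apply: mulr_gt0; [apply: mulr_gt0; exact: exprn_gt0|rewrite addr_gt0].
have thn := threshold_n_gt0 heps hnu ha3 c1_gt0.
have ths := threshold_signal_gt0 hnu ha0 ha3 c1_gt0.
(* The second constant adds what the fixed-design argument and the concentration of the design ask
   of n. The total failure probability is at most p^(-nu), and the other factor of the claimed
   product is at most 1, so the last constant can be 1. *)
exists (threshold_p eps), (threshold_n eps nu a3 c1 + C1'), (threshold_signal nu a0 a3 c1), 1.
split; first by rewrite expR_gt0 addr_gt0.
move=> gamma n p q hgamma hn hp hq d T P X Y b0 J0 X1 sample b0a J0q A1 A2 A3 largep.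
rewrite ge_max => /andP[]; rewrite lee_fin => largen signal growth.
pose Lam : R := ln p%:R; pose L := ln n%:R + 2 * gamma * Lam.
have n_gt0 : (0 < n)%N := ltnW hn.
have p_gt0 : (0 < p)%N := ltnW hp.
have nR : 0 < n%:R :> R by rewrite ltr0n.
have pR : 0 < p%:R :> R by rewrite ltr0n.
have qR : 1 <= q%:R :> R by rewrite ler1n.
have qR0 : 0 < q%:R :> R by rewrite ltr0n.
have Lam0 : 0 < Lam by rewrite ln_gt0// ltr1n.
have pE : p%:R = expR Lam by rewrite lnK// posrE.
have powE t : p%:R `^ t = expR (t * Lam) by rewrite /powR gt_eqF.
have LE : ln (n%:R * p%:R `^ (2 * gamma)) = L.
  by rewrite lnM ?posrE ?powR_gt0// ln_powR.
(* Twice the logarithm of the growth condition: the terms in gamma move to the side of log n and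
   form the penalty per covariate. *)
have L_large : 2 * ((1 + eps) * (1 + nu) * Lam) < L.
  move: growth; rewrite powE => growth.
  have : expR (((1 + eps) * (1 + nu) - gamma) * Lam) ^+ 2 < n%:R.
    rewrite -[ltRHS]sqr_sqrtr ?ler0n// ltr_sqr ?nnegrE ?expR_ge0 ?sqrtr_ge0//.
  rewrite -expRM_natl -[X in _ < X -> _]lnK ?posrE// ltr_expR /L; lra.
have L0 : 0 <= L.
  apply: ltW; apply: le_lt_trans L_large; rewrite mulr_ge0// mulr_ge0 ?(ltW Lam0)//.
  by rewrite mulr_ge0// addr_ge0// ltW.
have q3 : 0 < q%:R ^+ 3 * Lam by rewrite mulr_gt0 ?exprn_gt0.
move: largen; rewrite mulrDl => largen.
have largen1 : threshold_n eps nu a3 c1 * (q%:R ^+ 3 * Lam) <= n%:R.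
  by apply: le_trans largen; rewrite lerDl mulr_ge0// ltW.
have largen2 : C1' * (q%:R ^+ 3 * Lam) <= n%:R.
  by apply: le_trans largen; rewrite lerDr mulr_ge0// ltW.
have large_signal j : j \in J0 ->
    threshold_signal nu a0 a3 c1 * (q%:R * L) <= n%:R * b0 ord0 j ^+ 2.
  move=> jJ0; have [r [rE r0 rle]] := min_sq_signal_pos jJ0.
  move: signal; rewrite rE LE inver gt_eqF// -!EFinM lee_fin mulrA ler_pdivrMr//.
  by move/le_trans; apply; rewrite ler_pM2l// rle.
have sb0 : sparse (2 * q) b0.
  by rewrite /sparse (leq_trans J0q)// mul2n -addnn leq_addr.
have A1' u : sparse (2 * q) u -> norm2 u = 1 ->
    (a1%:E <= \int[P]_w (linpred (X1 w) u ^+ 2)%:E)%E.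
  by move=> su u1; have := A1 u su u1; rewrite unlock.
have A2' u : sparse (2 * q) u -> norm2 u = 1 ->
    (\int[P]_w (`|linpred (X1 w) u| ^+ 3)%:E <= a2%:E)%E.
  by move=> su u1; have := A2 u su u1; rewrite unlock.
have [G [mG GP PG]] := good_design ha0 ha1 ha2 ha3 b0a sb0 hq sample A1' A2' A3.
pose D (y : {ffun 'I_n -> bool}) : set (n.-tuple (p.-tuple R)) :=
  ~` [set x | unique_BIC_minimizer gamma (tnth x) y q J0].
have mD y : measurable (D y) by apply: measurableC; exact: measurable_unique_BIC.
have Gbound x : G x -> \sum_(y | `[< D y x >]) expR (loglik (tnth x) y b0) <=
    expR (- (nu * Lam)) / 2.
  move=> Gx; have [xa curv] := GP x Gx.
  apply: le_trans (misselection_weight_le heps hnu ha0 ha3 c1_gt0 n_gt0 hp hq b0a J0q xa curv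
    largep largen1 large_signal L_large).
  rewrite le_eqVlt; apply/orP; left; apply/eqP; apply: eq_bigl => y.
  by rewrite /D asbool_neg.
have c0 : 0 <= expR (- (nu * Lam)) / 2 by rewrite divr_ge0 ?expR_ge0.
have := probability_le_design sample c0 mD mG Gbound.
set bad := [set w | D _ _] => Pbad.
have mbad : measurable bad by exact: measurable_sample_event.
have tail : 2 * p%:R ^+ 2 * expR (- (n%:R * (kappa / (4 * q%:R)) ^+ 2 / (16 * b ^+ 2)))
    <= expR (- (nu * Lam)) / 2.
  have e1 : (nu + 4) * Lam <= n%:R * (kappa / (4 * q%:R)) ^+ 2 / (16 * b ^+ 2).
    have -> : n%:R * (kappa / (4 * q%:R)) ^+ 2 / (16 * b ^+ 2) =
      n%:R * (kappa ^+ 2 / (16 ^+ 2 * b ^+ 2 * q%:R ^+ 2)).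
      by field; rewrite !gt_eqF.
    have k2 : 0 < kappa ^+ 2 / (16 ^+ 2 * b ^+ 2 * q%:R ^+ 2).
      apply: divr_gt0; first exact: exprn_gt0.
      by apply: mulr_gt0; [apply: mulr_gt0; exact: exprn_gt0|exact: exprn_gt0].
    apply: le_trans (ler_wpM2r (ltW k2) largen2).
    have -> : C1' * (q%:R ^+ 3 * Lam) * (kappa ^+ 2 / (16 ^+ 2 * b ^+ 2 * q%:R ^+ 2)) =
       (nu + 4) * Lam * q%:R by rewrite /C1'; field; rewrite !gt_eqF.
    by rewrite ler_peMr// mulr_ge0 ?(ltW Lam0)// addr_ge0// ltW.
  apply: (@le_trans _ _ (2 * p%:R ^+ 2 * expR (- ((nu + 4) * Lam)))).
    by rewrite ler_wpM2l ?mulr_ge0 ?exprn_ge0// ler_expR lerN2.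
  have -> : - ((nu + 4) * Lam) = - (nu * Lam) - 4%:R * Lam by ring.
  rewrite expRD expRN (expRN (4%:R * Lam)) (expRM_natl 4) -pE.
  have E0 : 0 < (expR (nu * Lam))^-1 by rewrite invr_gt0 expR_gt0.
  rewrite mulrCA ler_pM2l// -[leRHS]div1r.
  have p2 : 2 <= p%:R :> R by rewrite ler_nat.
  rewrite (_ : 2 * p%:R ^+ 2 / p%:R ^+ 4 = 2 / p%:R ^+ 2); last by field; rewrite gt_eqF.
  rewrite ler_pdivrMr ?exprn_gt0//.
  nra.
have Pbad' : (P bad <= (expR (- (nu * Lam)))%:E)%E.
  apply: (le_trans Pbad); apply: (le_trans (leeD2r _ PG)).
  by rewrite -EFinD lee_fin; lra.
have -> : [set w | unique_BIC_minimizer gamma (fun i => X i w) (fun i => Y i w) q J0] = ~` bad.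
  have XYE w : unique_BIC_minimizer gamma (fun i => X i w) (fun i => Y i w) q J0 =
      unique_BIC_minimizer gamma (tnth [tuple X i w | i < n]) [ffun i => Y i w] q J0.
    have -> : tnth [tuple X i w | i < n] = (fun i => X i w).
      by apply/funext => i; rewrite tnth_mktuple.
    suff -> : [ffun i => Y i w] = (fun i => Y i w) :> ('I_n -> bool) by [].
    by apply/funext => i; rewrite ffunE.
  apply/seteqP; split => w; rewrite /bad /D /setC /= XYE.
    by move=> h; apply.
  by move=> h; apply: contrapT.
rewrite probability_setC// (_ : 1 / p%:R `^ nu = expR (- (nu * Lam))); last first.
  by rewrite powE div1r expRN.
apply: (@le_trans _ _ (1 - (expR (- (nu * Lam)))%:E)%E); last exact: leeB.
rewrite -EFinB lee_fin; set E := expR (- (nu * Lam)); set F := expR _.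
have F0 : 0 < F by exact: expR_gt0.
have E1 : E < 1 by rewrite expR_lt1 oppr_lt0 mulr_gt0.
nra.
Qed.
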